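(* Let $K>0$ and $\rho>0$. Let $P(S,t)$ be the American put option price under the CEV model $dS=\mu S\,dt+\sigma\sqrt{S}\,dW_t$ (with $\mu=r$, $\rho=2r/\sigma^2$, strike $K$, and rescaled time to expiry $t$), with free boundary $\alpha(t)=\alpha(t;\rho)$, $\alpha(0)=K$; that is, $(P,\alpha)$ is the solution of the free boundary problem stated in the context. Then $P$ has the integral representation, for $t>0$ and $S>\alpha(t)$, $$P(S,t)=K-S+\frac{1}{2\pi i}\int_{Br}e^{\theta V}\,Q(\theta,t)\,d\theta,\qquad V=S-\alpha(t),$$ where $\Re(\theta)>0$ on the Bromwich (vertical) contour $Br$, and $$Q(\theta,t)=\frac{K\rho}{\theta^2}\,e^{\alpha(t)\theta}\int_{\theta/\rho}^{\infty}\frac{1}{z+1}\exp\left[-\rho z\,\alpha\left(t+\rho^{-1}\log\left(\frac{\theta+\rho}{\theta}\,\frac{z}{z+1}\right)\right)\right]dz$$ (this formula being read for real $\theta>0$ and continued analytically to $\Re(\theta)>0$). Moreover, the free boundary $\alpha(t)=\alpha(t;\rho)$ satisfies the nonlinear integral equation $$\frac{e^{-K\theta}}{K\rho}=\int_{\theta/\rho}^{\infty}\frac{1}{z+1}\exp\left[-\rho z\,\alpha\left(\rho^{-1}\log\left(\frac{\theta+\rho}{\theta}\,\frac{z}{z+1}\right)\right)\right]dz\qquad\text{for all }\theta>0.$$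
   Context: The asset price $S$ satisfies $dS=\mu S\,dt+\sigma\sqrt{S}\,dW_t$, where $W_t$ is a standard Brownian motion, $\sigma>0$ is the volatility, and $\mu=r>0$ is the risk-free interest rate. An American put with strike $K$ and expiry $T_F$ is considered at time $T_0\le T_F$. Set $t=\frac{\sigma^2}{2}(T_F-T_0)$ and $\rho=\frac{2r}{\sigma^2}$, and write $P(S,t)$ for the price in these variables. The pair $(P,\alpha)$, where $\alpha(t)$ is the free (early exercise) boundary, satisfies the free boundary problem $$P_t=S P_{SS}+\rho S P_S-\rho P,\qquad t>0,\ S>\alpha(t),$$ $$P(S,0)=\max(K-S,0),\qquad P(\alpha(t),t)=K-\alpha(t),\qquad P_S(\alpha(t),t)=-1,\qquad \lim_{S\to\infty}P(S,t)=0,$$ with $\alpha(0)=K$, and $P(S,t)=K-S$ for $0<S<\alpha(t)$. Write $P(S,t)=K-S+\tilde P(V,t)$ with $V=S-\alpha(t)\ge 0$. The function $Q$ is the Laplace transform $Q(\theta,t)=\int_0^\infty e^{-\theta V}\tilde P(V,t)\,dV$; since $\tilde P(V,0)=V$, one has $Q(\theta,0)=1/\theta^2$. The integral over $Br$ is the Laplace inversion integral along a vertical line in $\{\Re(\theta)>0\}$. *)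

(* Defs.v *)
From Stdlib Require Export Reals.
From Coquelicot Require Export Coquelicot.
Open Scope R_scope.

Definition dt (P : R -> R -> R) (S t : R) : R := Derive (fun s => P S s) t.
Definition dS (P : R -> R -> R) (S t : R) : R := Derive (fun x => P x t) S.
Definition dSS (P : R -> R -> R) (S t : R) : R :=
  Derive_n (fun x => P x t) 2 S.

Definition cont2_on (D : R -> R -> Prop) (f : R -> R -> R) : Prop :=
  continuous_on (fun x : R * R => D (fst x) (snd x))
                (fun x : R * R => f (fst x) (snd x)).

(* Classical solutions [(P, alpha)] of the free boundary problem.  [P S t] is
   meaningful for [0 < S] and [0 <= t], [alpha t] for [0 <= t].  As [P] equals
   the payoff below the boundary, the derivative in the smooth-fit condition is
   two-sided.  [dS P] is continuous up to the free boundary for positive times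
   only: it jumps at the corner [(K, 0)].  The price is bounded on every finite
   time horizon, as a put price is; some growth condition is needed for the
   transforms below to make sense uniformly in time. *)
Record american_put_fbp (K rho : R) (P : R -> R -> R) (alpha : R -> R) : Prop :=
  { fbp_alpha_pos : forall t, 0 <= t -> 0 < alpha t;
    fbp_alpha_cont : continuous_on (fun t => 0 <= t) alpha;
    fbp_alpha_C1 :
      forall t, 0 < t -> ex_derive alpha t /\ continuous (Derive alpha) t;

    fbp_cont : cont2_on (fun S t => 0 <= t /\ alpha t <= S) P;
    fbp_dS_cont : cont2_on (fun S t => 0 < t /\ alpha t <= S) (dS P);
    fbp_dSS_cont : cont2_on (fun S t => 0 < t /\ alpha t < S) (dSS P);
    fbp_dt_cont : cont2_on (fun S t => 0 < t /\ alpha t < S) (dt P);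
    fbp_ex_dSS : forall S t, 0 < t -> alpha t < S ->
      ex_derive (fun x => P x t) S /\ ex_derive_n (fun x => P x t) 2 S;
    fbp_ex_dt : forall S t, 0 < t -> alpha t < S ->
      ex_derive (fun s => P S s) t;
    fbp_bounded : forall T, exists M, forall S t,
      0 < S -> 0 <= t <= T -> Rabs (P S t) <= M;

    fbp_pde : forall S t, 0 < t -> alpha t < S ->
      dt P S t = S * dSS P S t + rho * S * dS P S t - rho * P S t;
    fbp_initial : forall S, 0 < S -> P S 0 = Rmax (K - S) 0;
    fbp_value_match : forall t, 0 < t -> P (alpha t) t = K - alpha t;
    fbp_smooth_fit : forall t, 0 < t ->
      is_derive (fun x => P x t) (alpha t) (-1);
    fbp_infinity : forall t, 0 < t -> is_lim (fun S => P S t) p_infty 0;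
    fbp_alpha_0 : alpha 0 = K;
    fbp_exercise : forall S t, 0 < t -> 0 < S < alpha t -> P S t = K - S }.

Definition Ptilde (K : R) (P : R -> R -> R) (alpha : R -> R) (V t : R) : R :=
  P (V + alpha t) t - (K - (V + alpha t)).

Definition Cexp (z : C) : C := (exp (Re z) * cos (Im z), exp (Re z) * sin (Im z)).

Definition is_laplace (f : R -> R) (theta l : C) : Prop :=
  is_RInt_gen (V := C_R_NormedModule)
    (fun V : R => (Cexp (- (theta * RtoC V)) * RtoC (f V))%C)
    (at_point 0) (Rbar_locally p_infty) l.

(* Integral along the upward vertical line [Re theta = c], as the symmetric
   limit of the integrals over [[c - iY, c + iY]]; the factor [Ci] is
   [dtheta/dy]. *)
Definition is_vertical_integral (f : C -> C) (c : R) (l : C) : Prop :=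
  exists I : R -> C,
    (forall Y, 0 <= Y ->
       is_RInt (V := C_R_NormedModule)
         (fun y : R => (f (c, y) * Ci)%C) (- Y) Y (I Y)) /\
    filterlim I (Rbar_locally p_infty) (locally l).

Definition kernel (rho : R) (alpha : R -> R) (theta t z : R) : R :=
  1 / (z + 1) *
  exp (- (rho * z *
    alpha (t + / rho * ln ((theta + rho) / theta * (z / (z + 1)))))).

Definition is_kernel_integral (rho : R) (alpha : R -> R) (theta t l : R) : Prop :=
  is_RInt_gen (kernel rho alpha theta t)
    (at_point (theta / rho)) (Rbar_locally p_infty) l.

(* Main.v *)
Require Import Defs.
From Stdlib Require Import Lra Psatz.

(** Put [p = P - K + S] and [G(th, s) = th^2 * int_{alpha s}^oo e^{- th S} p(S, s) dS].
    The equation for [P] turns into a first order transport equation for [G],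
    whose characteristics are [th = rho z],
    [s(z) = t + ln ((th0 + rho) / th0 * (z / (z + 1))) / rho]; along them
    [- dG/dz = K rho / (z + 1) * e^{- rho z alpha (s(z))}].  As [G] tends to [0] for
    [z -> oo] while [s(z)] stays bounded, integrating in [z] gives both formulas,
    the second one because [G(th, 0) = e^{- K th}].  Neither the derivatives of [P]
    at infinity nor [dSS P] and [dt P] at the free boundary are controlled by the
    hypotheses, so the transport equation is obtained in the limit from integrals
    over [[alpha + eps, r]] against a weight that vanishes to second order at [r].

    The inversion formula is Dirichlet's: the truncated Bromwich integral is the
    integral of [e^{c (x0 - x)} f x] against [2 sin (Y (x - x0)) / (x - x0)], which
    is treated with the Riemann-Lebesgue lemma and [int_0^oo sin x / x dx = PI / 2]. *)

(** * Improper integrals and the complex Laplace transform *)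

(** The weight and the characteristics come from one computation. With [w = exp (- (th * S))], the
    adjoint of [p -> S p'' + rho S p' - rho p] sends [w] to [(th + rho) (th S - 2) w], while the
    derivative of [th^2 w] in [th] is [th (2 - th S) w]. The two cancel when [th] moves with speed
    [th (th + rho)]; the factor [th^2] is what removes the zero-order term. The source [- rho K] is
    all that survives, since value matching and smooth fit annul the boundary terms. Two features of
    the characteristics make this global. Time along one of them stays below a finite horizon, so
    bounds on compact time intervals suffice, and a positive lower bound of [alpha] there forces the
    decay. Time is positive after the start, where the equation holds, and the start itself,
    possibly at time 0, is reached by continuity. The transport argument sees real [theta] only:
    analyticity is read off the Laplace integral, and the kernel, with [alpha] at a logarithm, is
    never evaluated at a complex point. *)

Lemma is_RInt_gen_at_point_infty {V : NormedModule R_AbsRing} (f : R -> V)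
  (I : R -> V) (a : R) (l : V) :
  (forall b, a <= b -> is_RInt f a b (I b)) ->
  filterlim I (Rbar_locally p_infty) (locally l) ->
  is_RInt_gen f (at_point a) (Rbar_locally p_infty) l.
Proof.
intros HI Hl Q HQ.
destruct (Hl Q HQ) as [B HB].
apply (Filter_prod _ _ _ (fun x => x = a) (fun b => Rmax a B < b)).
- reflexivity.
- exists (Rmax a B); intros x Hx; exact Hx.
- intros x b -> Hb. exists (I b). simpl. split.
  + apply HI. pose proof (Rmax_l a B). lra.
  + apply HB. pose proof (Rmax_r a B). lra.
Qed.

Lemma filterlim_is_RInt_gen {V : CompleteNormedModule R_AbsRing} (f : R -> V)
  (I : R -> V) (a : R) (l : V) :
  (forall b, a <= b -> is_RInt f a b (I b)) ->
  is_RInt_gen f (at_point a) (Rbar_locally p_infty) l ->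
  filterlim I (Rbar_locally p_infty) (locally l).
Proof.
intros HI Hl Q HQ.
destruct (Hl Q HQ) as [A B HA [b0 Hb] H].
exists (Rmax a b0). intros b Hb'.
pose proof (Rmax_l a b0). pose proof (Rmax_r a b0).
assert (Hbb : b0 < b) by lra.
destruct (H a b HA (Hb b Hbb)) as [y [Hy Qy]]. simpl in Hy.
assert (E : I b = y).
{ rewrite <- (is_RInt_unique _ _ _ _ Hy). symmetry. apply is_RInt_unique, HI. lra. }
rewrite E. exact Qy.
Qed.

Lemma is_RInt_exp (c a b : R) :
  c <> 0 -> is_RInt (fun x => exp (- (c * x))) a b ((exp (- (c * a)) - exp (- (c * b))) / c).
Proof.
intros Hc.
replace ((exp (- (c * a)) - exp (- (c * b))) / c)
  with (minus (- exp (- (c * b)) / c) (- exp (- (c * a)) / c)).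
2: { unfold minus, plus, opp; simpl. field. exact Hc. }
apply (is_RInt_derive (fun x => - exp (- (c * x)) / c)).
- intros x _. auto_derive; trivial. field. exact Hc.
- intros x _. apply (ex_derive_continuous (fun x => exp (- (c * x)))).
  auto_derive; trivial.
Qed.

Lemma filterlim_exp_opp (c : R) :
  0 < c -> filterlim (fun x => exp (- (c * x))) (Rbar_locally p_infty) (locally 0).
Proof.
intros Hc. change (is_lim (fun x => exp (- (c * x))) p_infty 0).
apply (is_lim_comp exp (fun x => - (c * x)) p_infty 0 m_infty).
- exact is_lim_exp_m.
- replace m_infty with (Rbar_opp (Rbar_mult c p_infty)).
  + apply is_lim_opp, is_lim_scal_l, is_lim_id.
  + simpl. destruct (Rle_dec 0 c); [destruct (Rle_lt_or_eq_dec 0 c r)|]; simpl; try easy; lra.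
- exists 0. easy.
Qed.

Lemma is_RInt_gen_exp (c a : R) :
  0 < c -> is_RInt_gen (fun x => exp (- (c * x))) (at_point a) (Rbar_locally p_infty)
             (exp (- (c * a)) / c).
Proof.
intros Hc.
apply (is_RInt_gen_at_point_infty _ (fun b => (exp (- (c * a)) - exp (- (c * b))) / c)).
- intros b _. apply is_RInt_exp; lra.
- replace (exp (- (c * a)) / c) with ((exp (- (c * a)) - 0) / c) by (field; lra).
  change (is_lim (fun b => (exp (- (c * a)) - exp (- (c * b))) / c) p_infty (Finite ((exp (- (c * a)) - 0) / c))).
  unfold Rdiv.
  apply (is_lim_scal_r _ (/ c) p_infty (Finite (exp (- (c * a)) - 0))).
  apply (is_lim_minus' _ _ p_infty (exp (- (c * a))) 0).
  + apply is_lim_const.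
  + apply filterlim_exp_opp, Hc.
Qed.

(** Domination makes the partial integrals Cauchy. The tail bound is explicit, and depends on [f]
    only through [M] and [c], so that truncation errors can later be made uniform in a parameter of
    [f]. *)
Lemma is_RInt_gen_exp_dominated {V : CompleteNormedModule R_AbsRing} (f : R -> V) (M c a : R) :
  0 < c ->
  (forall x, a <= x -> continuous f x) ->
  (forall x, a <= x -> norm (f x) <= M * exp (- (c * x))) ->
  exists l : V, is_RInt_gen f (at_point a) (Rbar_locally p_infty) l /\
    forall b, a <= b -> norm (minus l (RInt f a b)) <= M / c * exp (- (c * b)).
Proof.
intros Hc Hf HM.
assert (Hex : forall b d, a <= b -> b <= d -> is_RInt f b d (RInt f b d)).
{ intros b d Hb Hd. apply RInt_correct, ex_RInt_continuous.
  intros x Hx. apply Hf. rewrite Rmin_left in Hx; lra. }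
assert (Hdiff : forall b d, a <= b -> b <= d ->
   norm (minus (RInt f a d) (RInt f a b)) <= M / c * (exp (- (c * b)) - exp (- (c * d)))).
{ intros b d Hb Hd.
  replace (minus (RInt f a d) (RInt f a b)) with (RInt f b d).
  - replace (M / c * (exp (- (c * b)) - exp (- (c * d))))
      with (M * ((exp (- (c * b)) - exp (- (c * d))) / c)) by (field; lra).
    apply (norm_RInt_le f (fun x => M * exp (- (c * x))) b d); try easy.
    + intros x Hx. apply HM; lra.
    + now apply Hex.
    + apply (is_RInt_scal (V := R_NormedModule) (fun x => exp (- (c * x)))). apply is_RInt_exp; lra.
  - rewrite <- (RInt_Chasles f a b d).
    + unfold minus. rewrite (plus_comm (RInt f a b)). rewrite <- plus_assoc.
      symmetry. etransitivity; [apply f_equal; apply plus_opp_r | apply plus_zero_r].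
    + exists (RInt f a b). apply Hex; lra.
    + exists (RInt f b d). now apply Hex. }
(* The sign of [M] is forced by the bound at [x = a]. *)
assert (HM0 : 0 <= M).
{ assert (H : 0 <= M * exp (- (c * a))).
{ apply Rle_trans with (norm (f a)); [apply norm_ge_0 | apply HM; lra]. }
  pose proof (exp_pos (- (c * a))). nra. }
assert (HMc : 0 <= M / c) by (apply Rdiv_le_0_compat; lra).
assert (Hcauchy : exists l : V, filterlim (fun b => RInt f a b) (Rbar_locally p_infty) (locally l)).
{ apply (filterlim_locally_cauchy (U := V) (F := Rbar_locally p_infty)). intros eps.
  assert (Hlim := filterlim_exp_opp c Hc).
  (* The [+ 1] keeps the divisor positive when [M = 0]; the same device recurs below. *)
  assert (H0 : 0 < eps / (2 * (M / c + 1))).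
  { apply Rdiv_lt_0_compat; [apply eps | lra]. }
  rewrite filterlim_locally in Hlim.
  destruct (Hlim (mkposreal _ H0)) as [B HB].
  exists (fun x => Rmax a B + 1 <= x). split.
  { exists (Rmax a B + 1). intros x Hx. lra. }
  pose proof (Rmax_l a B). pose proof (Rmax_r a B).
  assert (Key : forall b d, Rmax a B + 1 <= b -> b <= d ->
     norm (minus (RInt f a d) (RInt f a b)) < eps).
  { intros b d Hb Hd. eapply Rle_lt_trans; [apply Hdiff; lra|].
    assert (Hs : exp (- (c * b)) < eps / (2 * (M / c + 1))).
    { assert (HBb : B < b) by lra. specialize (HB b HBb).
      unfold ball in HB; simpl in HB. unfold AbsRing_ball in HB.
      unfold abs, minus, plus, opp in HB; simpl in HB.
      apply Rabs_def2 in HB. lra. }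
    pose proof (exp_pos (- (c * d))).
    apply Rle_lt_trans with ((M / c + 1) * (eps / (2 * (M / c + 1)))).
    - apply Rmult_le_compat; try lra.
      assert (exp (- (c * d)) <= exp (- (c * b))).
      { destruct (Req_dec b d) as [->|]; [lra|]. left. apply exp_increasing. nra. }
      lra.
    - replace ((M / c + 1) * (eps / (2 * (M / c + 1)))) with (eps / 2) by (field; lra).
      pose proof (cond_pos eps). lra. }
  intros u v Hu Hv. apply (norm_compat1 (V := V)).
  destruct (Rle_dec u v) as [Huv|Huv].
  - apply Key; assumption.
  - rewrite <- norm_opp, opp_minus. apply Key; try assumption. lra. }
destruct Hcauchy as [l Hl].
exists l. split.
- apply (is_RInt_gen_at_point_infty f (fun b => RInt f a b)); try assumption.
  intros b Hb. apply Hex; lra.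
- intros b Hb. apply le_epsilon. intros eps Heps.
  destruct (proj1 (filterlim_locally_ball_norm _ _) Hl (mkposreal _ Heps)) as [B HB].
  set (d := Rmax b B + 1).
  assert (Hbd : b <= d) by (unfold d; pose proof (Rmax_l b B); lra).
  assert (HBd : B < d) by (unfold d; pose proof (Rmax_r b B); lra).
  specialize (HB d HBd). unfold ball_norm in HB; simpl in HB.
  pose proof (norm_triangle (minus l (RInt f a d) : V) (minus (RInt f a d) (RInt f a b))) as Htri.
  rewrite (minus_trans (RInt f a d) l (RInt f a b)).
  eapply Rle_trans; [exact Htri|].
  rewrite Rplus_comm. apply Rplus_le_compat.
  + eapply Rle_trans; [apply Hdiff; lra|].
    apply Rmult_le_compat_l; try assumption. pose proof (exp_pos (- (c * d))). lra.
  + rewrite <- norm_opp. rewrite opp_minus. left. exact HB.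
Qed.

(** * Taylor remainders of the real and complex exponential *)

Lemma exp_le_compat (x y : R) : x <= y -> exp x <= exp y.
Proof. intros [H| ->]; [left; now apply exp_increasing | right; reflexivity]. Qed.

Lemma Cmod_Cexp (z : C) : Cmod (Cexp z) = exp (Re z).
Proof.
unfold Cmod, Cexp; simpl fst; simpl snd.
replace ((exp (Re z) * cos (Im z)) ^ 2 + (exp (Re z) * sin (Im z)) ^ 2)
  with (Rsqr (exp (Re z))).
- apply sqrt_Rsqr. left; apply exp_pos.
- pose proof (sin2_cos2 (Im z)) as H. unfold Rsqr in *.
  replace (exp (Re z) * exp (Re z)) with (exp (Re z) * exp (Re z) * (sin (Im z) * sin (Im z) + cos (Im z) * cos (Im z))) by (rewrite H; ring).
  ring.
Qed.

Lemma Cexp_plus (z w : C) : Cexp (z + w) = (Cexp z * Cexp w)%C.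
Proof.
destruct z as [a b], w as [c d].
unfold Cexp, Cplus, Cmult; simpl.
rewrite exp_plus, cos_plus, sin_plus. f_equal; ring.
Qed.

Lemma exp_remainder_1 (a : R) : Rabs (exp a - 1) <= Rabs a * exp (Rabs a).
Proof.
destruct (MVT_gen exp 0 a exp) as [c [Hc E]].
- intros x _. apply is_derive_Reals, derivable_pt_lim_exp.
- intros x _. apply derivable_continuous_pt, derivable_pt_exp.
- rewrite exp_0 in E. rewrite E, Rabs_mult, Rminus_0_r, Rmult_comm.
  apply Rmult_le_compat_l; [apply Rabs_pos|].
  rewrite Rabs_pos_eq by (left; apply exp_pos).
  destruct (Rle_dec c (Rabs a)) as [H|H].
  + now apply exp_le_compat.
  + exfalso. destruct Hc as [_ Hc]. apply H. eapply Rle_trans; [exact Hc|].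
    apply Rmax_lub; [apply Rabs_pos | apply Rle_abs].
Qed.

(** Mean value inequality based at the origin. It bootstraps: a bound on one remainder bounds the
    next one, whose derivative it is, at the price of constants that are not sharp. *)
Lemma Rabs_le_of_derive_le (f df : R -> R) (a M : R) :
  f 0 = 0 -> (forall x, is_derive f x (df x)) ->
  (forall x, Rabs x <= Rabs a -> Rabs (df x) <= M) -> Rabs (f a) <= M * Rabs a.
Proof.
intros H0 Hd HM.
destruct (MVT_gen f 0 a df) as [c [Hc E]].
- intros x _. apply Hd.
- intros x _. apply derivable_continuous_pt. exists (df x). apply is_derive_Reals, Hd.
- rewrite H0 in E. replace (f a) with (f a - 0) by ring. rewrite E, Rminus_0_r, Rabs_mult.
  apply Rmult_le_compat_r; [apply Rabs_pos|]. apply HM.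
  revert Hc. unfold Rmin, Rmax. destruct (Rle_dec 0 a); intros; unfold Rabs;
  repeat destruct Rcase_abs; lra.
Qed.

Lemma Rabs_sin_le (b : R) : Rabs (sin b) <= Rabs b.
Proof.
rewrite <- (Rmult_1_l (Rabs b)).
apply (Rabs_le_of_derive_le sin cos); [apply sin_0| |].
- intros x. apply is_derive_Reals, derivable_pt_lim_sin.
- intros x _. apply Rabs_le, COS_bound.
Qed.

Lemma cos_remainder (b : R) : Rabs (cos b - 1) <= b ^ 2.
Proof.
replace (b ^ 2) with (Rabs b * Rabs b) by (rewrite <- Rabs_mult, Rabs_pos_eq; [ring|nra]).
apply (Rabs_le_of_derive_le (fun b => cos b - 1) (fun b => - sin b)).
- rewrite cos_0; ring.
- intros x. auto_derive; [easy|ring].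
- intros x Hx. rewrite Rabs_Ropp. eapply Rle_trans; [apply Rabs_sin_le | exact Hx].
Qed.

Lemma sin_remainder (b : R) : Rabs (sin b - b) <= b ^ 2 * Rabs b.
Proof.
apply (Rabs_le_of_derive_le (fun b => sin b - b) (fun b => cos b - 1)).
- rewrite sin_0; ring.
- intros x. auto_derive; [easy|ring].
- intros x Hx. eapply Rle_trans; [apply cos_remainder|].
  rewrite <- (pow2_abs x), <- (pow2_abs b). apply pow_incr. split; [apply Rabs_pos|exact Hx].
Qed.

Lemma exp_remainder_2 (a : R) : Rabs (exp a - 1 - a) <= a ^ 2 * exp (Rabs a).
Proof.
replace (a ^ 2) with (Rabs a * Rabs a) by (rewrite <- Rabs_mult, Rabs_pos_eq; [ring|nra]).
replace (Rabs a * Rabs a * exp (Rabs a)) with (Rabs a * exp (Rabs a) * Rabs a) by ring.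
apply (Rabs_le_of_derive_le (fun a => exp a - 1 - a) (fun a => exp a - 1)).
- rewrite exp_0; ring.
- intros x. auto_derive; [easy|ring].
- intros x Hx. eapply Rle_trans; [apply exp_remainder_1|].
  apply Rmult_le_compat; try apply Rabs_pos; try easy.
  + left; apply exp_pos.
  + now apply exp_le_compat.
Qed.

(** Second-order bound behind differentiation under the Laplace integral. With [m] the modulus, each
    coordinate is at most [2 m^2 e^{2m}]; passing to the modulus costs [sqrt 2 <= 2], and 5 leaves
    some slack. *)
Lemma Cexp_remainder (w : C) :
  Cmod (Cexp w - 1 - w) <= 5 * Cmod w ^ 2 * exp (2 * Cmod w).
Proof.
destruct w as [a b]. set (m := Cmod (a, b)).
assert (Ha : Rabs a <= m) by (eapply Rle_trans; [apply Rmax_l|]; apply (Rmax_Cmod (a, b))).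
assert (Hb : Rabs b <= m) by (eapply Rle_trans; [apply Rmax_r|]; apply (Rmax_Cmod (a, b))).
assert (Hm : 0 <= m) by apply Cmod_ge_0.
assert (He1 : 1 <= exp m) by (rewrite <- exp_0; now apply exp_le_compat).
assert (HeA : exp (Rabs a) <= exp m).
{ now apply exp_le_compat. }
assert (Hea : exp a <= exp m).
{ apply exp_le_compat. pose proof (Rle_abs a). lra. }
assert (E2 : exp (2 * m) = exp m * exp m) by (rewrite <- exp_plus; f_equal; ring).
assert (Hmle : m <= exp m) by (pose proof (exp_ineq1_le m); lra).
assert (Ha2 : a ^ 2 <= m ^ 2) by (rewrite <- (pow2_abs a); apply pow_incr; split; [apply Rabs_pos|easy]).
assert (Hb2 : b ^ 2 <= m ^ 2) by (rewrite <- (pow2_abs b); apply pow_incr; split; [apply Rabs_pos|easy]).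
pose proof (exp_remainder_2 a) as H1. pose proof (cos_remainder b) as H2.
pose proof (sin_remainder b) as H3. pose proof (exp_remainder_1 a) as H4.
pose proof (Rabs_sin_le b) as H5.
pose proof (exp_pos a). pose proof (pow2_ge_0 a). pose proof (pow2_ge_0 b).
pose proof (Rabs_pos a). pose proof (Rabs_pos b).
assert (B1 : Rabs (exp a * cos b - 1 - a) <= 2 * (m ^ 2 * exp m)).
{ replace (exp a * cos b - 1 - a) with ((exp a - 1 - a) + exp a * (cos b - 1)) by ring.
  eapply Rle_trans; [apply Rabs_triang|]. rewrite Rabs_mult, (Rabs_pos_eq (exp a)) by lra.
  assert (a ^ 2 * exp (Rabs a) <= m ^ 2 * exp m).
  { apply Rmult_le_compat; try lra. left; apply exp_pos. }
  assert (exp a * Rabs (cos b - 1) <= exp m * m ^ 2).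
  { apply Rmult_le_compat; try lra. apply Rabs_pos. }
  lra. }
assert (B2 : Rabs (exp a * sin b - b) <= 2 * (m ^ 2 * (exp m * exp m))).
{ replace (exp a * sin b - b) with ((exp a - 1) * sin b + (sin b - b)) by ring.
  eapply Rle_trans; [apply Rabs_triang|]. rewrite Rabs_mult.
  assert (Rabs (exp a - 1) * Rabs (sin b) <= (m * exp m) * m).
  { apply Rmult_le_compat; try apply Rabs_pos; try lra.
    eapply Rle_trans; [exact H4|]. apply Rmult_le_compat; try lra. left; apply exp_pos. }
  assert (b ^ 2 * Rabs b <= m ^ 2 * exp m).
  { apply Rmult_le_compat; lra. }
  assert (0 <= m ^ 2) by apply pow2_ge_0.
  assert (m ^ 2 * exp m <= m ^ 2 * (exp m * exp m)) by (apply Rmult_le_compat_l; nra).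
  nra. }
replace (Cexp (a, b) - 1 - (a, b))%C with ((exp a * cos b - 1 - a, exp a * sin b - b) : C).
2: { unfold Cexp, Cminus, Cplus, Copp, RtoC; simpl. f_equal; ring. }
eapply Rle_trans; [apply Cmod_2Rmax|]. simpl fst; simpl snd.
assert (Hs : sqrt 2 <= 2).
{ rewrite <- (sqrt_Rsqr 2) at 2 by lra. apply sqrt_le_1_alt. unfold Rsqr; lra. }
assert (0 <= m ^ 2) by apply pow2_ge_0.
assert (HR : Rmax (Rabs (exp a * cos b - 1 - a)) (Rabs (exp a * sin b - b)) <= 2 * (m ^ 2 * (exp m * exp m))).
{ apply Rmax_lub; [|exact B2]. eapply Rle_trans; [exact B1|].
  apply Rmult_le_compat_l; [lra|]. apply Rmult_le_compat_l; nra. }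
rewrite E2.
assert (0 <= Rmax (Rabs (exp a * cos b - 1 - a)) (Rabs (exp a * sin b - b))).
{ eapply Rle_trans; [|apply Rmax_l]. apply Rabs_pos. }
pose proof (sqrt_pos 2).
assert (0 <= m ^ 2 * (exp m * exp m)) by (apply Rmult_le_pos; nra).
nra.
Qed.

(** Growth below every exponential gives convergence on the whole half-plane [Re theta > 0], and it
    is stable under multiplication by [x], as the derivative of the transform requires. *)
Definition subexp (f : R -> R) : Prop :=
  forall d, 0 < d -> exists M, 0 <= M /\ forall x, 0 <= x -> Rabs (f x) <= M * exp (d * x).

Lemma subexp_linear (f : R -> R) (M : R) :
  (forall x, 0 <= x -> Rabs (f x) <= M + x) -> subexp f.
Proof.
intros H d Hd. exists (Rabs M + / d). pose proof (Rabs_pos M). pose proof (Rinv_0_lt_compat d Hd).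
split; [lra|]. intros x Hx.
eapply Rle_trans; [apply H; easy|].
pose proof (exp_ineq1_le (d * x)). pose proof (Rle_abs M).
assert (x <= / d * (exp (d * x))).
{ replace x with (/ d * (d * x)) at 1 by (field; lra). apply Rmult_le_compat_l; nra. }
assert (1 <= exp (d * x)) by nra. assert (Rabs M <= Rabs M * exp (d * x)) by nra. lra.
Qed.

Lemma subexp_mult_id (f : R -> R) : subexp f -> subexp (fun x => x * f x).
Proof.
intros H d Hd. destruct (H (d / 2)) as [M [HM0 HM]]; [lra|].
pose proof (Rinv_0_lt_compat d Hd).
exists (2 * / d * M). split; [nra|]. intros x Hx.
rewrite Rabs_mult, (Rabs_pos_eq x Hx).
replace (d * x) with (d / 2 * x + d / 2 * x) by field. rewrite exp_plus.
pose proof (exp_ineq1_le (d / 2 * x)).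
assert (x <= 2 * / d * exp (d / 2 * x)).
{ replace x with (2 * / d * (d / 2 * x)) at 1 by (field; lra). apply Rmult_le_compat_l; lra. }
replace (2 * / d * M * (exp (d / 2 * x) * exp (d / 2 * x)))
  with ((2 * / d * exp (d / 2 * x)) * (M * exp (d / 2 * x))) by ring.
apply Rmult_le_compat; auto using Rabs_pos.
Qed.

(** * The complex Laplace transform and its derivative *)

Lemma continuous_C_pair (f g : R -> R) (x : R) :
  continuous f x -> continuous g x ->
  continuous (U := C_R_NormedModule) (fun x => (f x, g x) : C) x.
Proof.
intros Hf Hg.
apply (continuous_comp_2 f g (fun a b => (a, b) : C_R_NormedModule)); try easy.
apply (continuous_ext (fun z : R * R => z)); [now intros []|]. apply continuous_id.
Qed.

Definition laplace_integrand (f : R -> R) (theta : C) (x : R) : C :=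
  (Cexp (- (theta * RtoC x)) * RtoC (f x))%C.

Lemma laplace_integrand_pair (f : R -> R) (a b x : R) :
  laplace_integrand f (a, b) x =
  (exp (- (a * x)) * cos (b * x) * f x, - (exp (- (a * x)) * sin (b * x) * f x)).
Proof.
unfold laplace_integrand, Cexp, Cmult, Copp, RtoC; simpl.
replace (- (a * x - b * 0)) with (- (a * x)) by ring.
replace (- (a * 0 + b * x)) with (- (b * x)) by ring.
rewrite cos_neg, sin_neg. f_equal; ring.
Qed.

Lemma continuous_laplace_integrand (f : R -> R) (theta : C) (x : R) :
  continuous f x -> continuous (U := C_R_NormedModule) (laplace_integrand f theta) x.
Proof.
intros Hf. destruct theta as [a b].
apply (continuous_ext (fun x => (exp (- (a * x)) * cos (b * x) * f x, - (exp (- (a * x)) * sin (b * x) * f x)) : C)).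
- intros y. symmetry. apply laplace_integrand_pair.
- apply continuous_C_pair.
  + apply (continuous_mult (fun x => exp (- (a * x)) * cos (b * x)) f); trivial.
    apply (ex_derive_continuous (fun x => exp (- (a * x)) * cos (b * x))). auto_derive; trivial.
  + apply (continuous_opp (fun x => exp (- (a * x)) * sin (b * x) * f x)).
    apply (continuous_mult (fun x => exp (- (a * x)) * sin (b * x)) f); trivial.
    apply (ex_derive_continuous (fun x => exp (- (a * x)) * sin (b * x))). auto_derive; trivial.
Qed.

Lemma Cmod_laplace_integrand (f : R -> R) (theta : C) (x : R) :
  Cmod (laplace_integrand f theta x) = exp (- (Re theta * x)) * Rabs (f x).
Proof.
unfold laplace_integrand. rewrite Cmod_mult, Cmod_Cexp, Cmod_R. f_equal. f_equal.
destruct theta; simpl; ring.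
Qed.

Definition laplace (f : R -> R) (theta : C) : C :=
  RInt_gen (V := C_R_CompleteNormedModule) (laplace_integrand f theta)
    (at_point 0) (Rbar_locally p_infty).

(** Half of the damping absorbs the growth of the function, the other half remains for
    integration. *)
Lemma exp_mult_le_half (g M a x : R) :
  0 <= x -> Rabs g <= M * exp (a / 2 * x) ->
  exp (- (a * x)) * Rabs g <= M * exp (- (a / 2 * x)).
Proof.
intros Hx H.
replace (- (a / 2 * x)) with (- (a * x) + a / 2 * x) by field. rewrite exp_plus.
pose proof (exp_pos (- (a * x))). nra.
Qed.

(** [M] depends on the real part of [theta] only, so the truncation error is uniform along a
    vertical line; the Bromwich integral relies on this. *)
Lemma laplace_tail (f : R -> R) (a : R) :
  (forall x, continuous f x) -> subexp f -> 0 < a ->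
  exists M, 0 <= M /\ forall theta, Re theta = a ->
    is_RInt_gen (V := C_R_NormedModule) (laplace_integrand f theta)
      (at_point 0) (Rbar_locally p_infty) (laplace f theta) /\
    forall b, 0 <= b ->
      Cmod (laplace f theta - RInt (V := C_R_CompleteNormedModule) (laplace_integrand f theta) 0 b)
      <= M * exp (- (a / 2 * b)).
Proof.
intros Hf Hs Ha.
destruct (Hs (a / 2)) as [M [HM0 HM]]; [lra|].
exists (M / (a / 2)). split; [apply Rdiv_le_0_compat; lra|]. intros theta Htheta.
destruct (is_RInt_gen_exp_dominated (V := C_R_CompleteNormedModule)
  (laplace_integrand f theta) M (a / 2) 0) as [l [Hl Hb]].
- lra.
- intros x Hx. apply continuous_laplace_integrand, Hf.
- intros x Hx. eapply Rle_trans; [right; symmetry; apply Cmod_norm|].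
  rewrite Cmod_laplace_integrand, Htheta. apply exp_mult_le_half; auto.
- assert (E : laplace f theta = l).
  { unfold laplace. apply (is_RInt_gen_unique (V := C_R_CompleteNormedModule)). exact Hl. }
  rewrite E. split; [exact Hl|]. intros b Hb0.
  rewrite Cmod_norm. apply Hb, Hb0.
Qed.

Lemma is_laplace_laplace (f : R -> R) (theta : C) :
  (forall x, continuous f x) -> subexp f -> 0 < Re theta ->
  is_laplace f theta (laplace f theta).
Proof.
intros Hf Hs Ha. destruct (laplace_tail f (Re theta) Hf Hs Ha) as [M [_ H]].
exact (proj1 (H theta eq_refl)).
Qed.

Lemma is_RInt_C_R (f : R -> C) (a b : R) (l : C) :
  is_RInt (V := C_R_NormedModule) f a b l <->
  is_RInt (fun x => fst (f x)) a b (fst l) /\ is_RInt (fun x => snd (f x)) a b (snd l).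
Proof.
split.
- intros H. split.
  + apply (is_RInt_fct_extend_fst (U := R_NormedModule) (V := R_NormedModule) f a b l H).
  + apply (is_RInt_fct_extend_snd (U := R_NormedModule) (V := R_NormedModule) f a b l H).
- intros [H1 H2]. destruct l as [l1 l2].
  apply (is_RInt_fct_extend_pair (U := R_NormedModule) (V := R_NormedModule) f a b l1 l2 H1 H2).
Qed.

(** [C_R_NormedModule] has real scalars, so a complex factor is treated by coordinates. *)
Lemma is_RInt_Cmult_l (f : R -> C) (h : C) (a b : R) (l : C) :
  is_RInt (V := C_R_NormedModule) f a b l ->
  is_RInt (V := C_R_NormedModule) (fun x => h * f x)%C a b (h * l)%C.
Proof.
rewrite !is_RInt_C_R. intros [H1 H2]. destruct h as [h1 h2]. simpl.
split.
- apply (is_RInt_minus (V := R_NormedModule) (fun x => h1 * fst (f x)) (fun x => h2 * snd (f x)));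
  apply (is_RInt_scal (V := R_NormedModule)); assumption.
- apply (is_RInt_plus (V := R_NormedModule) (fun x => h1 * snd (f x)) (fun x => h2 * fst (f x)));
  apply (is_RInt_scal (V := R_NormedModule)); assumption.
Qed.

Lemma is_RInt_gen_Cmult_l (f : R -> C) (h : C) (a : R) (l : C) :
  (forall x, a <= x -> continuous (U := C_R_NormedModule) f x) ->
  is_RInt_gen (V := C_R_NormedModule) f (at_point a) (Rbar_locally p_infty) l ->
  is_RInt_gen (V := C_R_NormedModule) (fun x => h * f x)%C (at_point a) (Rbar_locally p_infty) (h * l)%C.
Proof.
intros Hf Hl.
assert (HI : forall b, a <= b -> is_RInt (V := C_R_NormedModule) f a b
   (RInt (V := C_R_CompleteNormedModule) f a b)).
{ intros b Hb. apply (RInt_correct (V := C_R_CompleteNormedModule)), ex_RInt_continuous.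
  intros x Hx. apply Hf. rewrite Rmin_left in Hx; lra. }
apply (is_RInt_gen_at_point_infty (V := C_R_NormedModule) _
  (fun b => (h * RInt (V := C_R_CompleteNormedModule) f a b)%C)).
- intros b Hb. apply is_RInt_Cmult_l, HI, Hb.
- pose proof (filterlim_is_RInt_gen (V := C_R_CompleteNormedModule) f _ a l HI Hl) as H.
  eapply filterlim_comp; [exact H|].
  apply (filterlim_scal_r (K := C_AbsRing) (V := C_NormedModule) h l).
Qed.

(** With [h] the increment, the defect of the linear approximation is the integral of
    [laplace_integrand f theta x] times the second-order remainder of [Cexp] at [- h x]. It is of
    order [|h|^2] because [x^2 f] is still subexponential. *)
Lemma is_derive_laplace (f : R -> R) (theta : C) :
  (forall x, continuous f x) -> subexp f -> 0 < Re theta ->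
  is_derive (K := C_AbsRing) (V := C_NormedModule) (laplace f) theta
    (- laplace (fun x => (x * f x)%R) theta)%C.
Proof.
intros Hf Hs Ha. set (g := fun x => x * f x).
assert (Hg : forall x, continuous g x).
{ intros x. apply (continuous_mult (fun x => x) f); [apply continuous_id | apply Hf]. }
assert (Hgs : subexp g) by now apply subexp_mult_id.
split; [apply is_linear_scal_l|].
intros y Hy. apply (is_filter_lim_locally_unique (V := AbsRing_NormedModule C_AbsRing)) in Hy.
subst y. intros eps.
set (a := Re theta) in *.
(* Of the decay rate [a], one quarter pays for [x^2 f] and one quarter for the exponential in the
   remainder; [a / 2] is left for the integral. *)
destruct (subexp_mult_id g Hgs (a / 4)) as [M [HM0 HM]]; [lra|].
(* [a / 8] bounds [exp (2 |h| x)] by [exp (a / 4 * x)]. The other term makes the final coefficient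
   [10 M / a * |h|] at most [eps / 2]. *)
set (delta := Rmin (a / 8) (eps * a / (20 * (M + 1)))).
assert (Hd : 0 < delta).
{ pose proof (cond_pos eps). apply Rmin_pos; [lra|]. apply Rdiv_lt_0_compat; nra. }
exists (mkposreal _ Hd). intros w Hw.
set (h := (w - theta)%C).
assert (Hh : Cmod h < delta) by exact Hw.
assert (Hh1 : Cmod h < a / 8) by (eapply Rlt_le_trans; [exact Hh|apply Rmin_l]).
assert (Hh2 : Cmod h < eps * a / (20 * (M + 1))) by (eapply Rlt_le_trans; [exact Hh|apply Rmin_r]).
change (Cmod (laplace f w - laplace f theta - h * - laplace g theta)%C <= eps * Cmod h).
assert (Hwre : 0 < Re w).
{ assert (H : Rabs (Re h) <= Cmod h) by (eapply Rle_trans; [apply Rmax_l|apply Rmax_Cmod]).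
  assert (Re w = a + Re h) by (unfold h, a; destruct w, theta; simpl; ring).
  pose proof (Rle_abs (- Re h)). rewrite Rabs_Ropp in *. lra. }
pose proof (is_laplace_laplace f w Hf Hs Hwre) as I1.
pose proof (is_laplace_laplace f theta Hf Hs Ha) as I2.
pose proof (is_laplace_laplace g theta Hg Hgs Ha) as I3.
apply (is_RInt_gen_Cmult_l _ h) in I3.
2: { intros x _. apply (continuous_laplace_integrand g theta x (Hg x)). }
pose proof (is_RInt_gen_plus (V := C_R_NormedModule) _ _ _ _ (is_RInt_gen_minus (V := C_R_NormedModule) _ _ _ _ I1 I2) I3) as I4.
assert (Ebound : forall x, 0 <= x ->
  Cmod (plus (minus (laplace_integrand f w x) (laplace_integrand f theta x)) (h * laplace_integrand g theta x)%C)
  <= 5 * Cmod h ^ 2 * M * exp (- (a / 2 * x))).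
{ intros x Hx.
  replace (plus (minus (laplace_integrand f w x) (laplace_integrand f theta x)) (h * laplace_integrand g theta x)%C)
    with (laplace_integrand f theta x * (Cexp (- (h * x)) - 1 - (- (h * x))))%C.
  2: { unfold laplace_integrand at 2. replace (- (w * x))%C with (- (theta * x) + - (h * x))%C.
       2: { unfold h. ring. }
       rewrite Cexp_plus. unfold laplace_integrand, g. rewrite RtoC_mult.
       change plus with Cplus. change minus with Cminus. ring. }
  rewrite Cmod_mult, Cmod_laplace_integrand. fold a.
  pose proof (Cexp_remainder (- (h * x))) as Hr.
  rewrite Cmod_opp, Cmod_mult, Cmod_R, (Rabs_pos_eq x Hx) in Hr.
  assert (He : exp (2 * (Cmod h * x)) <= exp (a / 4 * x)).
  { apply exp_le_compat. nra. }
  specialize (HM x Hx). unfold g in HM. rewrite !Rabs_mult, (Rabs_pos_eq x Hx) in HM.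
  pose proof (Cmod_ge_0 h). pose proof (exp_pos (- (a * x))). pose proof (exp_pos (2 * (Cmod h * x))).
  pose proof (Rabs_pos (f x)).
  apply Rle_trans with (exp (- (a * x)) * Rabs (f x) * (5 * (Cmod h * x) ^ 2 * exp (a / 4 * x))).
  { apply Rmult_le_compat_l; [nra|]. eapply Rle_trans; [exact Hr|].
    apply Rmult_le_compat_l; [|exact He]. pose proof (pow2_ge_0 (Cmod h * x)). lra. }
  replace (- (a / 2 * x)) with (- (a * x) + a / 4 * x + a / 4 * x) by field.
  rewrite !exp_plus. pose proof (exp_pos (a / 4 * x)).
  replace (exp (- (a * x)) * Rabs (f x) * (5 * (Cmod h * x) ^ 2 * exp (a / 4 * x)))
    with (5 * Cmod h ^ 2 * exp (- (a * x)) * exp (a / 4 * x) * (x * (x * Rabs (f x)))) by ring.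
  replace (5 * Cmod h ^ 2 * M * (exp (- (a * x)) * exp (a / 4 * x) * exp (a / 4 * x)))
    with (5 * Cmod h ^ 2 * exp (- (a * x)) * exp (a / 4 * x) * (M * exp (a / 4 * x))) by ring.
  apply Rmult_le_compat_l; [|exact HM].
  pose proof (pow2_ge_0 (Cmod h)).
  apply Rmult_le_pos; [|lra]. apply Rmult_le_pos; lra. }
assert (Hfin : Cmod (laplace f w - laplace f theta - h * - laplace g theta)%C
   <= 5 * Cmod h ^ 2 * M * (exp (- (a / 2 * 0)) / (a / 2))).
{ replace (laplace f w - laplace f theta - h * - laplace g theta)%C
    with (laplace f w - laplace f theta + h * laplace g theta)%C by ring.
  rewrite Cmod_norm.
  apply (RInt_gen_norm (V := C_R_CompleteNormedModule) (Fa := at_point 0) (Fb := Rbar_locally p_infty)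
     (fun x => plus (minus (laplace_integrand f w x) (laplace_integrand f theta x)) (h * laplace_integrand g theta x)%C)
     (fun x => 5 * Cmod h ^ 2 * M * exp (- (a / 2 * x)))).
  - apply (Filter_prod _ _ _ (fun x => x = 0) (fun x => 0 < x)); [easy|now exists 0|].
    intros x y -> Hy. simpl. lra.
  - apply (Filter_prod _ _ _ (fun x => x = 0) (fun x => 0 < x)); [easy|now exists 0|].
    intros x y -> Hy z Hz. simpl in Hz.
    eapply Rle_trans; [right; symmetry; apply Cmod_norm|]. apply Ebound; lra.
  - exact I4.
  - apply (is_RInt_gen_scal (V := R_NormedModule)).
    apply is_RInt_gen_exp. lra. }
eapply Rle_trans; [exact Hfin|].
rewrite Rmult_0_r, Ropp_0, exp_0.
pose proof (Cmod_ge_0 h).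
apply Rle_trans with (Cmod h * (10 * M / a) * Cmod h); [apply Req_le; field; lra|].
apply Rmult_le_compat_r; [easy|].
pose proof (cond_pos eps).
apply Rle_trans with (eps * a / (20 * (M + 1)) * (10 * M / a)).
- apply Rmult_le_compat_r; [|lra]. apply Rdiv_le_0_compat; lra.
- replace (eps * a / (20 * (M + 1)) * (10 * M / a)) with (eps * (M / (2 * (M + 1)))) by (field; lra).
  rewrite <- (Rmult_1_r eps) at 2. apply Rmult_le_compat_l; [lra|].
  apply (Rdiv_le_1 M (2 * (M + 1))); lra.
Qed.

(** * Bromwich inversion *)

Definition sinc (x : R) : R := if Req_EM_T x 0 then 1 else sin x / x.

Lemma sinc_mult (x : R) : x * sinc x = sin x.
Proof.
unfold sinc. destruct Req_EM_T as [->|H]; [rewrite sin_0; ring | field; exact H].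
Qed.

Lemma sinc_opp (x : R) : sinc (- x) = sinc x.
Proof.
unfold sinc. destruct (Req_EM_T (- x) 0), (Req_EM_T x 0); try lra.
rewrite sin_neg. field. exact n0.
Qed.

Lemma sinc_le_1 (x : R) : Rabs (sinc x) <= 1.
Proof.
unfold sinc. destruct Req_EM_T as [->|H]; [rewrite Rabs_R1; lra|].
unfold Rdiv. rewrite Rabs_mult, Rabs_inv.
pose proof (Rabs_pos_lt x H). pose proof (Rabs_sin_le x).
apply Rmult_le_reg_r with (Rabs x); [easy|].
rewrite Rmult_assoc, Rinv_l; lra.
Qed.

Lemma continuous_sinc (x : R) : continuous sinc x.
Proof.
destruct (Req_dec x 0) as [->|H].
- apply continuity_pt_filterlim.
  intros eps Heps. exists (Rmin 1 eps).
  split; [apply Rmin_pos; lra|].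
  intros y [_ Hy]. simpl in *. unfold R_dist in *. rewrite Rminus_0_r in Hy.
  pose proof (Rmin_l 1 eps). pose proof (Rmin_r 1 eps).
  unfold sinc at 2. destruct (Req_EM_T 0 0) as [_|]; [|easy].
  unfold sinc. destruct (Req_EM_T y 0) as [->|Hy0]; [rewrite Rminus_diag, Rabs_R0; lra|].
  replace (sin y / y - 1) with ((sin y - y) * / y) by (field; exact Hy0).
  rewrite Rabs_mult, Rabs_inv. pose proof (Rabs_pos_lt y Hy0).
  pose proof (sin_remainder y) as Hs.
  rewrite <- (pow2_abs y) in Hs.
  apply Rle_lt_trans with (Rabs y ^ 2); [|nra].
  apply Rmult_le_reg_r with (Rabs y); [easy|].
  rewrite Rmult_assoc, Rinv_l; lra.
- apply (continuous_ext_loc _ (fun y => sin y / y)).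
  + assert (Hx : 0 < Rabs x) by (now apply Rabs_pos_lt).
    exists (mkposreal _ Hx). intros y Hy. unfold sinc. destruct Req_EM_T as [->|]; [|easy].
    exfalso. unfold ball in Hy; simpl in Hy. unfold AbsRing_ball, abs, minus, plus, opp in Hy; simpl in Hy.
    rewrite Rplus_0_l, Rabs_Ropp in Hy. lra.
  + apply (ex_derive_continuous (fun y => sin y / y)). auto_derive. easy.
Qed.

Lemma continuity_2d_pt_of_1d_fst (f : R -> R) (x y : R) :
  continuous f x -> continuity_2d_pt (fun u _ => f u) x y.
Proof.
intros H. apply (continuity_1d_2d_pt_comp f (fun u _ => u)).
- now apply continuity_pt_filterlim.
- apply continuity_2d_pt_id1.
Qed.

Lemma continuity_2d_pt_of_1d_snd (f : R -> R) (x y : R) :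
  continuous f y -> continuity_2d_pt (fun _ v => f v) x y.
Proof.
intros H. apply (continuity_1d_2d_pt_comp f (fun _ v => v)).
- now apply continuity_pt_filterlim.
- apply continuity_2d_pt_id2.
Qed.

(* For large [X] the derivative is small in mean over [a >= 0], so the value
   [int_0^X sinc] at [a = 0] is close to the limit [PI / 2] at infinity. *)
Lemma is_derive_damped_sinc (X a : R) :
  is_derive (fun a => RInt (fun x => exp (- (a * x)) * sinc x) 0 X + atan a) a
    (exp (- (a * X)) * (cos X + a * sin X) / (1 + a ^ 2)).
Proof.
replace (exp (- (a * X)) * (cos X + a * sin X) / (1 + a ^ 2))
  with (- ((1 - exp (- (a * X)) * (cos X + a * sin X)) / (1 + a ^ 2)) + / (1 + a ^ 2)).
2: { field. pose proof (pow2_ge_0 a). lra. }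
assert (Hd : forall b x, is_derive (fun z : R => exp (- (z * x)) * sinc x) b (- (exp (- (b * x)) * sin x))).
{ intros b x. rewrite <- (sinc_mult x). auto_derive; trivial. ring. }
assert (Hc : forall b x, continuous (fun x => exp (- (b * x)) * sinc x) x).
{ intros b x. apply (continuous_mult (fun x => exp (- (b * x))) sinc).
  - apply (ex_derive_continuous (fun x => exp (- (b * x)))). auto_derive; trivial.
  - apply continuous_sinc. }
apply (is_derive_plus (V := R_NormedModule)).
- assert (HI : is_RInt (fun x => Derive (fun z => exp (- (z * x)) * sinc x) a) 0 X
      (- ((1 - exp (- (a * X)) * (cos X + a * sin X)) / (1 + a ^ 2)))).
  { apply (is_RInt_ext (fun x => - (exp (- (a * x)) * sin x))).
    { intros x _. symmetry. apply is_derive_unique, Hd. }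
    replace (- ((1 - exp (- (a * X)) * (cos X + a * sin X)) / (1 + a ^ 2)))
      with (minus (exp (- (a * X)) * (cos X + a * sin X) / (1 + a ^ 2))
                  (exp (- (a * 0)) * (cos 0 + a * sin 0) / (1 + a ^ 2))).
    - apply (is_RInt_derive (fun x => exp (- (a * x)) * (cos x + a * sin x) / (1 + a ^ 2))).
      + intros x _. auto_derive; trivial.
        change (a * (a * 1)) with (a ^ 2).
        field. pose proof (pow2_ge_0 a). lra.
      + intros x _. apply (ex_derive_continuous (fun x => - (exp (- (a * x)) * sin x))). auto_derive; trivial.
    - rewrite Rmult_0_r, Ropp_0, exp_0, cos_0, sin_0. unfold minus, plus, opp; simpl. field.
      pose proof (pow2_ge_0 a). simpl in *. lra. }
  rewrite <- (is_RInt_unique _ _ _ _ HI).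
  apply (is_derive_RInt_param (fun a x => exp (- (a * x)) * sinc x) 0 X a).
  + apply filter_forall. intros b x _. eexists. apply Hd.
  + intros x _.
    apply (continuity_2d_pt_ext (fun u v => - (exp (- (u * v)) * sin v))).
    { intros u v. symmetry. apply is_derive_unique, Hd. }
    apply continuity_2d_pt_opp, continuity_2d_pt_mult.
    * apply (continuity_1d_2d_pt_comp exp (fun u v => - (u * v))).
      { apply derivable_continuous_pt, derivable_pt_exp. }
      apply continuity_2d_pt_opp, continuity_2d_pt_mult;
        [apply continuity_2d_pt_id1 | apply continuity_2d_pt_id2].
    * apply continuity_2d_pt_of_1d_snd. apply continuous_sin.
  + apply filter_forall. intros b. apply (ex_RInt_continuous (V := R_CompleteNormedModule)).
    intros x _. apply Hc.
- apply is_derive_Reals.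
  apply derivable_pt_lim_atan.
Qed.

Lemma PI2_minus_atan (A : R) : 0 < A -> 0 <= PI / 2 - atan A <= / A.
Proof.
intros HA. rewrite <- (Rinv_inv A) at 1 2.
assert (H := Rinv_0_lt_compat _ HA).
rewrite (atan_inv (/ A) H).
pose proof (atan_increasing 0 (/ A) H) as H1. rewrite atan_0 in H1.
split; [lra|].
replace (PI / 2 - (PI / 2 - atan (/ A))) with (atan (/ A)) by ring.
destruct (MVT_gen atan 0 (/ A) (fun x => / (1 + x ^ 2))) as [c [Hc E]].
- intros x _. apply is_derive_Reals.
  apply derivable_pt_lim_atan.
- intros x _. apply derivable_continuous_pt, derivable_pt_atan.
- rewrite atan_0, !Rminus_0_r in E. rewrite E.
  assert (/ (1 + c ^ 2) <= 1).
  { rewrite <- Rinv_1. pose proof (pow2_ge_0 c). apply Rinv_le_contravar; lra. }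
  nra.
Qed.

(** The damped integral plus [atan] is followed from damping 0 to damping [A]. It changes by at most
    the integral of [2 e^{- X a}], hence by [2 / X], and at [A] it is within [2 / A] of [PI / 2].
    The explicit rate makes the limit usable for [Y * p] with [p] fixed. *)
Lemma sinc_integral_bound (X : R) : 0 < X -> Rabs (RInt sinc 0 X - PI / 2) <= 2 / X.
Proof.
intros HX. apply le_epsilon. intros eps Heps.
set (F := fun a => RInt (fun x => exp (- (a * x)) * sinc x) 0 X).
(* The damped integral at [A] and [PI / 2 - atan A] are each at most [/ A = eps / 2]. *)
set (A := 2 / eps).
assert (HA : 0 < A) by (apply Rdiv_lt_0_compat; lra).
assert (F0 : F 0 = RInt sinc 0 X).
{ apply RInt_ext. intros x _. rewrite Rmult_0_l, Ropp_0, exp_0. apply Rmult_1_l. }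
assert (FA : Rabs (F A) <= / A).
{ unfold F. assert (Hle : norm (F A : R_NormedModule) <= (exp (- (A * 0)) - exp (- (A * X))) / A).
  { apply (norm_RInt_le (V := R_NormedModule) (fun x => exp (- (A * x)) * sinc x) (fun x => exp (- (A * x))) 0 X); [lra| | |].
    - intros x _. change (Rabs (exp (- (A * x)) * sinc x) <= exp (- (A * x))).
      rewrite Rabs_mult, (Rabs_pos_eq (exp _)) by (left; apply exp_pos).
      pose proof (sinc_le_1 x). pose proof (exp_pos (- (A * x))). nra.
    - apply (RInt_correct (V := R_CompleteNormedModule)), (ex_RInt_continuous (V := R_CompleteNormedModule)). intros x _.
      apply (continuous_mult (fun x => exp (- (A * x))) sinc).
      + apply (ex_derive_continuous (fun x => exp (- (A * x)))). auto_derive; trivial.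
      + apply continuous_sinc.
    - apply is_RInt_exp; lra. }
  eapply Rle_trans; [exact Hle|]. rewrite Rmult_0_r, Ropp_0, exp_0.
  pose proof (exp_pos (- (A * X))). pose proof (Rinv_0_lt_compat A HA). unfold Rdiv. nra. }
assert (Hdiff : Rabs ((F A + atan A) - (F 0 + atan 0)) <= 2 / X).
{ assert (Hle : norm (minus (F A + atan A) (F 0 + atan 0) : R_NormedModule)
     <= 2 * ((exp (- (X * 0)) - exp (- (X * A))) / X)).
  { apply (norm_RInt_le (V := R_NormedModule) (fun a => exp (- (a * X)) * (cos X + a * sin X) / (1 + a ^ 2)) (fun a => 2 * exp (- (X * a))) 0 A); [lra| | |].
    - intros a Ha.
      change (Rabs (exp (- (a * X)) * (cos X + a * sin X) / (1 + a ^ 2)) <= 2 * exp (- (X * a))).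
      assert (H2 : 0 < 1 + a ^ 2) by nra.
      unfold Rdiv. rewrite !Rabs_mult, (Rabs_pos_eq (exp _)) by (left; apply exp_pos).
      rewrite Rabs_inv, (Rabs_pos_eq (1 + a ^ 2)) by lra.
      replace (a * X) with (X * a) by ring.
      assert (Rabs (cos X + a * sin X) <= 1 + a).
      { eapply Rle_trans; [apply Rabs_triang|]. apply Rplus_le_compat.
        - apply Rabs_le, COS_bound.
        - rewrite Rabs_mult, (Rabs_pos_eq a) by lra. rewrite <- (Rmult_1_r a) at 2.
          apply Rmult_le_compat_l; [lra|]. apply Rabs_le, SIN_bound. }
      rewrite Rmult_assoc, (Rmult_comm 2). apply Rmult_le_compat_l; [left; apply exp_pos|].
      apply Rmult_le_reg_r with (1 + a ^ 2); [easy|]. rewrite Rmult_assoc, Rinv_l by lra. nra.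
    - apply (is_RInt_derive (V := R_CompleteNormedModule) (fun a => F a + atan a)).
      + intros a _. apply is_derive_damped_sinc.
      + intros a _. apply (ex_derive_continuous (fun a => exp (- (a * X)) * (cos X + a * sin X) / (1 + a ^ 2))).
        auto_derive. nra.
    - apply (is_RInt_scal (V := R_NormedModule) (fun a => exp (- (X * a)))). apply is_RInt_exp; lra. }
  eapply Rle_trans; [exact Hle|]. rewrite Rmult_0_r, Ropp_0, exp_0.
  pose proof (exp_pos (- (X * A))). pose proof (Rinv_0_lt_compat X HX). unfold Rdiv. nra. }
rewrite F0, atan_0 in Hdiff. pose proof (PI2_minus_atan A HA) as Hat.
assert (EA : / A = eps / 2) by (unfold A; field; lra).
rewrite EA in *.
revert FA Hdiff Hat. generalize (2 / X) (F A) (atan A) (RInt sinc 0 X). intros.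
unfold Rabs in *. repeat destruct Rcase_abs; lra.
Qed.

(** This is [sin (Y * x) / x] with its limit [Y] at 0, that is, the integral of [cos (y * x)] for
    [y] from 0 to [Y]. *)
Definition dirichlet (Y x : R) : R := Y * sinc (Y * x).

Lemma dirichlet_mult (Y x : R) : x * dirichlet Y x = sin (Y * x).
Proof. rewrite <- sinc_mult. unfold dirichlet. ring. Qed.

Lemma dirichlet_opp_r (Y x : R) : dirichlet Y (- x) = dirichlet Y x.
Proof. unfold dirichlet. replace (Y * - x) with (- (Y * x)) by ring. now rewrite sinc_opp. Qed.

Lemma dirichlet_opp_l (Y x : R) : dirichlet (- Y) x = - dirichlet Y x.
Proof. unfold dirichlet. replace (- Y * x) with (- (Y * x)) by ring. rewrite sinc_opp. ring. Qed.

Lemma continuous_dirichlet (Y x : R) : continuous (dirichlet Y) x.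
Proof.
apply (continuous_mult (fun _ => Y) (fun x => sinc (Y * x))); [apply continuous_const|].
apply (continuous_comp (fun x => Y * x) sinc); [|apply continuous_sinc].
apply (continuous_mult (fun _ => Y) (fun x => x)); [apply continuous_const|apply continuous_id].
Qed.

Lemma is_derive_dirichlet (Y x : R) : is_derive (fun Y => dirichlet Y x) Y (cos (Y * x)).
Proof.
destruct (Req_dec x 0) as [->|H].
- apply (is_derive_ext (fun Y => Y)).
  + intros y. unfold dirichlet. rewrite Rmult_0_r. unfold sinc. destruct Req_EM_T; [symmetry; apply Rmult_1_r|easy].
  + rewrite Rmult_0_r, cos_0. apply (is_derive_id (K := R_AbsRing)).
- apply (is_derive_ext (fun Y => sin (Y * x) / x)).
  + intros y. rewrite <- dirichlet_mult. change (x * dirichlet y x / x = dirichlet y x :> R). field. exact H.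
  + auto_derive; trivial. field. exact H.
Qed.

Lemma dirichlet_integral (Y q : R) : RInt (dirichlet Y) 0 q = RInt sinc 0 (Y * q).
Proof.
unfold dirichlet.
assert (H := RInt_comp_lin (V := R_CompleteNormedModule) sinc Y 0 0 q).
rewrite Rmult_0_r, !Rplus_0_r in H. rewrite <- H.
- apply RInt_ext. intros x _. now rewrite Rplus_0_r.
- apply (ex_RInt_continuous (V := R_CompleteNormedModule)). intros; apply continuous_sinc.
Qed.

Lemma ex_RInt_dirichlet (Y a b : R) : ex_RInt (dirichlet Y) a b.
Proof. apply (ex_RInt_continuous (V := R_CompleteNormedModule)). intros; apply continuous_dirichlet. Qed.

Lemma dirichlet_integral_symmetric (Y p q : R) : 0 < Y -> 0 < p -> 0 < q ->
  Rabs (RInt (dirichlet Y) (- p) q - PI) <= (2 / p + 2 / q) / Y.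
Proof.
intros HY Hp Hq.
rewrite <- (RInt_Chasles (dirichlet Y) (- p) 0 q) by apply ex_RInt_dirichlet.
assert (E : RInt (dirichlet Y) (- p) 0 = RInt (dirichlet Y) 0 p).
{ assert (H := RInt_comp_lin (V := R_CompleteNormedModule) (dirichlet Y) (-1) 0 p 0).
  replace (-1 * p + 0) with (- p) in H by ring. replace (-1 * 0 + 0) with 0 in H by ring.
  rewrite <- H by apply ex_RInt_dirichlet.
  rewrite <- (opp_RInt_swap (V := R_CompleteNormedModule) (dirichlet Y) p 0) by apply ex_RInt_dirichlet.
  rewrite <- (RInt_opp (V := R_CompleteNormedModule) (dirichlet Y)) by apply ex_RInt_dirichlet.
  apply RInt_ext. intros x _. rewrite Rplus_0_r.
  replace (-1 * x) with (- x) by ring. rewrite dirichlet_opp_r.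
  change (-1 * dirichlet Y x = - dirichlet Y x). ring. }
rewrite E, !dirichlet_integral.
pose proof (sinc_integral_bound (Y * p)) as H1. pose proof (sinc_integral_bound (Y * q)) as H2.
replace (2 / (Y * p)) with (2 / p / Y) in H1 by (field; lra).
replace (2 / (Y * q)) with (2 / q / Y) in H2 by (field; lra).
assert (0 < Y * p) by nra. assert (0 < Y * q) by nra.
specialize (H1 ltac:(easy)). specialize (H2 ltac:(easy)).
change plus with Rplus.
replace (RInt sinc 0 (Y * p) + RInt sinc 0 (Y * q) - PI)
  with ((RInt sinc 0 (Y * p) - PI / 2) + (RInt sinc 0 (Y * q) - PI / 2)) by field.
eapply Rle_trans; [apply Rabs_triang|]. unfold Rdiv in *. lra.
Qed.

(** * Riemann-Lebesgue lemma and localization of the Dirichlet integral *)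

Ltac eq_in_R := match goal with |- @eq _ ?a ?b => change (@eq R a b) end.

Lemma ex_RInt_cont (f : R -> R) (a b : R) : (forall x, continuous f x) -> ex_RInt f a b.
Proof. intros H. apply (ex_RInt_continuous (V := R_CompleteNormedModule)). intros; apply H. Qed.

Lemma exp_eventually_small (M c eps b0 : R) : 0 <= M -> 0 < c -> 0 < eps ->
  exists b, b0 <= b /\ forall x, b <= x -> M * exp (- (c * x)) < eps.
Proof.
intros HM Hc Heps.
assert (H0 : 0 < eps / (M + 1)) by (apply Rdiv_lt_0_compat; lra).
pose proof (filterlim_exp_opp c Hc) as H. rewrite filterlim_locally in H.
destruct (H (mkposreal _ H0)) as [B HB].
exists (Rmax b0 (B + 1)). split; [apply Rmax_l|]. intros x Hx.
pose proof (Rmax_r b0 (B + 1)).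
assert (HBx : B < x) by lra. specialize (HB x HBx).
unfold ball in HB; simpl in HB. unfold AbsRing_ball, abs, minus, plus, opp in HB; simpl in HB.
apply Rabs_def2 in HB.
assert (Hlt : exp (- (c * x)) < eps / (M + 1)) by lra.
pose proof (exp_pos (- (c * x))).
apply Rle_lt_trans with ((M + 1) * exp (- (c * x))); [nra|].
replace eps with ((M + 1) * (eps / (M + 1))) by (field; lra). apply Rmult_lt_compat_l; lra.
Qed.

Lemma continuous_RInt_param (f : R -> R -> R) (a b c : R) :
  a <= b ->
  (forall x, a <= x <= b -> continuity_2d_pt f c x) ->
  locally c (fun y => ex_RInt (f y) a b) ->
  continuous (fun y => RInt (f y) a b) c.
Proof.
intros Hab Hf [d0 Hex].
apply filterlim_locally. intros eps.
assert (He : 0 < eps / (b - a + 1)) by (apply Rdiv_lt_0_compat; [apply eps|lra]).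
destruct (uniform_continuity_2d_1d' f a b c Hf (mkposreal _ He)) as [d Hd]. simpl in Hd.
pose proof (cond_pos d) as Hdp.
assert (Hm : 0 < Rmin d0 d) by (apply Rmin_pos; [apply d0|easy]).
exists (mkposreal _ Hm). intros y Hy.
assert (Hy1 : Rabs (y - c) < Rmin d0 d) by exact Hy.
pose proof (Rmin_l d0 d). pose proof (Rmin_r d0 d).
assert (Exy : ex_RInt (f y) a b).
{ apply Hex. change (Rabs (y - c) < d0). lra. }
assert (Exc : ex_RInt (f c) a b) by (apply Hex, ball_center).
change (Rabs (RInt (f y) a b - RInt (f c) a b) < eps).
change (Rabs (minus (RInt (f y) a b) (RInt (f c) a b)) < eps).
rewrite <- (RInt_minus (V := R_CompleteNormedModule) (f y) (f c)) by easy.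
apply Rle_lt_trans with ((b - a) * (eps / (b - a + 1))).
- apply abs_RInt_le_const; [easy| |].
  + now apply (ex_RInt_minus (V := R_NormedModule)).
  + intros x Hx. left. apply Rabs_def2 in Hy1.
    apply (Hd x c x y); try lra. rewrite Rminus_diag, Rabs_R0. easy.
- pose proof (cond_pos eps).
  replace (pos eps) with ((b - a + 1) * (eps / (b - a + 1))) at 2 by (field; lra).
  apply Rmult_lt_compat_r; lra.
Qed.

(** Shifting by the half-period [PI / Y] changes the sign of the sine. Twice the integral is
    therefore the integral of an increment of [h] against the sine, small by uniform continuity,
    plus two end pieces of length [PI / Y]. Continuity of [h] is enough for this. *)
Lemma riemann_lebesgue (h : R -> R) (a b x0 : R) :
  a <= b -> (forall x, continuous h x) ->
  forall eps, 0 < eps -> exists Y0, 0 < Y0 /\ forall Y, Y0 <= Y ->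
    Rabs (RInt (fun x => h x * sin (Y * (x - x0))) a b) <= eps.
Proof.
intros Hab Hh eps Heps.
destruct (bounded_continuity (V := R_NormedModule) h a (b + 1)) as [M HM].
{ intros x _. apply Hh. }
assert (HM' : forall x, a <= x <= b + 1 -> Rabs (h x) <= M) by (intros; left; now apply HM).
assert (HM0 : 0 <= M).
{ apply Rle_trans with (Rabs (h a)); [apply Rabs_pos|apply HM'; lra]. }
assert (He : 0 < eps / (b - a + 1)) by (apply Rdiv_lt_0_compat; lra).
destruct (unifcont_normed_1d (V := R_NormedModule) h a (b + 1) (fun x _ => Hh x) (mkposreal _ He)) as [d Hd].
(* For [Y >= Y0] the shift is at most 1, so that shifted points stay in [[a, b + 1]] where [M]
   applies, at most [d / 2] for uniform continuity, and small enough that the end pieces contribute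
   at most [eps]. *)
set (Y0 := PI / Rmin (Rmin 1 (d / 2)) (eps / (2 * M + 1))).
assert (Hd0 := cond_pos d). assert (HPI := PI_RGT_0).
assert (Hm : 0 < Rmin (Rmin 1 (d / 2)) (eps / (2 * M + 1))).
{ repeat apply Rmin_pos; try lra. apply Rdiv_lt_0_compat; lra. }
assert (HY0 : 0 < Y0) by (apply Rdiv_lt_0_compat; lra).
exists Y0. split; [easy|]. intros Y HY.
set (del := PI / Y).
assert (Hdel0 : 0 < del) by (apply Rdiv_lt_0_compat; lra).
assert (Hdel : del <= Rmin (Rmin 1 (d / 2)) (eps / (2 * M + 1))).
{ unfold del. apply Rmult_le_reg_r with Y; [lra|]. unfold Rdiv at 1. rewrite Rmult_assoc, Rinv_l, Rmult_1_r by lra.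
  replace PI with (Rmin (Rmin 1 (d / 2)) (eps / (2 * M + 1)) * Y0) at 1 by (unfold Y0; field; lra).
  apply Rmult_le_compat_l; lra. }
assert (Hdel1 : del <= 1 /\ del <= d / 2 /\ del <= eps / (2 * M + 1)).
{ pose proof (Rmin_l (Rmin 1 (d / 2)) (eps / (2 * M + 1))).
  pose proof (Rmin_r (Rmin 1 (d / 2)) (eps / (2 * M + 1))).
  pose proof (Rmin_l 1 (d / 2)). pose proof (Rmin_r 1 (d / 2)). lra. }
set (s := fun x => sin (Y * (x - x0))).
set (k := fun x => h (x + del) * s x).
set (J := RInt (fun x => h x * s x) a b).
assert (Cs : forall x, continuous s x).
{ intros x. apply (ex_derive_continuous s). unfold s. auto_derive; trivial. }
assert (Chs : forall x, continuous (fun x => h x * s x) x).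
{ intros x. apply (continuous_mult h s); auto. }
assert (Ch2 : forall x, continuous (fun x => h (x + del)) x).
{ intros x. apply (continuous_comp (fun x => x + del) h); [|apply Hh].
  apply (ex_derive_continuous (fun x => x + del)). auto_derive; trivial. }
assert (Ck : forall x, continuous k x).
{ intros x. apply (continuous_mult (fun x => h (x + del)) s); auto. }
assert (E1 : J = - RInt k (a - del) (b - del)).
{ unfold J. assert (H := RInt_comp_lin (V := R_CompleteNormedModule) (fun x => h x * s x) 1 del (a - del) (b - del)).
  replace (1 * (a - del) + del) with a in H by ring. replace (1 * (b - del) + del) with b in H by ring.
  rewrite <- H by now apply ex_RInt_cont.
  change (- RInt k (a - del) (b - del)) with (opp (RInt k (a - del) (b - del))).
  rewrite <- (RInt_opp (V := R_CompleteNormedModule) k) by now apply ex_RInt_cont.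
  apply RInt_ext. intros x _.
  change (1 * (h (1 * x + del) * s (1 * x + del)) = - (h (x + del) * s x)).
  rewrite !Rmult_1_l.
  replace (s (x + del)) with (- s x); [ring|].
  unfold s. replace (Y * (x + del - x0)) with (Y * (x - x0) + PI) by (unfold del; field; lra).
  now rewrite neg_sin. }
assert (E2 : RInt k (a - del) (b - del) = RInt k (a - del) a + RInt k a b - RInt k (b - del) b).
{ rewrite <- (RInt_Chasles k (a - del) a (b - del)) by now apply ex_RInt_cont.
  rewrite <- (RInt_Chasles k a b (b - del)) by now apply ex_RInt_cont.
  rewrite <- (opp_RInt_swap (V := R_CompleteNormedModule) k (b - del) b) by now apply ex_RInt_cont.
  change plus with Rplus. change opp with Ropp. eq_in_R. ring. }
assert (E3 : J - RInt k a b = RInt (fun x => (h x - h (x + del)) * s x) a b).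
{ unfold J. change (minus (RInt (fun x => h x * s x) a b) (RInt k a b) = RInt (fun x => (h x - h (x + del)) * s x) a b).
  rewrite <- (RInt_minus (V := R_CompleteNormedModule)) by now apply ex_RInt_cont.
  apply RInt_ext. intros x _. change (h x * s x - h (x + del) * s x = (h x - h (x + del)) * s x). ring. }
assert (Hs1 : forall x, Rabs (s x) <= 1) by (intros; apply Rabs_le, SIN_bound).
assert (Hk : forall x, a - del <= x <= b -> Rabs (k x) <= M).
{ intros x Hx. unfold k. rewrite Rabs_mult.
  pose proof (Hs1 x). pose proof (HM' (x + del)). pose proof (Rabs_pos (s x)). pose proof (Rabs_pos (h (x + del))).
  assert (Rabs (h (x + del)) <= M) by (apply H0; lra). nra. }
assert (B1 : Rabs (RInt k (a - del) a) <= (a - (a - del)) * M).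
{ apply abs_RInt_le_const; [lra| now apply ex_RInt_cont |]. intros; apply Hk; lra. }
assert (B2 : Rabs (RInt k (b - del) b) <= (b - (b - del)) * M).
{ apply abs_RInt_le_const; [lra| now apply ex_RInt_cont |]. intros; apply Hk; lra. }
assert (B3 : Rabs (J - RInt k a b) <= (b - a) * (eps / (b - a + 1))).
{ rewrite E3. apply abs_RInt_le_const; [lra| |].
  - apply ex_RInt_cont. intros x. apply (continuous_mult (fun x => h x - h (x + del)) s); auto.
    apply (continuous_minus (V := R_NormedModule) h (fun x => h (x + del))); auto.
  - intros x Hx. rewrite Rabs_mult.
    assert (Hb : Rabs (h (x + del) - h x) < eps / (b - a + 1)).
    { apply (Hd x (x + del)); try lra.
      change (Rabs (x + del - x) < d). replace (x + del - x) with del by ring. rewrite Rabs_pos_eq; lra. }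
    rewrite Rabs_minus_sym in Hb. pose proof (Hs1 x). pose proof (Rabs_pos (s x)). pose proof (Rabs_pos (h x - h (x + del))). nra. }
assert (B4 : (b - a) * (eps / (b - a + 1)) <= eps).
{ replace eps with ((b - a + 1) * (eps / (b - a + 1))) at 2 by (field; lra). apply Rmult_le_compat_r; lra. }
assert (B5 : 2 * del * M <= eps).
{ apply Rle_trans with (eps / (2 * M + 1) * (2 * M)); [nra|].
  replace eps with (eps / (2 * M + 1) * (2 * M + 1)) at 2 by (field; lra).
  apply Rmult_le_compat_l; [|lra]. apply Rdiv_le_0_compat; lra. }
change (Rabs J <= eps).
assert (E4 : 2 * J = (J - RInt k a b) - RInt k (a - del) a + RInt k (b - del) b).
{ replace (2 * J) with (J + J) by ring. rewrite E1 at 2. rewrite E2. ring. }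
revert B1 B2 B3 E4. generalize J (RInt k a b) (RInt k (a - del) a) (RInt k (b - del) b).
intros J' r1 r2 r3. unfold Rabs. repeat destruct Rcase_abs; intros; nra.
Qed.

Lemma continuous_difference_quotient (g : R -> R) (l x0 : R) :
  (forall x, continuous g x) -> is_derive g x0 l ->
  forall x, continuous (fun x => if Req_EM_T x x0 then l else (g x - g x0) / (x - x0)) x.
Proof.
intros Hg Hl x. destruct (Req_dec x x0) as [->|H].
- apply continuity_pt_filterlim. intros eps Heps.
  apply is_derive_Reals in Hl. destruct (Hl eps Heps) as [d Hd].
  exists d. split; [apply d|]. intros y [_ Hy]. simpl in *. unfold R_dist in *.
  destruct (Req_EM_T x0 x0); [|easy].
  destruct (Req_EM_T y x0) as [->|Hy0]; [rewrite Rminus_diag, Rabs_R0; lra|].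
  specialize (Hd (y - x0)). replace (x0 + (y - x0)) with y in Hd by ring. apply Hd; [lra|easy].
- apply (continuous_ext_loc _ (fun y => (g y - g x0) / (y - x0))).
  + assert (Hx : 0 < Rabs (x - x0)) by (apply Rabs_pos_lt; lra).
    exists (mkposreal _ Hx). intros y Hy. destruct Req_EM_T as [->|]; [|easy].
    exfalso. change (Rabs (x0 - x) < Rabs (x - x0)) in Hy. rewrite Rabs_minus_sym in Hy. lra.
  + apply (continuous_mult (fun y => g y - g x0) (fun y => / (y - x0))).
    * apply (continuous_minus (V := R_NormedModule) g (fun _ => g x0)); [apply Hg|apply continuous_const].
    * apply (ex_derive_continuous (fun y => / (y - x0))). auto_derive. lra.
Qed.

Lemma continuous_shifted_dirichlet (Y x0 x : R) : continuous (fun x => dirichlet Y (x - x0)) x.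
Proof.
apply (continuous_comp (fun x => x - x0) (dirichlet Y)); [|apply continuous_dirichlet].
apply (ex_derive_continuous (fun x => x - x0)). auto_derive; trivial.
Qed.

(** Subtracting the constant [g x0] turns [g] times the Dirichlet kernel into a difference quotient
    times a sine, to which Riemann-Lebesgue applies. Differentiability at [x0] makes that quotient
    continuous; the constant part tends to [PI * g x0]. *)
Lemma dirichlet_localization (g : R -> R) (x0 b : R) :
  (forall x, continuous g x) -> ex_derive g x0 -> 0 < x0 < b ->
  forall eps, 0 < eps -> exists Y0, 0 < Y0 /\ forall Y, Y0 <= Y ->
    Rabs (RInt (fun x => g x * dirichlet Y (x - x0)) 0 b - PI * g x0) <= eps.
Proof.
intros Hg [l Hl] Hx0 eps Heps.
set (h := fun x => if Req_EM_T x x0 then l else (g x - g x0) / (x - x0)).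
assert (Hh : forall x, continuous h x) by (now apply continuous_difference_quotient).
destruct (riemann_lebesgue h 0 b x0 ltac:(lra) Hh (eps / 2) ltac:(lra)) as [Y1 [HY1 HR]].
set (m := Rabs (g x0) * (2 / x0 + 2 / (b - x0))).
assert (Hm : 0 <= m).
{ apply Rmult_le_pos; [apply Rabs_pos|]. apply Rplus_le_le_0_compat; apply Rdiv_le_0_compat; lra. }
assert (H2m : 0 <= 2 * m / eps) by (apply Rdiv_le_0_compat; lra).
(* The second summand forces [m / Y <= eps / 2], where [m / Y] is the error of the constant part. *)
exists (Y1 + 2 * m / eps). split; [lra|]. intros Y HY.
assert (HYp : 0 < Y) by lra.
specialize (HR Y ltac:(lra)).
assert (E : RInt (fun x => g x * dirichlet Y (x - x0)) 0 b
   = RInt (fun x => h x * sin (Y * (x - x0))) 0 b + g x0 * RInt (dirichlet Y) (- x0) (b - x0)).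
{ assert (H := RInt_comp_lin (V := R_CompleteNormedModule) (dirichlet Y) 1 (- x0) 0 b).
  replace (1 * 0 + - x0) with (- x0) in H by ring. replace (1 * b + - x0) with (b - x0) in H by ring.
  rewrite <- H by apply ex_RInt_dirichlet.
  rewrite (RInt_ext (fun y => scal 1 (dirichlet Y (1 * y + - x0))) (fun x => dirichlet Y (x - x0))).
  2: { intros x _. change (1 * dirichlet Y (1 * x + - x0) = dirichlet Y (x - x0)).
       rewrite !Rmult_1_l. reflexivity. }
  change (g x0 * RInt (fun x => dirichlet Y (x - x0)) 0 b)
    with (scal (g x0) (RInt (V := R_CompleteNormedModule) (fun x => dirichlet Y (x - x0)) 0 b)).
  rewrite <- (RInt_scal (V := R_CompleteNormedModule)).
  2: { apply ex_RInt_cont, continuous_shifted_dirichlet. }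
  change Rplus with (@plus R_AbelianGroup).
  rewrite <- (RInt_plus (V := R_CompleteNormedModule)).
  - apply RInt_ext. intros x _.
    change (g x * dirichlet Y (x - x0) = h x * sin (Y * (x - x0)) + g x0 * dirichlet Y (x - x0)).
    rewrite <- dirichlet_mult. unfold h. destruct Req_EM_T as [->|]; [ring|field; lra].
  - apply ex_RInt_cont. intros x. apply (continuous_mult h (fun x => sin (Y * (x - x0)))); [apply Hh|].
    apply (ex_derive_continuous (fun x => sin (Y * (x - x0)))). auto_derive; trivial.
  - apply (ex_RInt_scal (V := R_NormedModule)). apply ex_RInt_cont, continuous_shifted_dirichlet. }
rewrite E.
pose proof (dirichlet_integral_symmetric Y x0 (b - x0) HYp ltac:(lra) ltac:(lra)) as HD.
replace (RInt (fun x => h x * sin (Y * (x - x0))) 0 b + g x0 * RInt (dirichlet Y) (- x0) (b - x0) - PI * g x0)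
  with (RInt (fun x => h x * sin (Y * (x - x0))) 0 b + g x0 * (RInt (dirichlet Y) (- x0) (b - x0) - PI)) by ring.
eapply Rle_trans; [apply Rabs_triang|]. rewrite Rabs_mult.
assert (Hlast : Rabs (g x0) * Rabs (RInt (dirichlet Y) (- x0) (b - x0) - PI) <= eps / 2).
{ apply Rle_trans with (m / Y).
  - unfold m, Rdiv at 1. rewrite Rmult_assoc. apply Rmult_le_compat_l; [apply Rabs_pos|exact HD].
  - apply Rmult_le_reg_r with Y; [easy|]. unfold Rdiv at 1. rewrite Rmult_assoc, Rinv_l, Rmult_1_r by lra.
    replace m with (eps / 2 * (2 * m / eps)) by (field; lra). apply Rmult_le_compat_l; lra. }
lra.
Qed.

(** * The truncated inversion integral *)

Lemma continuity_2d_pt_trig (T : R -> R) (g : R -> R) (x0 y x : R) :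
  (forall x, continuous T x) -> (forall x, continuous g x) ->
  continuity_2d_pt (fun y x => g x * T (y * (x - x0))) y x.
Proof.
intros HT Hg. apply continuity_2d_pt_mult; [now apply continuity_2d_pt_of_1d_snd|].
apply (continuity_1d_2d_pt_comp T (fun y x => y * (x - x0))).
- apply continuity_pt_filterlim, HT.
- apply continuity_2d_pt_mult; [apply continuity_2d_pt_id1|].
  apply continuity_2d_pt_minus; [apply continuity_2d_pt_id2|apply continuity_2d_pt_const].
Qed.

Lemma continuous_trig_modulation (T : R -> R) (g : R -> R) (x0 y x : R) :
  (forall x, continuous T x) -> (forall x, continuous g x) ->
  continuous (fun x => g x * T (y * (x - x0))) x.
Proof.
intros HT Hg. apply (continuous_mult g (fun x => T (y * (x - x0)))); [apply Hg|].
apply (continuous_comp (fun x => y * (x - x0)) T); [|apply HT].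
apply (ex_derive_continuous (fun x => y * (x - x0))). auto_derive; trivial.
Qed.

(** The order of integration is exchanged by differentiation under the integral: the Dirichlet
    integral [W], as a function of [Y], is a primitive of the cosine transform, and it is odd. *)
Lemma cosine_transform_symmetric_integral (g : R -> R) (x0 b Y : R) :
  (forall x, continuous g x) -> 0 <= b ->
  is_RInt (fun y => RInt (fun x => g x * cos (y * (x - x0))) 0 b) (- Y) Y
    (2 * RInt (fun x => g x * dirichlet Y (x - x0)) 0 b).
Proof.
intros Hg Hb.
set (W := fun Y => RInt (fun x => g x * dirichlet Y (x - x0)) 0 b).
assert (HexW : forall Y, ex_RInt (fun x => g x * dirichlet Y (x - x0)) 0 b).
{ intros Z. apply ex_RInt_cont. intros x.
  apply (continuous_mult g (fun x => dirichlet Z (x - x0))); [apply Hg|apply continuous_shifted_dirichlet]. }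
assert (Hodd : W (- Y) = - W Y).
{ unfold W. change (- RInt (fun x => g x * dirichlet Y (x - x0)) 0 b)
    with (opp (RInt (V := R_CompleteNormedModule) (fun x => g x * dirichlet Y (x - x0)) 0 b)).
  rewrite <- (RInt_opp (V := R_CompleteNormedModule)) by apply HexW.
  apply RInt_ext. intros x _.
  change (g x * dirichlet (- Y) (x - x0) = - (g x * dirichlet Y (x - x0))).
  rewrite dirichlet_opp_l. ring. }
replace (2 * RInt (fun x => g x * dirichlet Y (x - x0)) 0 b) with (minus (W Y) (W (- Y))).
2: { rewrite Hodd. change (W Y - - W Y = 2 * W Y). ring. }
assert (Hd : forall z x, is_derive (fun z : R => g x * dirichlet z (x - x0)) z (g x * cos (z * (x - x0)))).
{ intros z x. apply (is_derive_scal (fun z => dirichlet z (x - x0)) z (g x) (cos (z * (x - x0)))).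
  apply is_derive_dirichlet. }
apply (is_RInt_derive (V := R_CompleteNormedModule) W).
- intros z _. unfold W.
  rewrite (RInt_ext (fun x => g x * cos (z * (x - x0)))
     (fun x => Derive (fun z => g x * dirichlet z (x - x0)) z)).
  2: { intros x _. symmetry. apply is_derive_unique, Hd. }
  apply (is_derive_RInt_param (fun z x => g x * dirichlet z (x - x0)) 0 b z).
  + apply filter_forall. intros z' x _. eexists. apply Hd.
  + intros x _. apply (continuity_2d_pt_ext (fun z x => g x * cos (z * (x - x0)))).
    { intros u v. symmetry. apply is_derive_unique, Hd. }
    apply continuity_2d_pt_trig; [apply continuous_cos|exact Hg].
  + apply filter_forall. intros z'. apply HexW.
- intros z _. apply (continuous_RInt_param (fun z x => g x * cos (z * (x - x0))) 0 b z Hb).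
  + intros x _. apply continuity_2d_pt_trig; [apply continuous_cos|exact Hg].
  + apply filter_forall. intros z'. apply ex_RInt_cont. intros x.
    apply continuous_trig_modulation; [apply continuous_cos|exact Hg].
Qed.

Lemma sine_transform_symmetric_integral (g : R -> R) (x0 b Y : R) :
  (forall x, continuous g x) -> 0 <= b ->
  is_RInt (fun y => RInt (fun x => g x * sin (y * (x - x0))) 0 b) (- Y) Y 0.
Proof.
intros Hg Hb. set (B := fun y => RInt (fun x => g x * sin (y * (x - x0))) 0 b).
assert (HexB : forall y, ex_RInt (fun x => g x * sin (y * (x - x0))) 0 b).
{ intros y. apply ex_RInt_cont. intros x.
  apply continuous_trig_modulation; [apply continuous_sin|exact Hg]. }
assert (HB : forall y, continuous B y).
{ intros y. apply (continuous_RInt_param (fun z x => g x * sin (z * (x - x0))) 0 b y Hb).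
  - intros x _. apply continuity_2d_pt_trig; [apply continuous_sin|exact Hg].
  - apply filter_forall. exact HexB. }
assert (Hodd : forall y, B (- y) = - B y).
{ intros y. unfold B. change (- RInt (fun x => g x * sin (y * (x - x0))) 0 b)
    with (opp (RInt (V := R_CompleteNormedModule) (fun x => g x * sin (y * (x - x0))) 0 b)).
  rewrite <- (RInt_opp (V := R_CompleteNormedModule)) by apply HexB.
  apply RInt_ext. intros x _.
  change (g x * sin (- y * (x - x0)) = - (g x * sin (y * (x - x0)))).
  replace (- y * (x - x0)) with (- (y * (x - x0))) by ring. rewrite sin_neg. ring. }
assert (E : RInt B (- Y) Y = 0).
{ assert (H := RInt_comp_lin (V := R_CompleteNormedModule) B (-1) 0 Y (- Y)).
  replace (-1 * Y + 0) with (- Y) in H by ring. replace (-1 * - Y + 0) with Y in H by ring.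
  rewrite (RInt_ext _ B) in H.
  - specialize (H ltac:(now apply ex_RInt_cont)).
    rewrite <- (opp_RInt_swap (V := R_CompleteNormedModule) B) in H by now apply ex_RInt_cont.
    change opp with Ropp in H.
    assert (H' : - RInt B (- Y) Y = RInt B (- Y) Y) by exact H. lra.
  - intros x _. change (-1 * B (-1 * x + 0) = B x).
    replace (-1 * x + 0) with (- x) by ring. rewrite Hodd. ring. }
rewrite <- E. apply (RInt_correct (V := R_CompleteNormedModule)). now apply ex_RInt_cont.
Qed.

Lemma continuous_laplace_vertical (f : R -> R) (c y : R) :
  (forall x, continuous f x) -> subexp f -> 0 < c ->
  continuous (U := C_R_NormedModule) (fun y : R => laplace f (c, y)) y.
Proof.
intros Hf Hs Hc.
assert (H : continuous (T := AbsRing_UniformSpace C_AbsRing) (U := C_UniformSpace) (laplace f) (c, y)).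
{ apply (ex_derive_continuous (K := C_AbsRing) (V := C_NormedModule) (laplace f)).
  eexists. now apply is_derive_laplace. }
apply (continuous_comp (fun y : R => (c, y) : AbsRing_UniformSpace C_AbsRing) (laplace f)); [|exact H].
apply filterlim_locally. intros eps. exists eps. intros z Hz.
change (Cmod ((c, z) - (c, y))%C < eps).
replace ((c, z) - (c, y))%C with ((0, z - y) : C).
2: { unfold Cminus, Cplus, Copp; simpl. f_equal; ring. }
replace (Cmod (0, z - y)) with (Rabs (z - y)); [exact Hz|].
unfold Cmod; simpl. rewrite <- sqrt_Rsqr_abs. f_equal. unfold Rsqr. ring.
Qed.

Lemma continuous_Cmult (u v : R -> C) (x : R) :
  continuous (U := C_R_NormedModule) u x -> continuous (U := C_R_NormedModule) v x ->
  continuous (U := C_R_NormedModule) (fun x => u x * v x)%C x.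
Proof.
intros Hu Hv.
assert (Hu1 : continuous (fun x => fst (u x)) x) by (apply (continuous_comp u fst); [exact Hu|apply continuous_fst]).
assert (Hu2 : continuous (fun x => snd (u x)) x) by (apply (continuous_comp u snd); [exact Hu|apply continuous_snd]).
assert (Hv1 : continuous (fun x => fst (v x)) x) by (apply (continuous_comp v fst); [exact Hv|apply continuous_fst]).
assert (Hv2 : continuous (fun x => snd (v x)) x) by (apply (continuous_comp v snd); [exact Hv|apply continuous_snd]).
unfold Cmult. apply continuous_C_pair.
- apply (continuous_minus (V := R_NormedModule) (fun x => fst (u x) * fst (v x)) (fun x => snd (u x) * snd (v x)));
  [apply (continuous_mult (fun x => fst (u x)) (fun x => fst (v x)))|apply (continuous_mult (fun x => snd (u x)) (fun x => snd (v x)))]; assumption.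
- apply (continuous_plus (V := R_NormedModule) (fun x => fst (u x) * snd (v x)) (fun x => snd (u x) * fst (v x)));
  [apply (continuous_mult (fun x => fst (u x)) (fun x => snd (v x)))|apply (continuous_mult (fun x => snd (u x)) (fun x => fst (v x)))]; assumption.
Qed.

Lemma Cmult_pair_Ci (u v : R) : ((u, (- v)%R) * Ci)%C = (v, u).
Proof. unfold Cmult, Ci; simpl. f_equal; ring. Qed.

(** The sine part is odd in [y] and integrates to 0. The factor [Ci] moves the cosine part to the
    imaginary coordinate, which is why the result is purely imaginary. *)
Lemma bromwich_truncated (f : R -> R) (c x0 b Y : R) :
  (forall x, continuous f x) -> 0 <= b ->
  is_RInt (V := C_R_NormedModule)
    (fun y => Cexp ((c, y) * RtoC x0) *
       RInt (V := C_R_CompleteNormedModule) (laplace_integrand f (c, y)) 0 b * Ci)%C (- Y) Y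
    (0, 2 * RInt (fun x => exp (c * (x0 - x)) * f x * dirichlet Y (x - x0)) 0 b).
Proof.
intros Hf Hb. set (g := fun x => exp (c * (x0 - x)) * f x).
assert (Hg : forall x, continuous g x).
{ intros x. apply (continuous_mult (fun x => exp (c * (x0 - x))) f); [|apply Hf].
  apply (ex_derive_continuous (fun x => exp (c * (x0 - x)))). auto_derive; trivial. }
apply (is_RInt_ext (V := C_R_NormedModule) (fun y =>
   (RInt (fun x => g x * sin (y * (x - x0))) 0 b, RInt (fun x => g x * cos (y * (x - x0))) 0 b) : C)).
- intros y _.
  assert (H : is_RInt (V := C_R_NormedModule)
      (fun x => Cexp ((c, y) * RtoC x0) * laplace_integrand f (c, y) x)%C 0 b
      (RInt (fun x => g x * cos (y * (x - x0))) 0 b, - RInt (fun x => g x * sin (y * (x - x0))) 0 b)).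
  { apply (is_RInt_ext (V := C_R_NormedModule)
      (fun x => (g x * cos (y * (x - x0)), - (g x * sin (y * (x - x0)))) : C)).
    - intros x _. unfold laplace_integrand. rewrite Cmult_assoc, <- Cexp_plus.
      unfold Cexp, g, Cmult, Cplus, Copp, RtoC; simpl.
      replace (c * x0 - y * 0 + - (c * x - y * 0)) with (c * (x0 - x)) by ring.
      replace (c * 0 + y * x0 + - (c * 0 + y * x)) with (- (y * (x - x0))) by ring.
      rewrite cos_neg, sin_neg. f_equal; ring.
    - apply is_RInt_C_R. split; simpl.
      + apply (RInt_correct (V := R_CompleteNormedModule)), ex_RInt_cont. intros x.
        apply continuous_trig_modulation; [apply continuous_cos|exact Hg].
      + apply (is_RInt_opp (V := R_NormedModule)).
        apply (RInt_correct (V := R_CompleteNormedModule)), ex_RInt_cont. intros x.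
        apply continuous_trig_modulation; [apply continuous_sin|exact Hg]. }
  apply (is_RInt_unique (V := C_R_CompleteNormedModule)) in H.
  assert (H2 : is_RInt (V := C_R_NormedModule)
      (fun x => Cexp ((c, y) * RtoC x0) * laplace_integrand f (c, y) x)%C 0 b
      (Cexp ((c, y) * RtoC x0) * RInt (V := C_R_CompleteNormedModule) (laplace_integrand f (c, y)) 0 b)%C).
  { apply is_RInt_Cmult_l. apply (RInt_correct (V := C_R_CompleteNormedModule)).
    apply ex_RInt_continuous. intros x _. apply continuous_laplace_integrand, Hf. }
  apply (is_RInt_unique (V := C_R_CompleteNormedModule)) in H2.
  rewrite <- H2, H. symmetry. apply Cmult_pair_Ci.
- apply is_RInt_C_R. split; simpl.
  + now apply sine_transform_symmetric_integral.
  + now apply cosine_transform_symmetric_integral.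
Qed.

(** The limits in [Y] and in the truncation point do not commute for free: localization wants a
    truncation fixed before [Y], whereas replacing the full transform by a truncated one costs an
    error that grows with [Y]. Two truncations [b <= b'] reconcile these, linked by a tail estimate
    uniform in [Y]. *)
Theorem bromwich_inversion (f : R -> R) (c x0 : R) :
  (forall x, continuous f x) -> subexp f -> 0 < c -> 0 < x0 -> ex_derive f x0 ->
  is_vertical_integral (fun theta => Cexp (theta * RtoC x0) * laplace f theta)%C c
    (0, 2 * PI * f x0).
Proof.
intros Hf Hs Hc Hx0 Hdf.
set (Phi := fun y : R => (Cexp ((c, y) * RtoC x0) * laplace f (c, y) * Ci)%C).
assert (HPhi : forall y, continuous (U := C_R_NormedModule) Phi y).
{ intros y. unfold Phi. apply continuous_Cmult; [apply continuous_Cmult|].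
  - apply (continuous_ext (fun y => (exp (c * x0) * cos (y * x0), exp (c * x0) * sin (y * x0)) : C)).
    + intros z. unfold Cexp; simpl. f_equal; f_equal; f_equal; ring.
    + apply continuous_C_pair.
      * apply (ex_derive_continuous (fun y => exp (c * x0) * cos (y * x0))). auto_derive; trivial.
      * apply (ex_derive_continuous (fun y => exp (c * x0) * sin (y * x0))). auto_derive; trivial.
  - now apply continuous_laplace_vertical.
  - apply continuous_const. }
set (I := (fun Y => RInt (V := C_R_CompleteNormedModule) Phi (- Y) Y) : R -> C).
assert (HI : forall Y, is_RInt (V := C_R_NormedModule) Phi (- Y) Y (I Y)).
{ intros Y. apply (RInt_correct (V := C_R_CompleteNormedModule)), ex_RInt_continuous. intros; apply HPhi. }
exists I. split; [intros Y _; apply HI|].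
set (g := fun x => exp (c * (x0 - x)) * f x).
assert (Hg : forall x, continuous g x).
{ intros x. apply (continuous_mult (fun x => exp (c * (x0 - x))) f); [|apply Hf].
  apply (ex_derive_continuous (fun x => exp (c * (x0 - x)))). auto_derive; trivial. }
set (W := (fun b Y => RInt (fun x => g x * dirichlet Y (x - x0)) 0 b) : R -> R -> R).
destruct (laplace_tail f c Hf Hs Hc) as [M [HM0 HM]].
(* For fixed [Y] the error of truncating the Laplace integral at [b] vanishes as [b] grows. *)
assert (HIW : forall Y b, 0 <= Y -> 0 <= b ->
   Cmod (I Y - (0, (2 * W b Y)%R))%C <= 2 * Y * (exp (c * x0) * M) * exp (- (c / 2 * b))).
{ intros Y b HY Hb.
  pose proof (is_RInt_minus (V := C_R_NormedModule) _ _ _ _ _ _ (HI Y) (bromwich_truncated f c x0 b Y Hf Hb)) as H.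
  rewrite Cmod_norm.
  replace (2 * Y * (exp (c * x0) * M) * exp (- (c / 2 * b)))
    with ((Y - - Y) * (exp (c * x0) * (M * exp (- (c / 2 * b))))) by ring.
  refine (norm_RInt_le_const (V := C_R_NormedModule) _ (- Y) Y _ _ _ _ H); [lra|].
  intros y _. unfold Phi.
  eapply Rle_trans; [right; symmetry; apply Cmod_norm|].
  change minus with Cminus.
  set (L := RInt (V := C_R_CompleteNormedModule) (laplace_integrand f (c, y)) 0 b).
  replace (Cexp ((c, y) * x0) * laplace f (c, y) * Ci - Cexp ((c, y) * x0) * L * Ci)%C
    with (Cexp ((c, y) * x0) * (laplace f (c, y) - L) * Ci)%C by ring.
  rewrite !Cmod_mult, Cmod_Cexp.
  replace (Cmod Ci) with 1.
  2: { unfold Cmod; simpl. replace (0 * (0 * 1) + 1 * (1 * 1)) with 1 by ring. now rewrite sqrt_1. }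
  rewrite Rmult_1_r.
  replace (Re ((c, y) * RtoC x0)) with (c * x0) by (simpl; ring).
  apply Rmult_le_compat_l; [left; apply exp_pos|].
  apply (HM (c, y) eq_refl). exact Hb. }
destruct (Hs (c / 2)) as [M1 [HM10 HM1]]; [lra|].
set (M2 := exp (c * x0) * M1).
assert (HM20 : 0 <= M2) by (apply Rmult_le_pos; [left; apply exp_pos|easy]).
assert (Hg1 : forall x, 0 <= x -> Rabs (g x) <= M2 * exp (- (c / 2 * x))).
{ intros x Hx. unfold g, M2. rewrite Rabs_mult, (Rabs_pos_eq (exp _)) by (left; apply exp_pos).
  replace (c * (x0 - x)) with (c * x0 + - (c * x)) by ring. rewrite exp_plus, !Rmult_assoc.
  apply Rmult_le_compat_l; [left; apply exp_pos|].
  apply exp_mult_le_half; auto. }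
assert (HexW : forall a b Y, ex_RInt (fun x => g x * dirichlet Y (x - x0)) a b).
{ intros a b Z. apply ex_RInt_cont. intros x.
  apply (continuous_mult g (fun x => dirichlet Z (x - x0))); [apply Hg|apply continuous_shifted_dirichlet]. }
(* Away from [x0] the Dirichlet kernel is at most 1, which makes this tail uniform in [Y]. *)
assert (HWW : forall Y b b', x0 + 1 <= b -> b <= b' ->
   Rabs (W b' Y - W b Y) <= M2 * (2 / c) * exp (- (c / 2 * b))).
{ intros Y b b' Hb Hbb'.
  replace (W b' Y - W b Y) with (RInt (fun x => g x * dirichlet Y (x - x0)) b b').
  2: { assert (H : W b Y + RInt (fun x => g x * dirichlet Y (x - x0)) b b' = W b' Y).
       { apply (RInt_Chasles (V := R_CompleteNormedModule)); apply HexW. }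
       lra. }
  apply Rle_trans with (M2 * ((exp (- (c / 2 * b)) - exp (- (c / 2 * b'))) / (c / 2))).
  - apply (norm_RInt_le (V := R_NormedModule) (fun x => g x * dirichlet Y (x - x0))
       (fun x => M2 * exp (- (c / 2 * x))) b b' (RInt (fun x => g x * dirichlet Y (x - x0)) b b')); [easy| | |].
    + intros x Hx. change (Rabs (g x * dirichlet Y (x - x0)) <= M2 * exp (- (c / 2 * x))).
      rewrite Rabs_mult. specialize (Hg1 x ltac:(lra)).
      assert (Hd1 : Rabs (dirichlet Y (x - x0)) <= 1).
      { assert (Hsin : Rabs ((x - x0) * dirichlet Y (x - x0)) <= 1).
        { rewrite dirichlet_mult. apply Rabs_le, SIN_bound. }
        rewrite Rabs_mult, (Rabs_pos_eq (x - x0)) in Hsin by lra.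
        pose proof (Rabs_pos (dirichlet Y (x - x0))). nra. }
      pose proof (Rabs_pos (dirichlet Y (x - x0))). pose proof (Rabs_pos (g x)). nra.
    + apply (RInt_correct (V := R_CompleteNormedModule)), HexW.
    + apply (is_RInt_scal (V := R_NormedModule) (fun x => exp (- (c / 2 * x)))). apply is_RInt_exp; lra.
  - rewrite Rmult_assoc. apply Rmult_le_compat_l; [easy|].
    pose proof (exp_pos (- (c / 2 * b'))).
    replace (2 / c * exp (- (c / 2 * b))) with (exp (- (c / 2 * b)) / (c / 2)) by (field; lra).
    unfold Rdiv at 1 4. apply Rmult_le_compat_r; [|lra]. left; apply Rinv_0_lt_compat; lra. }
apply (filterlim_locally_ball_norm (K := R_AbsRing) (U := C_R_NormedModule)). intros eps.
assert (Heps := cond_pos eps).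
(* [b] is chosen before [Y], beyond [x0 + 1] so that the uniform tail estimate applies. *)
destruct (exp_eventually_small (M2 * (2 / c)) (c / 2) (eps / 8) (x0 + 1)) as [b [Hb Hbe]]; try lra.
{ apply Rmult_le_pos; [easy|]. apply Rdiv_le_0_compat; lra. }
specialize (Hbe b ltac:(lra)).
assert (Hdg : ex_derive g x0).
{ unfold g. apply (ex_derive_mult (fun x => exp (c * (x0 - x))) f); [auto_derive; trivial|exact Hdf]. }
destruct (dirichlet_localization g x0 b Hg Hdg ltac:(lra) (eps / 8) ltac:(lra)) as [Y0 [HY0 HW]].
exists Y0. intros Y HY. specialize (HW Y ltac:(lra)).
assert (Hg0 : g x0 = f x0).
{ unfold g. replace (c * (x0 - x0)) with 0 by ring. rewrite exp_0. ring. }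
rewrite Hg0 in HW. fold (W b Y) in HW.
assert (HK : 0 <= 2 * Y * (exp (c * x0) * M)).
{ apply Rmult_le_pos; [lra|]. apply Rmult_le_pos; [left; apply exp_pos|easy]. }
(* [b'] may depend on [Y]: it only has to beat the factor [Y] in the truncation error. *)
destruct (exp_eventually_small (2 * Y * (exp (c * x0) * M)) (c / 2) (eps / 8) b) as [b' [Hb' Hbe']]; try lra.
specialize (Hbe' b' ltac:(lra)).
specialize (HIW Y b' ltac:(lra) ltac:(lra)). specialize (HWW Y b b' Hb Hb').
unfold ball_norm. eapply Rle_lt_trans; [right; symmetry; apply Cmod_norm|].
change minus with Cminus.
replace (I Y - (0, (2 * PI * f x0)%R))%C with ((I Y - (0, (2 * W b' Y)%R)) + RtoC (2 * (W b' Y - PI * f x0))%R * Ci)%C.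
2: { destruct (I Y) as [i1 i2]. unfold Cminus, Cplus, Copp, Cmult, Ci, RtoC; simpl. f_equal; ring. }
eapply Rle_lt_trans; [apply Cmod_triangle|].
rewrite Cmod_mult, Cmod_R.
replace (Cmod Ci) with 1.
2: { unfold Cmod; simpl. replace (0 * (0 * 1) + 1 * (1 * 1)) with 1 by ring. now rewrite sqrt_1. }
rewrite Rmult_1_r, Rabs_mult, (Rabs_pos_eq 2) by lra.
assert (Rabs (W b' Y - PI * f x0) <= eps / 4).
{ replace (W b' Y - PI * f x0) with ((W b' Y - W b Y) + (W b Y - PI * f x0)) by ring.
  eapply Rle_trans; [apply Rabs_triang|]. lra. }
lra.
Qed.

(** * Real Laplace transforms and continuity in two variables *)

Definition rlaplace (f : R -> R) (theta : R) : R :=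
  RInt_gen (V := R_CompleteNormedModule) (fun x => exp (- (theta * x)) * f x)
    (at_point 0) (Rbar_locally p_infty).

Lemma linear_exp_bound (B k x : R) : 0 <= B -> 0 < k -> 0 <= x -> B + x <= (B + / k) * exp (k * x).
Proof.
intros HB Hk Hx. pose proof (Rinv_0_lt_compat k Hk). pose proof (exp_ineq1_le (k * x)).
assert (B <= B * exp (k * x)).
{ rewrite <- (Rmult_1_r B) at 1. apply Rmult_le_compat_l; [easy|]. assert (0 <= k * x) by nra. lra. }
assert (x <= / k * exp (k * x)).
{ apply Rle_trans with (/ k * (k * x)); [right; field; lra|]. apply Rmult_le_compat_l; lra. }
lra.
Qed.

(** The estimate uses only a lower bound [th1] of [th], so it is uniform along a moving
    characteristic. At [b = 0] it bounds the whole transform. *)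
Lemma rlaplace_tail (f : R -> R) (B th1 th : R) :
  (forall x, continuous f x) -> 0 <= B -> (forall x, 0 <= x -> Rabs (f x) <= B + x) ->
  0 < th1 <= th ->
  is_RInt_gen (fun x => exp (- (th * x)) * f x) (at_point 0) (Rbar_locally p_infty) (rlaplace f th) /\
  forall b, 0 <= b ->
    Rabs (rlaplace f th - RInt (fun x => exp (- (th * x)) * f x) 0 b)
    <= (B + 2 / th1) * (2 / th1) * exp (- (th1 / 2 * b)).
Proof.
intros Hf HB Hfb Hth.
destruct (is_RInt_gen_exp_dominated (V := R_CompleteNormedModule)
   (fun x => exp (- (th * x)) * f x) (B + 2 / th1) (th1 / 2) 0) as [l [Hl Hb]].
- lra.
- intros x _. apply (continuous_mult (fun x => exp (- (th * x))) f); [|apply Hf].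
  apply (ex_derive_continuous (fun x => exp (- (th * x)))). auto_derive; trivial.
- intros x Hx. change (Rabs (exp (- (th * x)) * f x) <= (B + 2 / th1) * exp (- (th1 / 2 * x))).
  rewrite Rabs_mult, (Rabs_pos_eq (exp _)) by (left; apply exp_pos).
  apply Rle_trans with (exp (- (th1 * x)) * Rabs (f x)).
  { apply Rmult_le_compat_r; [apply Rabs_pos|]. apply exp_le_compat. nra. }
  apply exp_mult_le_half; [easy|]. eapply Rle_trans; [now apply Hfb|].
  replace (2 / th1) with (/ (th1 / 2)) by (field; lra). apply linear_exp_bound; lra.
- assert (E : rlaplace f th = l).
  { unfold rlaplace. apply (is_RInt_gen_unique (V := R_CompleteNormedModule)). exact Hl. }
  rewrite E. split; [exact Hl|]. intros b Hb0.
  replace ((B + 2 / th1) * (2 / th1)) with ((B + 2 / th1) / (th1 / 2)) by (field; lra).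
  apply (Hb b Hb0).
Qed.

Lemma laplace_rlaplace (f : R -> R) (B th : R) :
  (forall x, continuous f x) -> 0 <= B -> (forall x, 0 <= x -> Rabs (f x) <= B + x) ->
  0 < th -> laplace f (RtoC th) = RtoC (rlaplace f th).
Proof.
intros Hf HB Hfb Hth.
destruct (rlaplace_tail f B th th Hf HB Hfb ltac:(lra)) as [H _].
assert (HI : forall b, 0 <= b -> is_RInt (fun x => exp (- (th * x)) * f x) 0 b
   (RInt (fun x => exp (- (th * x)) * f x) 0 b)).
{ intros b _. apply (RInt_correct (V := R_CompleteNormedModule)), ex_RInt_cont. intros x.
  apply (continuous_mult (fun x => exp (- (th * x))) f); [|apply Hf].
  apply (ex_derive_continuous (fun x => exp (- (th * x)))). auto_derive; trivial. }
pose proof (filterlim_is_RInt_gen (V := R_CompleteNormedModule) _ _ 0 _ HI H) as Hlim.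
unfold laplace. apply (is_RInt_gen_unique (V := C_R_CompleteNormedModule)).
apply (is_RInt_gen_at_point_infty (V := C_R_NormedModule) _
  (fun b => RtoC (RInt (fun x => exp (- (th * x)) * f x) 0 b))).
- intros b Hb. apply is_RInt_C_R. split.
  + apply (is_RInt_ext (fun x => exp (- (th * x)) * f x)); [|now apply HI].
    intros x _. change (exp (- (th * x)) * f x = fst (laplace_integrand f (th, 0) x)).
    rewrite laplace_integrand_pair. simpl. rewrite Rmult_0_l, cos_0. ring.
  + apply (is_RInt_ext (fun x => 0)).
    * intros x _. change (0 = snd (laplace_integrand f (th, 0) x)).
      rewrite laplace_integrand_pair. simpl. rewrite Rmult_0_l, sin_0. ring.
    * pose proof (is_RInt_const (V := R_NormedModule) 0 b 0) as Hz.
      assert (Hz0 : scal (b - 0) (0 : R_NormedModule) = 0) by apply Rmult_0_r.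
      rewrite Hz0 in Hz. exact Hz.
- eapply filterlim_comp; [exact Hlim|].
  unfold RtoC. apply (continuous_C_pair (fun x => x) (fun _ => 0)); [apply continuous_id|apply continuous_const].
Qed.

(** Meant for time 0, where the boundary is [K] and the excess at [K + x] is [x]: this is the
    initial value [Q(theta, 0) = 1 / theta^2]. *)
Lemma rlaplace_id (f : R -> R) (th : R) :
  (forall x, 0 <= x -> f x = x) -> 0 < th -> rlaplace f th = / th ^ 2.
Proof.
intros Hf Hth. unfold rlaplace. apply (is_RInt_gen_unique (V := R_CompleteNormedModule)).
apply (is_RInt_gen_at_point_infty _ (fun b => / th ^ 2 - (b / th + / th ^ 2) * exp (- (th * b)))).
- intros b Hb. apply (is_RInt_ext (fun x => exp (- (th * x)) * x)).
  { intros x Hx. rewrite Rmin_left in Hx by easy. rewrite Hf; [reflexivity|lra]. }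
  replace (/ th ^ 2 - (b / th + / th ^ 2) * exp (- (th * b)))
    with (minus (- ((b / th + / th ^ 2) * exp (- (th * b)))) (- ((0 / th + / th ^ 2) * exp (- (th * 0))))).
  + apply (is_RInt_derive (V := R_CompleteNormedModule) (fun x => - ((x / th + / th ^ 2) * exp (- (th * x))))).
    * intros x _. auto_derive; trivial. eq_in_R. field. lra.
    * intros x _. apply (ex_derive_continuous (fun x => exp (- (th * x)) * x)). auto_derive; trivial.
  + rewrite Rmult_0_r, Ropp_0, exp_0. unfold minus, plus, opp; simpl. field. lra.
- assert (Hi : 0 < / th) by now apply Rinv_0_lt_compat.
  assert (Hi2 : 0 < / th ^ 2) by (apply Rinv_0_lt_compat; nra).
  apply filterlim_locally. intros eps.
  set (C0 := / th * (/ th + / (th / 2))).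
  assert (HC0 : 0 <= C0).
  { apply Rmult_le_pos; [lra|]. assert (0 < / (th / 2)) by (apply Rinv_0_lt_compat; lra). lra. }
  destruct (exp_eventually_small C0 (th / 2) eps 0) as [b0 [Hb0 Hsmall]]; try easy; try lra.
  { apply eps. }
  exists b0. intros b Hb. specialize (Hsmall b ltac:(lra)).
  change (Rabs (/ th ^ 2 - (b / th + / th ^ 2) * exp (- (th * b)) - / th ^ 2) < eps).
  replace (/ th ^ 2 - (b / th + / th ^ 2) * exp (- (th * b)) - / th ^ 2)
    with (- (/ th * (/ th + b) * exp (- (th * b)))) by (field; lra).
  pose proof (exp_pos (- (th * b))).
  assert (0 <= / th * (/ th + b)) by (apply Rmult_le_pos; lra).
  rewrite Rabs_Ropp, Rabs_pos_eq by nra.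
  eapply Rle_lt_trans; [|exact Hsmall].
  pose proof (linear_exp_bound (/ th) (th / 2) b ltac:(lra) ltac:(lra) ltac:(lra)) as Hl.
  unfold C0. replace (- (th / 2 * b)) with (- (th * b) + th / 2 * b) by field. rewrite exp_plus.
  replace (/ th * (/ th + / (th / 2)) * (exp (- (th * b)) * exp (th / 2 * b)))
    with (/ th * ((/ th + / (th / 2)) * exp (th / 2 * b)) * exp (- (th * b))) by ring.
  apply Rmult_le_compat_r; [lra|]. apply Rmult_le_compat_l; lra.
Qed.

(** Continuity relative to a domain becomes ordinary continuity once the inner map stays in the
    domain near the point. This is how the closed-domain hypotheses on [P] and [dS P] are used at
    the boundary. *)
Lemma cont2_on_comp (D : R -> R -> Prop) (f X Y : R -> R -> R) (u v : R) :
  cont2_on D f -> locally_2d (fun u v => D (X u v) (Y u v)) u v ->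
  continuity_2d_pt X u v -> continuity_2d_pt Y u v ->
  continuity_2d_pt (fun u v => f (X u v) (Y u v)) u v.
Proof.
intros Hf HD HX HY.
assert (HD0 : D (X u v) (Y u v)) by exact (locally_2d_singleton _ _ _ HD).
apply continuity_2d_pt_filterlim in HX. apply continuity_2d_pt_filterlim in HY.
apply continuity_2d_pt_filterlim.
specialize (Hf (X u v, Y u v) HD0).
intros Q HQ. specialize (Hf Q HQ).
assert (HXY : filterlim (fun z : R * R => (X (fst z) (snd z), Y (fst z) (snd z))) (locally (u, v))
   (locally (X u v, Y u v))).
{ apply (filterlim_comp_2 (G := locally (X u v)) (H := locally (Y u v)) _ _ pair HX HY).
  intros S [e He]. exists (fun x => ball (X u v) e x) (fun y => ball (Y u v) e y).
  - apply locally_ball.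
  - apply locally_ball.
  - intros x y Hx Hy. apply He. split; assumption. }
specialize (HXY _ Hf). apply locally_2d_locally in HD.
unfold filtermap in *. generalize (filter_and _ _ HXY HD). apply filter_imp.
intros z [H1 H2]. apply H1. exact H2.
Qed.

Lemma continuity_2d_pt_section (f : R -> R -> R) (u v : R) :
  continuity_2d_pt f u v -> continuous (f u) v.
Proof.
intros H. apply continuity_2d_pt_filterlim in H.
eapply filterlim_comp_2 with (f := fun _ => u) (g := fun v => v) (h := f).
- apply filterlim_const.
- apply filterlim_id.
- intros Q HQ. specialize (H Q HQ). destruct H as [e He].
  exists (fun x => ball u e x) (fun y => ball v e y).
  + apply locally_ball.
  + apply locally_ball.
  + intros x y Hx Hy. apply (He (x, y)). split; assumption.
Qed.

Lemma continuity_2d_pt_Rmax_l (f : R -> R -> R) (c u v : R) :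
  continuity_2d_pt f u v -> continuity_2d_pt (fun u v => Rmax (f u v) c) u v.
Proof.
intros H eps. destruct (H eps) as [d Hd]. exists d. intros x y Hx Hy.
specialize (Hd x y Hx Hy). revert Hd. unfold Rmax, Rabs.
repeat destruct Rle_dec; repeat destruct Rcase_abs; pose proof (cond_pos eps); lra.
Qed.

Lemma bounded_on_segment (f : R -> R) (z1 z2 : R) : (forall z, z1 <= z <= z2 -> continuous f z) ->
  exists M, 0 <= M /\ forall z, z1 <= z <= z2 -> Rabs (f z) <= M.
Proof.
intros Hf. destruct (bounded_continuity (V := R_NormedModule) f z1 z2) as [M HM]; [exact Hf|].
exists (Rmax M 0). split; [apply Rmax_r|]. intros z Hz. pose proof (Rmax_l M 0).
specialize (HM z Hz). change (Rabs (f z) < M) in HM. lra.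
Qed.

(** * The test function *)

Definition excess (K : R) (P : R -> R -> R) (S s : R) : R := P S s - (K - S).

(* The cutoff [(1 - S / r) ^ 2] vanishes to second order at [r], so that no bound
   on [dS P] near infinity is needed; [th ^ 2 * exp (- (th * S))] solves the
   adjoint equation along the characteristic. *)
Definition test_fun (r th S : R) : R := (1 - S / r) ^ 2 * (th ^ 2 * exp (- (th * S))).

Definition test_flux_slope (r th S : R) : R := S * test_fun r th S.

(** For [w = test_fun r th] this is [rho S w - (S w)']. With [S w] in front of [p'] and this in
    front of [p], the flux has derivative [S w p'' + rho S w p'] plus a multiple of [p]. *)
Definition test_flux_value (rho r th S : R) : R :=
  th ^ 2 * exp (- (th * S)) *
  (- (1 - S / r) ^ 2 + 2 / r * (1 - S / r) * S + (th + rho) * (1 - S / r) ^ 2 * S).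

(** The terms of [(S w)'' - rho (S w)'] in which a derivative falls on the cutoff; each carries a
    factor [1 / r]. *)
Definition test_error (rho r th S : R) : R :=
  th ^ 2 * exp (- (th * S)) *
  (2 / r ^ 2 * S - 4 / r * (1 - S / r) * (1 - th * S) + 2 * rho / r * (1 - S / r) * S).

Lemma is_derive_test_fun_char (rho r z S : R) :
  is_derive (fun z => test_fun r (rho * z) S) z
    ((1 - S / r) ^ 2 * rho * (2 * (rho * z) - (rho * z) ^ 2 * S) * exp (- (rho * z * S))).
Proof. unfold test_fun. auto_derive; trivial. ring. Qed.

(** The transport equation before integration in [S]. Moving [z] differentiates the weight, and this
    cancels the adjoint operator applied to it; what remains is an exact flux derivative, the cutoff
    error and the source [- rho K]. The factor [/ (rho * z * (z + 1))] is the derivative of time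
    along the characteristic. *)
Lemma adjoint_identity (K rho r z S p p' p'' pt : R) :
  0 < rho -> 0 < z -> r <> 0 ->
  pt = S * p'' + rho * S * p' - rho * p - rho * K ->
  (1 - S / r) ^ 2 * rho * (2 * (rho * z) - (rho * z) ^ 2 * S) * exp (- (rho * z * S)) * p
  + test_fun r (rho * z) S * (pt * / (rho * z * (z + 1)))
  = / (rho * z * (z + 1)) *
    ((test_flux_slope r (rho * z) S * p'' + rho * test_flux_slope r (rho * z) S * p'
      + Derive (test_flux_value rho r (rho * z)) S * p)
     + p * test_error rho r (rho * z) S - rho * K * test_fun r (rho * z) S).
Proof.
intros Hr Hz Hr0 ->.
assert (E : Derive (test_flux_value rho r (rho * z)) S
  = (rho * z) ^ 2 * exp (- (rho * z * S)) *
    (- (rho * z) * (- (1 - S / r) ^ 2 + 2 / r * (1 - S / r) * S + (rho * z + rho) * (1 - S / r) ^ 2 * S)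
     + 2 / r * (1 - S / r) + 2 / r * (1 - S / r) - 2 / r ^ 2 * S
     + (rho * z + rho) * ((1 - S / r) ^ 2 - 2 / r * (1 - S / r) * S))).
{ apply is_derive_unique. unfold test_flux_value. auto_derive; trivial. field. lra. }
rewrite E. unfold test_flux_slope, test_error, test_fun.
generalize (exp (- (rho * z * S))). intros X. field. lra.
Qed.

Lemma test_flux_derive (rho r th S : R) (p p' : R -> R) (p'' : R) :
  is_derive p S (p' S) -> is_derive p' S p'' -> r <> 0 ->
  is_derive (fun S => test_flux_slope r th S * p' S + test_flux_value rho r th S * p S) S
    (test_flux_slope r th S * p'' + rho * test_flux_slope r th S * p' S
      + Derive (test_flux_value rho r th) S * p S).
Proof.
intros Hp Hp' Hr.
assert (Ha : is_derive (test_flux_slope r th) S (rho * test_flux_slope r th S - test_flux_value rho r th S)).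
{ unfold test_flux_slope, test_flux_value, test_fun. auto_derive; trivial. field. lra. }
assert (Hb : is_derive (test_flux_value rho r th) S (Derive (test_flux_value rho r th) S)).
{ apply Derive_correct. unfold test_flux_value. auto_derive; trivial. }
evar_last.
{ apply (is_derive_plus (V := R_NormedModule)).
  - apply (is_derive_mult (test_flux_slope r th) p' S _ _ Ha Hp'). intros; apply Rmult_comm.
  - apply (is_derive_mult (test_flux_value rho r th) p S _ _ Hb Hp). intros; apply Rmult_comm. }
simpl. unfold plus, mult; simpl. ring.
Qed.

Lemma locally_2d_lt (f g : R -> R -> R) (u v : R) :
  continuity_2d_pt f u v -> continuity_2d_pt g u v -> f u v < g u v ->
  locally_2d (fun u v => f u v < g u v) u v.
Proof.
intros Hf Hg H.
assert (He : 0 < (g u v - f u v) / 2) by lra.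
destruct (Hf (mkposreal _ He)) as [d1 H1]. destruct (Hg (mkposreal _ He)) as [d2 H2]. simpl in *.
assert (Hd : 0 < Rmin d1 d2) by (apply Rmin_pos; apply cond_pos).
exists (mkposreal _ Hd). simpl. intros x y Hx Hy.
pose proof (Rmin_l d1 d2). pose proof (Rmin_r d1 d2).
specialize (H1 x y ltac:(lra) ltac:(lra)). specialize (H2 x y ltac:(lra) ltac:(lra)).
apply Rabs_def2 in H1. apply Rabs_def2 in H2. lra.
Qed.

Lemma continuous_on_ge0_locally (alpha : R -> R) (x : R -> R -> R) (u v : R) :
  continuous_on (fun t => 0 <= t) alpha -> locally_2d (fun u v => 0 <= x u v) u v ->
  continuity_2d_pt x u v -> continuity_2d_pt (fun u v => alpha (x u v)) u v.
Proof.
intros Ha Hloc Hx.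
assert (H0 := locally_2d_singleton _ _ _ Hloc). simpl in H0.
apply continuity_2d_pt_filterlim in Hx. apply continuity_2d_pt_filterlim.
specialize (Ha (x u v) H0). intros Q HQ. specialize (Ha Q HQ).
specialize (Hx _ Ha). apply locally_2d_locally in Hloc.
unfold filtermap in *. generalize (filter_and _ _ Hx Hloc). apply filter_imp.
intros z [H1 H2]. apply H1. exact H2.
Qed.

(** * Size of the test function, its flux and its error *)

Lemma cutoff_bounds (r S : R) : 0 < r -> 0 <= S <= r -> 0 <= 1 - S / r <= 1.
Proof.
intros Hr HS. pose proof (Rinv_0_lt_compat r Hr).
assert (0 <= S / r) by (apply Rdiv_le_0_compat; lra).
assert (S / r <= 1) by (apply (Rdiv_le_1 S r); lra). lra.
Qed.

Lemma cutoff_deficit (r S : R) : 0 < r -> 0 <= S <= r -> 0 <= 1 - (1 - S / r) ^ 2 <= 2 * S / r.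
Proof.
intros Hr HS. pose proof (cutoff_bounds r S Hr HS).
replace (2 * S / r) with (2 * (1 - (1 - S / r))) by (field; lra). nra.
Qed.

Lemma exp_opp_le_1 (x : R) : 0 <= x -> exp (- x) <= 1.
Proof. intros Hx. rewrite <- exp_0. apply exp_le_compat. lra. Qed.

Lemma Rabs_mult_le (a b A B : R) : Rabs a <= A -> Rabs b <= B -> Rabs (a * b) <= A * B.
Proof. intros. rewrite Rabs_mult. apply Rmult_le_compat; auto using Rabs_pos. Qed.

Lemma test_fun_bound (r th th2 S : R) : 0 < r -> 0 <= S <= r -> 0 <= th <= th2 ->
  Rabs (test_fun r th S) <= th2 ^ 2.
Proof.
intros Hr HS Hth. pose proof (cutoff_bounds r S Hr HS) as Hc. unfold test_fun.
replace (th2 ^ 2) with (1 * (th2 ^ 2 * 1)) by ring.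
assert (th ^ 2 <= th2 ^ 2) by (apply pow_incr; lra).
apply Rabs_mult_le; [|apply Rabs_mult_le].
- rewrite Rabs_pos_eq; nra.
- rewrite Rabs_pos_eq; [easy|apply pow2_ge_0].
- rewrite Rabs_pos_eq by (left; apply exp_pos). apply exp_opp_le_1. nra.
Qed.

Lemma test_flux_slope_bound (r th th2 S Sm : R) : 0 < r -> 0 <= S <= r -> S <= Sm -> 0 <= th <= th2 ->
  Rabs (test_flux_slope r th S) <= Sm * th2 ^ 2.
Proof.
intros Hr HS HSm Hth. apply Rabs_mult_le; [rewrite Rabs_pos_eq; lra|now apply test_fun_bound].
Qed.

Lemma test_flux_value_bound (rho r th th2 S Sm : R) :
  0 < rho -> 1 <= r -> 0 <= S <= r -> S <= Sm -> 0 <= th <= th2 ->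
  Rabs (test_flux_value rho r th S) <= th2 ^ 2 * (1 + 2 * Sm + (th2 + rho) * Sm).
Proof.
intros Hrho Hr HS HSm Hth. pose proof (cutoff_bounds r S ltac:(lra) HS) as Hc. unfold test_flux_value.
assert (th ^ 2 <= th2 ^ 2) by (apply pow_incr; lra).
assert (0 <= / r <= 1).
{ split; [left; apply Rinv_0_lt_compat; lra|]. rewrite <- Rinv_1. apply Rinv_le_contravar; lra. }
apply Rabs_mult_le.
- replace (th2 ^ 2) with (th2 ^ 2 * 1) by ring. apply Rabs_mult_le.
  + rewrite Rabs_pos_eq; [easy|apply pow2_ge_0].
  + rewrite Rabs_pos_eq by (left; apply exp_pos). apply exp_opp_le_1. nra.
- assert (Hw : 0 <= (1 - S / r) ^ 2 <= 1) by nra.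
  eapply Rle_trans; [apply Rabs_triang|]. apply Rplus_le_compat.
  + eapply Rle_trans; [apply Rabs_triang|]. apply Rplus_le_compat.
    * rewrite Rabs_Ropp, Rabs_pos_eq; lra.
    * replace (2 * Sm) with (2 * 1 * Sm) by ring. apply Rabs_mult_le; [|rewrite Rabs_pos_eq; lra].
      replace (2 * 1) with (2 * 1 * 1) by ring. unfold Rdiv at 1.
      apply Rabs_mult_le; [apply Rabs_mult_le|]; rewrite Rabs_pos_eq; lra.
  + apply Rabs_mult_le; [|rewrite Rabs_pos_eq; lra].
    replace (th2 + rho) with ((th2 + rho) * 1) by ring.
    apply Rabs_mult_le; rewrite Rabs_pos_eq; lra.
Qed.

Lemma test_error_bound (rho r th th1 th2 S : R) :
  0 < rho -> 1 <= r -> 0 <= S <= r -> 0 < th1 -> th1 <= th <= th2 ->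
  Rabs (test_error rho r th S) <=
  th2 ^ 2 * exp (- (th1 * S)) * ((6 + 4 * th2 + 2 * rho) * (1 + S) / r).
Proof.
intros Hrho Hr HS Hth1 Hth. pose proof (cutoff_bounds r S ltac:(lra) HS) as Hc. unfold test_error.
assert (th ^ 2 <= th2 ^ 2) by (apply pow_incr; lra).
assert (Hi : 0 <= / r <= 1).
{ split; [left; apply Rinv_0_lt_compat; lra|]. rewrite <- Rinv_1. apply Rinv_le_contravar; lra. }
apply Rabs_mult_le; [apply Rabs_mult_le|].
- rewrite Rabs_pos_eq; [easy|apply pow2_ge_0].
- rewrite Rabs_pos_eq by (left; apply exp_pos). apply exp_le_compat. nra.
- replace (2 / r ^ 2 * S - 4 / r * (1 - S / r) * (1 - th * S) + 2 * rho / r * (1 - S / r) * S)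
    with ((/ r * (2 * S) - 4 * (1 - S / r) * (1 - th * S) + 2 * rho * (1 - S / r) * S) * / r)
    by (field; lra).
  unfold Rdiv at 3. apply Rabs_mult_le; [|rewrite Rabs_pos_eq; lra].
  assert (B1 : Rabs (/ r * (2 * S)) <= 1 * (2 * S)) by (apply Rabs_mult_le; rewrite Rabs_pos_eq; lra).
  assert (B2 : Rabs (4 * (1 - S / r) * (1 - th * S)) <= (4 * 1) * (1 + th2 * S)).
  { apply Rabs_mult_le; [apply Rabs_mult_le; rewrite Rabs_pos_eq; lra|]. apply Rabs_le. nra. }
  assert (B3 : Rabs (2 * rho * (1 - S / r) * S) <= 2 * rho * 1 * S).
  { repeat apply Rabs_mult_le; rewrite Rabs_pos_eq; lra. }
  eapply Rle_trans; [apply Rabs_triang|]. eapply Rle_trans; [apply Rplus_le_compat_r, Rabs_triang|].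
  rewrite Rabs_Ropp. assert (0 <= th2) by lra. nra.
Qed.

(** Each linear factor is absorbed by a quarter of the exponential, which leaves half of it. *)
Lemma quadratic_exp_bound (a b th x : R) : 0 <= a -> 0 <= b -> 0 < th -> 0 <= x ->
  (a + x) * (b + x) * exp (- (th * x)) <= (a + 4 / th) * (b + 4 / th) * exp (- (th / 2 * x)).
Proof.
intros Ha Hb Hth Hx.
pose proof (linear_exp_bound a (th / 4) x Ha ltac:(lra) Hx) as H1.
pose proof (linear_exp_bound b (th / 4) x Hb ltac:(lra) Hx) as H2.
replace (/ (th / 4)) with (4 / th) in * by (field; lra).
replace (- (th / 2 * x)) with (th / 4 * x + th / 4 * x + - (th * x)) by field. rewrite !exp_plus.
pose proof (exp_pos (- (th * x))).
replace ((a + 4 / th) * (b + 4 / th) * (exp (th / 4 * x) * exp (th / 4 * x) * exp (- (th * x))))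
  with (((a + 4 / th) * exp (th / 4 * x)) * ((b + 4 / th) * exp (th / 4 * x)) * exp (- (th * x))) by ring.
apply Rmult_le_compat_r; [lra|]. apply Rmult_le_compat; lra.
Qed.

Lemma abs_RInt_exp_bound (f : R -> R) (C k a b : R) :
  0 <= C -> 0 < k -> 0 <= a <= b -> (forall x, a <= x <= b -> continuous f x) ->
  (forall x, a <= x <= b -> Rabs (f x) <= C * exp (- (k * x))) ->
  Rabs (RInt f a b) <= C / k.
Proof.
intros HC Hk Hab Hf Hb.
apply Rle_trans with (C * ((exp (- (k * a)) - exp (- (k * b))) / k)).
- apply (norm_RInt_le (V := R_NormedModule) f (fun x => C * exp (- (k * x))) a b (RInt f a b)); [easy|exact Hb| |].
  + apply (RInt_correct (V := R_CompleteNormedModule)), (ex_RInt_continuous (V := R_CompleteNormedModule)).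
    intros x Hx. rewrite Rmin_left, Rmax_right in Hx by lra. now apply Hf.
  + apply (is_RInt_scal (V := R_NormedModule) (fun x => exp (- (k * x)))). apply is_RInt_exp; lra.
- unfold Rdiv. apply Rmult_le_compat_l; [easy|].
  pose proof (exp_pos (- (k * b))). assert (exp (- (k * a)) <= 1) by (apply exp_opp_le_1; nra).
  pose proof (Rinv_0_lt_compat k Hk). nra.
Qed.

(** The exponential beats both the linear growth of [p] and the factor [1 + S], so the cutoff error
    is [O(1 / r)] uniformly for [th] in [[th1, th2]]. Only the size of [p] enters, not its
    derivatives. *)
Lemma test_error_integral_bound (rho r th th1 th2 B a : R) (p : R -> R) :
  0 < rho -> 1 <= r -> 0 < th1 -> th1 <= th <= th2 -> 0 <= B -> 0 <= a <= r ->
  (forall S, a <= S <= r -> continuous p S) -> (forall S, a <= S <= r -> Rabs (p S) <= B + S) ->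
  Rabs (RInt (fun S => p S * test_error rho r th S) a r) <=
  th2 ^ 2 * (6 + 4 * th2 + 2 * rho) * (B + 4 / th1) * (1 + 4 / th1) * (2 / th1) / r.
Proof.
intros Hrho Hr Hth1 Hth HB Ha Hp Hpb.
assert (Hi : 0 < / r) by (apply Rinv_0_lt_compat; lra).
assert (H4 : 0 < 4 / th1) by (apply Rdiv_lt_0_compat; lra).
pose proof (pow2_ge_0 th2).
assert (HD : 0 <= th2 ^ 2 * (6 + 4 * th2 + 2 * rho) / r).
{ apply Rmult_le_pos; [apply Rmult_le_pos|]; lra. }
replace (th2 ^ 2 * (6 + 4 * th2 + 2 * rho) * (B + 4 / th1) * (1 + 4 / th1) * (2 / th1) / r)
  with (th2 ^ 2 * (6 + 4 * th2 + 2 * rho) / r * ((B + 4 / th1) * (1 + 4 / th1)) / (th1 / 2)) by (field; lra).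
apply abs_RInt_exp_bound; try lra.
- apply Rmult_le_pos; [easy|]. apply Rmult_le_pos; lra.
- intros S HS. apply (continuous_mult p (test_error rho r th)); [now apply Hp|].
  apply (ex_derive_continuous (test_error rho r th)). unfold test_error. auto_derive; trivial.
- intros S HS. eapply Rle_trans.
  { apply Rabs_mult_le; [now apply Hpb|]. apply (test_error_bound rho r th th1 th2); lra. }
  replace ((B + S) * (th2 ^ 2 * exp (- (th1 * S)) * ((6 + 4 * th2 + 2 * rho) * (1 + S) / r)))
    with (th2 ^ 2 * (6 + 4 * th2 + 2 * rho) / r * ((B + S) * (1 + S) * exp (- (th1 * S)))) by (field; lra).
  rewrite (Rmult_assoc (th2 ^ 2 * (6 + 4 * th2 + 2 * rho) / r)). apply Rmult_le_compat_l; [easy|]. apply quadratic_exp_bound; lra.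
Qed.

(** Without cutoff and inset the integral over [S >= A] is exactly [th * exp (- (th * A))]. The
    inset loses at most [th ^ 2 * eps], the missing range beyond [r] at most [1 / r], and the cutoff
    at most [2 / r]. *)
Lemma test_fun_integral (r th A eps : R) : 0 < th -> 0 <= A -> 0 < eps -> A + eps < r ->
  Rabs (RInt (test_fun r th) (A + eps) r - th * exp (- (th * A))) <= th ^ 2 * eps + 3 / r.
Proof.
intros Hth HA Heps Hr. set (a := A + eps) in *.
assert (Ha : 0 < a) by (unfold a; lra).
set (phi := fun S => th ^ 2 * exp (- (th * S))).
assert (I1 : is_RInt phi a r (th * exp (- (th * a)) - th * exp (- (th * r)))).
{ replace (th * exp (- (th * a)) - th * exp (- (th * r)))
    with (minus (- th * exp (- (th * r))) (- th * exp (- (th * a)))) by (unfold minus, plus, opp; simpl; ring).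
  apply (is_RInt_derive (V := R_CompleteNormedModule) (fun S => - th * exp (- (th * S)))).
  - intros x _. unfold phi. auto_derive; trivial. ring.
  - intros x _. apply (ex_derive_continuous phi). unfold phi. auto_derive; trivial. }
assert (I2 : is_RInt (fun S => S * phi S) a r ((th * a + 1) * exp (- (th * a)) - (th * r + 1) * exp (- (th * r)))).
{ replace ((th * a + 1) * exp (- (th * a)) - (th * r + 1) * exp (- (th * r)))
    with (minus (- (th * r + 1) * exp (- (th * r))) (- (th * a + 1) * exp (- (th * a)))) by (unfold minus, plus, opp; simpl; ring).
  apply (is_RInt_derive (V := R_CompleteNormedModule) (fun S => - (th * S + 1) * exp (- (th * S)))).
  - intros x _. unfold phi. auto_derive; trivial. ring.
  - intros x _. apply (ex_derive_continuous (fun S => S * phi S)). unfold phi. auto_derive; trivial. }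
assert (I3 : is_RInt (test_fun r th) a r (RInt (test_fun r th) a r)).
{ apply (RInt_correct (V := R_CompleteNormedModule)), ex_RInt_cont. intros S.
  apply (ex_derive_continuous (test_fun r th)). unfold test_fun. auto_derive; trivial. }
assert (Hphi : forall S, 0 < phi S) by (intros; apply Rmult_lt_0_compat; [nra|apply exp_pos]).
assert (U : RInt (test_fun r th) a r <= th * exp (- (th * a)) - th * exp (- (th * r))).
{ apply (is_RInt_le (test_fun r th) phi a r); try easy; [lra|].
  intros S HS. unfold test_fun. fold (phi S). pose proof (cutoff_deficit r S ltac:(lra) ltac:(lra)).
  pose proof (Hphi S). nra. }
assert (L : th * exp (- (th * a)) - th * exp (- (th * r))
   - 2 / r * ((th * a + 1) * exp (- (th * a)) - (th * r + 1) * exp (- (th * r))) <= RInt (test_fun r th) a r).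
{ apply (is_RInt_le (fun S => phi S - 2 / r * (S * phi S)) (test_fun r th) a r); try easy; [lra| |].
  - apply (is_RInt_minus (V := R_NormedModule)); [exact I1|].
    apply (is_RInt_scal (V := R_NormedModule) (fun S => S * phi S)). exact I2.
  - intros S HS. unfold test_fun. fold (phi S). pose proof (cutoff_deficit r S ltac:(lra) ltac:(lra)) as Hc.
    pose proof (Hphi S). replace (2 / r * (S * phi S)) with (2 * S / r * phi S) by (field; lra). nra. }
assert (Hr0 : 0 < / r) by (apply Rinv_0_lt_compat; lra).
assert (Hxe : forall x, 0 <= x -> (x + 1) * exp (- x) <= 1).
{ intros x Hx. pose proof (exp_ineq1_le x). pose proof (exp_pos (- x)).
  apply Rle_trans with (exp x * exp (- x)); [nra|]. rewrite <- exp_plus, Rplus_opp_r, exp_0. lra. }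
pose proof (Hxe (th * a) ltac:(nra)) as E1. pose proof (Hxe (th * r) ltac:(nra)) as E2.
assert (E3 : th * exp (- (th * r)) <= / r).
{ apply Rmult_le_reg_r with r; [lra|]. rewrite Rinv_l by lra. pose proof (exp_pos (- (th * r))). lra. }
assert (E4 : th * exp (- (th * A)) - th * exp (- (th * a)) <= th ^ 2 * eps).
{ unfold a. replace (- (th * (A + eps))) with (- (th * A) + - (th * eps)) by ring. rewrite exp_plus.
  pose proof (exp_ineq1_le (- (th * eps))). assert (exp (- (th * A)) <= 1) by (apply exp_opp_le_1; nra).
  pose proof (exp_pos (- (th * A))). assert (exp (- (th * eps)) <= 1) by (apply exp_opp_le_1; nra).
  assert (exp (- (th * A)) * (1 - exp (- (th * eps))) <= 1 * (th * eps)) by (apply Rmult_le_compat; lra).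
  nra. }
assert (E5 : exp (- (th * a)) <= exp (- (th * A))) by (apply exp_le_compat; unfold a; nra).
pose proof (exp_pos (- (th * r))).
assert (E6 : 2 / r * ((th * a + 1) * exp (- (th * a)) - (th * r + 1) * exp (- (th * r))) <= 2 * / r).
{ unfold Rdiv. assert (0 <= (th * r + 1) * exp (- (th * r))) by (apply Rmult_le_pos; nra). nra. }
unfold Rdiv at 1. assert (0 <= th ^ 2 * eps) by nra. apply Rabs_le. split; nra.
Qed.

(** * Transport along a characteristic *)

Section Characteristic.

Context (K rho : R) (P : R -> R -> R) (alpha : R -> R).
Context (HK : 0 < K) (Hrho : 0 < rho) (HP : american_put_fbp K rho P alpha).
Context (sig : R -> R) (z0 : R) (Hz0 : 0 < z0).
Context (Hsig : forall z, z0 < z -> 0 < sig z /\ is_derive sig z (/ (rho * z * (z + 1)))).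

(** The free boundary seen along a characteristic [sig], which is kept abstract. It is
    differentiated for [z > z0] only, where time is positive and [alpha] is continuously
    differentiable. *)
Definition bdry (z : R) : R := alpha (sig z).

Lemma bdry_pos (z : R) : z0 < z -> 0 < bdry z.
Proof. intros Hz. apply (fbp_alpha_pos _ _ _ _ HP). destruct (Hsig z Hz). lra. Qed.

Lemma is_derive_bdry (z : R) : z0 < z ->
  is_derive bdry z (Derive alpha (sig z) * / (rho * z * (z + 1))).
Proof.
intros Hz. destruct (Hsig z Hz) as [Hs Hd].
destruct (fbp_alpha_C1 _ _ _ _ HP (sig z) Hs) as [Hea _].
unfold bdry. rewrite Rmult_comm.
apply (is_derive_comp alpha sig z _ _ (Derive_correct _ _ Hea) Hd).
Qed.

Lemma continuous_sig (z : R) : z0 < z -> continuous sig z.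
Proof. intros Hz. apply (ex_derive_continuous sig). eexists. apply Hsig, Hz. Qed.

Lemma continuous_bdry (z : R) : z0 < z -> continuous bdry z.
Proof. intros Hz. apply (ex_derive_continuous bdry). eexists. now apply is_derive_bdry. Qed.

Lemma continuous_Derive_bdry (z : R) : z0 < z ->
  continuous (fun z => Derive alpha (sig z) * / (rho * z * (z + 1))) z.
Proof.
intros Hz. destruct (Hsig z Hz) as [Hs Hd].
apply (continuous_mult (fun z => Derive alpha (sig z)) (fun z => / (rho * z * (z + 1)))).
- apply (continuous_comp sig (Derive alpha)); [now apply continuous_sig|].
  apply (fbp_alpha_C1 _ _ _ _ HP (sig z) Hs).
- apply (ex_derive_continuous (fun z => / (rho * z * (z + 1)))). auto_derive.
  apply Rgt_not_eq. apply Rmult_lt_0_compat; [apply Rmult_lt_0_compat|]; lra.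
Qed.

Lemma locally_2d_interior (z S : R) : z0 < z -> bdry z < S ->
  locally_2d (fun z S => z0 < z /\ bdry z < S) z S.
Proof.
intros Hz HS. apply locally_2d_and.
- apply locally_2d_lt; [apply continuity_2d_pt_const|apply continuity_2d_pt_id1|easy].
- apply locally_2d_lt; [|apply continuity_2d_pt_id2|easy].
  apply continuity_2d_pt_of_1d_fst. now apply continuous_bdry.
Qed.

Lemma continuity_2d_pt_interior (D : R -> R -> Prop) (f : R -> R -> R) (z S : R) :
  (forall S s, 0 < s -> alpha s < S -> D S s) -> cont2_on D f ->
  z0 < z -> bdry z < S -> continuity_2d_pt (fun z S => f S (sig z)) z S.
Proof.
intros HD Hf Hz HS.
apply (cont2_on_comp D f (fun _ S => S) (fun z _ => sig z)); [easy| | |].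
- generalize (locally_2d_interior z S Hz HS). apply locally_2d_impl, locally_2d_forall.
  intros u v [Hu Hv]. apply HD; [now apply Hsig|exact Hv].
- apply continuity_2d_pt_id2.
- apply continuity_2d_pt_of_1d_fst. now apply continuous_sig.
Qed.

Lemma continuity_2d_pt_excess (z S : R) : z0 < z -> bdry z < S ->
  continuity_2d_pt (fun z S => excess K P S (sig z)) z S.
Proof.
intros Hz HS. unfold excess. apply continuity_2d_pt_minus.
- apply (continuity_2d_pt_interior _ P z S) with (2 := fbp_cont _ _ _ _ HP); try easy.
  intros; lra.
- apply continuity_2d_pt_minus; [apply continuity_2d_pt_const|apply continuity_2d_pt_id2].
Qed.

Lemma is_derive_excess_S (s S : R) : 0 < s -> alpha s < S ->
  is_derive (fun S => excess K P S s) S (dS P S s + 1).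
Proof.
intros Hs HS. unfold excess.
assert (Hl : is_derive (fun S => K - S) S (-1)) by (auto_derive; trivial; ring).
evar_last.
{ apply (is_derive_minus (V := R_NormedModule) (fun S => P S s) (fun S => K - S)).
  - apply Derive_correct, (fbp_ex_dSS _ _ _ _ HP S s Hs HS).
  - exact Hl. }
unfold dS, minus, plus, opp; simpl. ring.
Qed.

Lemma is_derive_dS (s S : R) : 0 < s -> alpha s < S ->
  is_derive (fun S => dS P S s + 1) S (dSS P S s).
Proof.
intros Hs HS. evar_last.
{ apply (is_derive_plus (V := R_NormedModule) (fun S => dS P S s) (fun _ => 1)).
  - apply Derive_correct. apply (fbp_ex_dSS _ _ _ _ HP S s Hs HS).
  - apply (is_derive_const (K := R_AbsRing)). }
unfold dSS, plus, zero; simpl. apply Rplus_0_r.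
Qed.

Lemma is_derive_excess_char (z S : R) : z0 < z -> bdry z < S ->
  is_derive (fun z => excess K P S (sig z)) z (dt P S (sig z) * / (rho * z * (z + 1))).
Proof.
intros Hz HS. destruct (Hsig z Hz) as [Hs Hd]. unfold excess.
rewrite <- (Rminus_0_r (_ * _)).
apply (is_derive_minus (V := R_NormedModule) (fun z => P S (sig z)) (fun _ => K - S)).
- rewrite Rmult_comm. apply (is_derive_comp (fun s => P S s) sig z); [|exact Hd].
  apply Derive_correct, (fbp_ex_dt _ _ _ _ HP S (sig z) Hs HS).
- exact (is_derive_const (K := R_AbsRing) (V := R_NormedModule) (K - S) z).
Qed.

(** * The weighted excess over a truncated range, and its derivative along the characteristic *)

Definition weighted (r z S : R) : R := test_fun r (rho * z) S * excess K P S (sig z).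

Definition weighted_dz (r z S : R) : R :=
  (1 - S / r) ^ 2 * rho * (2 * (rho * z) - (rho * z) ^ 2 * S) * exp (- (rho * z * S)) * excess K P S (sig z)
  + test_fun r (rho * z) S * (dt P S (sig z) * / (rho * z * (z + 1))).

Lemma is_derive_weighted (r z S : R) : z0 < z -> bdry z < S ->
  is_derive (fun z => weighted r z S) z (weighted_dz r z S).
Proof.
intros Hz HS.
apply (is_derive_mult (fun z => test_fun r (rho * z) S) (fun z => excess K P S (sig z)) z).
- apply is_derive_test_fun_char.
- now apply is_derive_excess_char.
- intros; apply Rmult_comm.
Qed.

Lemma continuity_2d_pt_exp_char (z S : R) : continuity_2d_pt (fun z S => exp (- (rho * z * S))) z S.
Proof.
apply (continuity_1d_2d_pt_comp exp (fun z S => - (rho * z * S))).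
- apply derivable_continuous_pt, derivable_pt_exp.
- apply continuity_2d_pt_opp. apply continuity_2d_pt_mult; [|apply continuity_2d_pt_id2].
  apply continuity_2d_pt_mult; [apply continuity_2d_pt_const|apply continuity_2d_pt_id1].
Qed.

Lemma continuity_2d_pt_cutoff (r z S : R) : continuity_2d_pt (fun _ S => (1 - S / r) ^ 2) z S.
Proof.
apply (continuity_2d_pt_of_1d_snd (fun S => (1 - S / r) ^ 2)).
apply (ex_derive_continuous (fun S => (1 - S / r) ^ 2)). auto_derive; trivial.
Qed.

Lemma continuity_2d_pt_test_fun (r z S : R) :
  continuity_2d_pt (fun z S => test_fun r (rho * z) S) z S.
Proof.
unfold test_fun. apply continuity_2d_pt_mult; [apply continuity_2d_pt_cutoff|].
apply continuity_2d_pt_mult; [|apply continuity_2d_pt_exp_char].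
apply (continuity_2d_pt_of_1d_fst (fun z => (rho * z) ^ 2)).
apply (ex_derive_continuous (fun z => (rho * z) ^ 2)). auto_derive; trivial.
Qed.

Lemma continuity_2d_pt_weighted (r z S : R) : z0 < z -> bdry z < S ->
  continuity_2d_pt (weighted r) z S.
Proof.
intros Hz HS. apply continuity_2d_pt_mult; [apply continuity_2d_pt_test_fun|now apply continuity_2d_pt_excess].
Qed.

Lemma continuity_2d_pt_weighted_dz (r z S : R) : z0 < z -> bdry z < S ->
  continuity_2d_pt (weighted_dz r) z S.
Proof.
intros Hz HS. unfold weighted_dz. apply continuity_2d_pt_plus; apply continuity_2d_pt_mult.
- apply continuity_2d_pt_mult; [|apply continuity_2d_pt_exp_char].
  apply continuity_2d_pt_mult.
  + apply continuity_2d_pt_mult; [apply continuity_2d_pt_cutoff|apply continuity_2d_pt_const].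
  + apply continuity_2d_pt_minus.
    * apply (continuity_2d_pt_of_1d_fst (fun z => 2 * (rho * z))).
      apply (ex_derive_continuous (fun z => 2 * (rho * z))). auto_derive; trivial.
    * apply continuity_2d_pt_mult; [|apply continuity_2d_pt_id2].
      apply (continuity_2d_pt_of_1d_fst (fun z => (rho * z) ^ 2)).
      apply (ex_derive_continuous (fun z => (rho * z) ^ 2)). auto_derive; trivial.
- now apply continuity_2d_pt_excess.
- apply continuity_2d_pt_test_fun.
- apply continuity_2d_pt_mult.
  + apply (continuity_2d_pt_interior _ (dt P) z S) with (2 := fbp_dt_cont _ _ _ _ HP); easy.
  + apply (continuity_2d_pt_of_1d_fst (fun z => / (rho * z * (z + 1)))).
    apply (ex_derive_continuous (fun z => / (rho * z * (z + 1)))). auto_derive.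
    apply Rgt_not_eq. apply Rmult_lt_0_compat; [apply Rmult_lt_0_compat|]; lra.
Qed.

Lemma continuity_2d_pt_Derive_weighted (r z S : R) : z0 < z -> bdry z < S ->
  continuity_2d_pt (fun u v => Derive (fun z => weighted r z v) u) z S.
Proof.
intros Hz HS. apply (continuity_2d_pt_ext_loc (weighted_dz r)).
- generalize (locally_2d_interior z S Hz HS). apply locally_2d_impl, locally_2d_forall.
  intros u v [Hu Hv]. symmetry. apply is_derive_unique. now apply is_derive_weighted.
- now apply continuity_2d_pt_weighted_dz.
Qed.

Definition truncated (eps r z : R) : R := RInt (weighted r z) (bdry z + eps) r.

Lemma is_derive_truncated (eps r z : R) : z0 < z -> 0 < eps -> bdry z + eps < r ->
  is_derive (truncated eps r) z
    (RInt (weighted_dz r z) (bdry z + eps) r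
     - weighted r z (bdry z + eps) * (Derive alpha (sig z) * / (rho * z * (z + 1)))).
Proof.
intros Hz Heps Hr.
(* For these [y] the boundary lies below [bdry z + eps / 2], so ranges whose lower end is within
   [eps / 4] of [bdry z + eps] stay strictly inside the continuation region. *)
assert (Hloc : locally z (fun y => z0 < y /\ bdry y < bdry z + eps / 2)).
{ apply filter_and.
  - apply (open_gt z0 z Hz).
  - apply (continuous_bdry z Hz (fun b => b < bdry z + eps / 2)).
    apply (open_lt (bdry z + eps / 2) (bdry z)). lra. }
assert (Hex : forall y a b, z0 < y /\ bdry y < bdry z + eps / 2 ->
   bdry z + eps / 2 <= a -> bdry z + eps / 2 <= b -> ex_RInt (fun S => weighted r y S) a b).
{ intros y a b [Hy Hb] Ha Hb'. apply (ex_RInt_continuous (V := R_CompleteNormedModule)).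
  intros x Hx. apply (continuity_2d_pt_section (weighted r)). apply continuity_2d_pt_weighted; [easy|].
  revert Hx. unfold Rmin. destruct Rle_dec; lra. }
assert (He4 : 0 < eps / 4) by lra.
assert (Hzz : bdry z < bdry z + eps / 2) by lra.
pose proof (is_derive_RInt_param_bound_comp_aux2 (weighted r) (fun z => bdry z + eps) r z
  (Derive alpha (sig z) * / (rho * z * (z + 1)))) as H.
assert (ERI : RInt (fun t => Derive (fun u => weighted r u t) z) (bdry z + eps) r
   = RInt (weighted_dz r z) (bdry z + eps) r).
{ apply RInt_ext. intros x Hx. rewrite Rmin_left in Hx by lra.
  apply is_derive_unique, is_derive_weighted; lra. }
cbv beta in H. rewrite ERI in H. unfold Rminus. rewrite Ropp_mult_distr_l.
apply H; clear H.
- revert Hloc. apply filter_imp. intros y Hy. apply Hex; lra.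
- exists (mkposreal _ He4). revert Hloc. apply filter_imp. intros y Hy. simpl. apply Hex; lra.
- evar_last.
  { apply (is_derive_plus (V := R_NormedModule) bdry (fun _ => eps)).
    - now apply is_derive_bdry.
    - apply (is_derive_const (K := R_AbsRing)). }
  apply Rplus_0_r.
- exists (mkposreal _ He4). revert Hloc. apply filter_imp. intros y [Hy1 Hy2] t Ht. simpl in Ht.
  eexists. apply is_derive_weighted; [easy|].
  revert Ht. unfold Rmin. destruct Rle_dec; lra.
- intros t Ht. rewrite Rmin_left in Ht by lra. apply continuity_2d_pt_Derive_weighted; lra.
- generalize (locally_2d_interior z (bdry z + eps) Hz ltac:(lra)). apply locally_2d_impl, locally_2d_forall.
  intros u v [Hu Hv]. now apply continuity_2d_pt_Derive_weighted.
- apply continuity_pt_filterlim. apply (continuity_2d_pt_section (weighted r)).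
  apply continuity_2d_pt_weighted; lra.
Qed.

Lemma is_RInt_weighted_dz (eps r z : R) : z0 < z -> 0 < eps -> bdry z + eps < r ->
  RInt (weighted_dz r z) (bdry z + eps) r =
  / (rho * z * (z + 1)) *
  (- (test_flux_slope r (rho * z) (bdry z + eps) * (dS P (bdry z + eps) (sig z) + 1)
      + test_flux_value rho r (rho * z) (bdry z + eps) * excess K P (bdry z + eps) (sig z))
   + RInt (fun S => excess K P S (sig z) * test_error rho r (rho * z) S) (bdry z + eps) r
   - rho * K * RInt (test_fun r (rho * z)) (bdry z + eps) r).
Proof.
intros Hz Heps Hr. destruct (Hsig z Hz) as [Hs _]. pose proof (bdry_pos z Hz) as Hb.
assert (Ha0 : 0 < bdry z + eps) by lra.
set (a := bdry z + eps) in *. set (s := sig z) in *.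
set (p := fun S => excess K P S s). set (p' := fun S => dS P S s + 1).
set (F := fun S => test_flux_slope r (rho * z) S * p' S + test_flux_value rho r (rho * z) S * p S).
set (dF := fun S => test_flux_slope r (rho * z) S * dSS P S s + rho * test_flux_slope r (rho * z) S * p' S
      + Derive (test_flux_value rho r (rho * z)) S * p S).
assert (Hint : forall S, a <= S -> alpha s < S) by (intros S HS; change (bdry z < S); unfold a in HS; lra).
assert (Cp : forall S, a <= S -> continuous p S).
{ intros S HS. apply (ex_derive_continuous p). eexists. apply is_derive_excess_S; auto. }
assert (Cp' : forall S, a <= S -> continuous p' S).
{ intros S HS. apply (ex_derive_continuous p'). eexists. apply is_derive_dS; auto. }
assert (Cp'' : forall S, a <= S -> continuous (fun S => dSS P S s) S).
{ intros S HS. apply (continuity_2d_pt_section (fun z S => dSS P S (sig z))).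
  apply (continuity_2d_pt_interior _ (dSS P) z S) with (2 := fbp_dSS_cont _ _ _ _ HP); try easy. now apply Hint. }
assert (Ca : forall S, continuous (test_flux_slope r (rho * z)) S).
{ intros S. apply (ex_derive_continuous (test_flux_slope r (rho * z))). unfold test_flux_slope, test_fun. auto_derive; trivial. }
assert (Cb' : forall S, continuous (Derive (test_flux_value rho r (rho * z))) S).
{ intros S. apply (continuous_ext (fun S => (rho * z) ^ 2 * exp (- (rho * z * S)) *
    (- (rho * z) * (- (1 - S / r) ^ 2 + 2 / r * (1 - S / r) * S + (rho * z + rho) * (1 - S / r) ^ 2 * S)
     + 2 / r * (1 - S / r) + 2 / r * (1 - S / r) - 2 / r ^ 2 * S
     + (rho * z + rho) * ((1 - S / r) ^ 2 - 2 / r * (1 - S / r) * S)))).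
  - intros x. symmetry. apply is_derive_unique. unfold test_flux_value. auto_derive; trivial. field. lra.
  - apply (ex_derive_continuous (fun S => (rho * z) ^ 2 * exp (- (rho * z * S)) *
    (- (rho * z) * (- (1 - S / r) ^ 2 + 2 / r * (1 - S / r) * S + (rho * z + rho) * (1 - S / r) ^ 2 * S)
     + 2 / r * (1 - S / r) + 2 / r * (1 - S / r) - 2 / r ^ 2 * S
     + (rho * z + rho) * ((1 - S / r) ^ 2 - 2 / r * (1 - S / r) * S)))). auto_derive; trivial. }
assert (CE : forall S, continuous (test_error rho r (rho * z)) S).
{ intros S. apply (ex_derive_continuous (test_error rho r (rho * z))). unfold test_error. auto_derive; trivial. }
assert (Ct : forall S, continuous (test_fun r (rho * z)) S).
{ intros S. apply (ex_derive_continuous (test_fun r (rho * z))). unfold test_fun. auto_derive; trivial. }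
assert (I1 : is_RInt dF a r (minus (F r) (F a))).
{ apply (is_RInt_derive (V := R_CompleteNormedModule) F); rewrite Rmin_left by lra.
  - intros S HS. apply test_flux_derive; [apply is_derive_excess_S; [easy|apply Hint; lra]|apply is_derive_dS; [easy|apply Hint; lra]|lra].
  - intros S HS. apply (continuous_plus (V := R_NormedModule) (fun S => test_flux_slope r (rho * z) S * dSS P S s + rho * test_flux_slope r (rho * z) S * p' S)).
    + apply (continuous_plus (V := R_NormedModule) (fun S => test_flux_slope r (rho * z) S * dSS P S s)).
      * apply (continuous_mult (test_flux_slope r (rho * z)) (fun S => dSS P S s)); [apply Ca|apply Cp''; lra].
      * apply (continuous_mult (fun S => rho * test_flux_slope r (rho * z) S) p'); [|apply Cp'; lra].
        apply (continuous_mult (fun _ => rho)); [apply continuous_const|apply Ca].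
    + apply (continuous_mult (Derive (test_flux_value rho r (rho * z))) p); [apply Cb'|apply Cp; lra]. }
assert (I2 : is_RInt (fun S => p S * test_error rho r (rho * z) S) a r
   (RInt (fun S => p S * test_error rho r (rho * z) S) a r)).
{ apply (RInt_correct (V := R_CompleteNormedModule)), (ex_RInt_continuous (V := R_CompleteNormedModule)).
  intros S HS. rewrite Rmin_left in HS by lra. apply (continuous_mult p); [apply Cp; lra|apply CE]. }
assert (I3 : is_RInt (test_fun r (rho * z)) a r (RInt (test_fun r (rho * z)) a r)).
{ apply (RInt_correct (V := R_CompleteNormedModule)), ex_RInt_cont, Ct. }
(* Both flux coefficients contain the factor [1 - S / r], so neither [P] nor [dS P] contributes at
   [S = r]. *)
assert (FR : F r = 0).
{ unfold F, test_flux_slope, test_flux_value, test_fun. field. lra. }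
pose proof (is_RInt_plus (V := R_NormedModule) _ _ _ _ _ _ I1 I2) as I4.
apply (is_RInt_scal (V := R_NormedModule) _ _ _ (rho * K)) in I3.
pose proof (is_RInt_minus (V := R_NormedModule) _ _ _ _ _ _ I4 I3) as I5.
apply (is_RInt_scal (V := R_NormedModule) _ _ _ (/ (rho * z * (z + 1)))) in I5.
apply (is_RInt_ext _ (weighted_dz r z)) in I5.
- rewrite (is_RInt_unique _ _ _ _ I5).
  unfold minus, plus, opp, scal; simpl. unfold mult; simpl. rewrite FR. unfold F, p, p'. eq_in_R. ring.
- intros S HS. rewrite Rmin_left in HS by lra.
  unfold minus, plus, opp, scal; simpl. unfold mult; simpl.
  symmetry. unfold weighted_dz, dF, p, p'. fold s. rewrite (adjoint_identity K rho r z S _ (dS P S s + 1) (dSS P S s)).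
  + eq_in_R. ring.
  + easy.
  + lra.
  + lra.
  + rewrite (fbp_pde _ _ _ _ HP S s Hs) by (apply Hint; lra). unfold excess. ring.
Qed.

Context (B : R) (HB : 0 <= B).
Context (Hbound : forall z S, z0 < z -> 0 < S -> Rabs (excess K P S (sig z)) <= B + S).

(** Replacing [V] by [Rmax V 0] straightens the moving boundary to [V = 0] and extends [f] across
    it, so that one-sided continuity up to the boundary becomes two-dimensional continuity. *)
Lemma continuity_2d_pt_near_bdry (D : R -> R -> Prop) (f : R -> R -> R) (z V : R) :
  (forall S s, 0 < s -> alpha s <= S -> D S s) -> cont2_on D f -> z0 < z ->
  continuity_2d_pt (fun z V => f (bdry z + Rmax V 0) (sig z)) z V.
Proof.
intros HD Hf Hz.
apply (cont2_on_comp D f (fun z V => bdry z + Rmax V 0) (fun z _ => sig z)); [easy| | |].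
- assert (H : locally_2d (fun u _ => z0 < u) z V).
  { apply locally_2d_lt; [apply continuity_2d_pt_const|apply continuity_2d_pt_id1|easy]. }
  revert H. apply locally_2d_impl, locally_2d_forall. intros u v Hu.
  apply HD; [now apply Hsig|]. pose proof (Rmax_r v 0). change (bdry u <= bdry u + Rmax v 0). lra.
- apply continuity_2d_pt_plus.
  + apply continuity_2d_pt_of_1d_fst. now apply continuous_bdry.
  + apply continuity_2d_pt_Rmax_l, continuity_2d_pt_id2.
- apply continuity_2d_pt_of_1d_fst. now apply continuous_sig.
Qed.

Lemma excess_bdry (z : R) : z0 < z -> excess K P (bdry z) (sig z) = 0.
Proof.
intros Hz. unfold excess, bdry. rewrite (fbp_value_match _ _ _ _ HP) by now apply Hsig. ring.
Qed.

Lemma dS_bdry (z : R) : z0 < z -> dS P (bdry z) (sig z) = -1.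
Proof.
intros Hz. unfold dS. apply is_derive_unique. apply (fbp_smooth_fit _ _ _ _ HP). now apply Hsig.
Qed.

Lemma continuity_2d_pt_excess_shift (z V : R) : z0 < z ->
  continuity_2d_pt (fun z V => excess K P (bdry z + Rmax V 0) (sig z)) z V.
Proof.
intros Hz. unfold excess. apply continuity_2d_pt_minus.
- apply continuity_2d_pt_near_bdry with (2 := fbp_cont _ _ _ _ HP); [|easy]. intros; lra.
- apply continuity_2d_pt_minus; [apply continuity_2d_pt_const|].
  apply continuity_2d_pt_plus.
  + apply continuity_2d_pt_of_1d_fst. now apply continuous_bdry.
  + apply continuity_2d_pt_Rmax_l, continuity_2d_pt_id2.
Qed.

(** Uniform continuity near the compact set [[z1, z2] x {0}] makes the vanishing at the boundary
    uniform in [z], as integration in [z] requires. *)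
Lemma uniformly_small_near_bdry (f : R -> R -> R) (z1 z2 : R) :
  z0 < z1 -> (forall z, z0 < z -> continuity_2d_pt (fun z V => f (bdry z + Rmax V 0) (sig z)) z 0) ->
  (forall z, z0 < z -> f (bdry z) (sig z) = 0) ->
  forall delta, 0 < delta -> exists e, 0 < e /\ forall z eps, z1 <= z <= z2 -> 0 < eps <= e ->
    Rabs (f (bdry z + eps) (sig z)) <= delta.
Proof.
intros Hz1 Hf Hf0 delta Hdelta.
destruct (uniform_continuity_2d_1d (fun z V => f (bdry z + Rmax V 0) (sig z)) z1 z2 0
  ltac:(intros; apply Hf; lra) (mkposreal _ Hdelta)) as [d Hd]. simpl in Hd.
exists d. split; [apply d|]. intros z eps Hz Heps. pose proof (cond_pos d).
specialize (Hd z 0 z eps ltac:(lra) ltac:(lra) ltac:(lra) ltac:(lra)).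
rewrite (Rmax_left eps 0), (Rmax_left 0 0), Rplus_0_r in Hd by lra.
rewrite Hf0, Rminus_0_r in Hd by lra. left. apply Hd. rewrite Rminus_diag, Rabs_R0. lra.
Qed.

Lemma excess_small_near_bdry (z1 z2 : R) : z0 < z1 ->
  forall delta, 0 < delta -> exists e, 0 < e /\ forall z eps, z1 <= z <= z2 -> 0 < eps <= e ->
    Rabs (excess K P (bdry z + eps) (sig z)) <= delta.
Proof.
intros Hz1. apply (uniformly_small_near_bdry (excess K P)); [easy| |apply excess_bdry].
intros z Hz. now apply continuity_2d_pt_excess_shift.
Qed.

Lemma slope_small_near_bdry (z1 z2 : R) : z0 < z1 ->
  forall delta, 0 < delta -> exists e, 0 < e /\ forall z eps, z1 <= z <= z2 -> 0 < eps <= e ->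
    Rabs (dS P (bdry z + eps) (sig z) + 1) <= delta.
Proof.
intros Hz1. apply (uniformly_small_near_bdry (fun S s => dS P S s + 1)); [easy| |].
- intros z Hz. apply continuity_2d_pt_plus; [|apply continuity_2d_pt_const].
  apply continuity_2d_pt_near_bdry with (2 := fbp_dS_cont _ _ _ _ HP); easy.
- intros z Hz. rewrite dS_bdry by easy. ring.
Qed.

Definition char_kernel (z : R) : R := K * rho / (z + 1) * exp (- (rho * z * bdry z)).

Definition truncated_dz (eps r z : R) : R :=
  RInt (weighted_dz r z) (bdry z + eps) r
  - weighted r z (bdry z + eps) * (Derive alpha (sig z) * / (rho * z * (z + 1))).

Lemma Rinv_char_bound (z1 z : R) : 0 < z1 <= z -> 0 < / (rho * z * (z + 1)) <= / (rho * z1).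
Proof.
intros Hz. assert (0 < rho * z1) by nra. assert (rho * z1 <= rho * z * (z + 1)) by nra.
split; [apply Rinv_0_lt_compat; lra|apply Rinv_le_contravar; lra].
Qed.

(** Value matching and smooth fit make the boundary flux and the moving-endpoint term vanish with
    [eps]; the cutoff error vanishes as [r] grows. Only the source is left, and it converges to
    [- char_kernel z], all uniformly on [[z1, z2]]. *)
Lemma truncated_dz_limit (z1 z2 : R) : z0 < z1 <= z2 ->
  forall delta, 0 < delta -> exists e r0, 0 < e /\ forall eps r z,
    0 < eps <= e -> r0 <= r -> z1 <= z <= z2 ->
    bdry z + eps < r /\ Rabs (truncated_dz eps r z + char_kernel z) <= delta.
Proof.
intros Hz12 delta Hdelta.
destruct (bounded_on_segment bdry z1 z2) as [Am [HAm0 HAm]].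
{ intros z Hz. apply continuous_bdry. lra. }
destruct (bounded_on_segment (fun z => Derive alpha (sig z) * / (rho * z * (z + 1))) z1 z2) as [Dm [HDm0 HDm]].
{ intros z Hz. apply continuous_Derive_bdry. lra. }
set (th1 := rho * z1). set (th2 := rho * z2).
assert (Hth1 : 0 < th1) by (unfold th1; nra).
(* [c1] bounds the flux coefficients for [S <= Am + 1], and [c2 / r] bounds the cutoff error. Below,
   [m] collects the coefficients of a common error [d], taken as [delta / m]. *)
set (c1 := (Am + 1) * th2 ^ 2 + th2 ^ 2 * (1 + 2 * (Am + 1) + (th2 + rho) * (Am + 1))).
set (c2 := th2 ^ 2 * (6 + 4 * th2 + 2 * rho) * (B + 4 / th1) * (1 + 4 / th1) * (2 / th1)).
set (m := / th1 * (c1 + c2 + rho * K * (th2 ^ 2 + 3)) + th2 ^ 2 * Dm + 1).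
assert (Hth12 : th1 <= th2) by (unfold th1, th2; nra).
assert (H4 : 0 < 4 / th1) by (apply Rdiv_lt_0_compat; lra).
assert (H2 : 0 < 2 / th1) by (apply Rdiv_lt_0_compat; lra).
assert (Hi1 : 0 < / th1) by (apply Rinv_0_lt_compat; lra).
assert (Hq : 0 <= th2 ^ 2) by apply pow2_ge_0.
assert (Hc1 : 0 <= c1).
{ unfold c1. apply Rplus_le_le_0_compat; apply Rmult_le_pos; try lra. nra. }
assert (Hc2 : 0 <= c2).
{ unfold c2. repeat apply Rmult_le_pos; lra. }
assert (HrK : 0 < rho * K) by nra.
assert (Hm : 1 <= m).
{ unfold m. assert (0 <= / th1 * (c1 + c2 + rho * K * (th2 ^ 2 + 3))).
  { apply Rmult_le_pos; [lra|]. nra. }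
  nra. }
set (d := delta / m).
assert (Hd : 0 < d) by (apply Rdiv_lt_0_compat; lra).
destruct (excess_small_near_bdry z1 z2 ltac:(lra) d Hd) as [e1 [He1 HE1]].
destruct (slope_small_near_bdry z1 z2 ltac:(lra) d Hd) as [e2 [He2 HE2]].
set (e := Rmin (Rmin e1 e2) (Rmin 1 d)).
assert (He : 0 < e) by (repeat apply Rmin_pos; lra).
(* [Am + 2] puts [r] above the inset boundary, as [eps <= 1]; [/ d] gives [/ r <= d]. *)
exists e, (Rmax (Am + 2) (/ d)). split; [easy|].
intros eps r z Heps Hr Hz.
assert (Hee : eps <= e1 /\ eps <= e2 /\ eps <= 1 /\ eps <= d).
{ unfold e in Heps. pose proof (Rmin_l (Rmin e1 e2) (Rmin 1 d)). pose proof (Rmin_r (Rmin e1 e2) (Rmin 1 d)).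
  pose proof (Rmin_l e1 e2). pose proof (Rmin_r e1 e2). pose proof (Rmin_l 1 d). pose proof (Rmin_r 1 d). lra. }
pose proof (Rmax_l (Am + 2) (/ d)). pose proof (Rmax_r (Am + 2) (/ d)).
assert (Hir : 0 < / r <= d).
{ split; [apply Rinv_0_lt_compat; lra|]. rewrite <- (Rinv_inv d). apply Rinv_le_contravar; [|lra].
  now apply Rinv_0_lt_compat. }
assert (Hz' : z0 < z) by lra.
pose proof (bdry_pos z Hz') as Hb.
assert (HbA : bdry z <= Am).
{ specialize (HAm z Hz). rewrite Rabs_pos_eq in HAm; lra. }
split; [lra|].
specialize (HE1 z eps Hz ltac:(lra)). specialize (HE2 z eps Hz ltac:(lra)). specialize (HDm z Hz). cbv beta in HDm.
unfold truncated_dz. rewrite is_RInt_weighted_dz by lra.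
set (s' := / (rho * z * (z + 1))) in *. set (a := bdry z + eps) in *. set (th := rho * z).
assert (Ha : 0 < a <= Am + 1) by (unfold a; lra).
assert (Har : a < r) by lra.
assert (Hth : th1 <= th <= th2) by (unfold th1, th2, th; nra).
assert (Hs' : 0 < s' <= / th1) by (apply Rinv_char_bound; lra).
assert (X1 : Rabs (test_flux_slope r th a * (dS P a (sig z) + 1) + test_flux_value rho r th a * excess K P a (sig z)) <= c1 * d).
{ unfold c1. rewrite Rmult_plus_distr_r. eapply Rle_trans; [apply Rabs_triang|]. apply Rplus_le_compat.
  - apply Rabs_mult_le; [|exact HE2]. apply test_flux_slope_bound; lra.
  - apply Rabs_mult_le; [|exact HE1]. apply test_flux_value_bound; lra. }
assert (X2 : Rabs (RInt (fun S => excess K P S (sig z) * test_error rho r th S) a r) <= c2 * d).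
{ apply Rle_trans with (c2 / r).
  - unfold c2. apply test_error_integral_bound; try lra.
    + intros S HS. apply (ex_derive_continuous (fun S => excess K P S (sig z))). eexists.
      apply is_derive_excess_S; [now apply Hsig|]. change (bdry z < S). unfold a in HS. lra.
    + intros S HS. apply Hbound; lra.
  - unfold Rdiv. apply Rmult_le_compat_l; lra. }
assert (X3 : Rabs (RInt (test_fun r th) a r - th * exp (- (th * bdry z))) <= (th2 ^ 2 + 3) * d).
{ eapply Rle_trans; [apply test_fun_integral; unfold a in *; lra|].
  assert (th ^ 2 * eps <= th2 ^ 2 * d).
  { apply Rmult_le_compat; try lra. apply pow2_ge_0. apply pow_incr; lra. }
  unfold Rdiv. lra. }
assert (X4 : Rabs (weighted r z a * (Derive alpha (sig z) * s')) <= th2 ^ 2 * d * Dm).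
{ apply Rabs_mult_le; [|exact HDm]. apply Rabs_mult_le; [|exact HE1]. apply test_fun_bound; fold th; lra. }
assert (Ek : char_kernel z = s' * (rho * K * (th * exp (- (th * bdry z))))).
{ unfold char_kernel, s', th. field. split; lra. }
rewrite Ek.
set (F := test_flux_slope r th a * (dS P a (sig z) + 1) + test_flux_value rho r th a * excess K P a (sig z)) in *.
set (I2 := RInt (fun S => excess K P S (sig z) * test_error rho r th S) a r) in *.
set (I3 := RInt (test_fun r th) a r) in *. set (w := th * exp (- (th * bdry z))) in *.
set (W := weighted r z a * (Derive alpha (sig z) * s')) in *.
match goal with |- Rabs ?x <= _ => replace x with (s' * (- F + I2 - rho * K * (I3 - w)) - W) end.
2: { unfold W. ring. }
assert (X5 : Rabs (- F + I2 - rho * K * (I3 - w)) <= (c1 + c2 + rho * K * (th2 ^ 2 + 3)) * d).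
{ rewrite !Rmult_plus_distr_r, (Rmult_assoc (rho * K)).
  unfold Rminus at 1. eapply Rle_trans; [apply Rabs_triang|]. apply Rplus_le_compat.
  - eapply Rle_trans; [apply Rabs_triang|]. rewrite Rabs_Ropp. lra.
  - rewrite Rabs_Ropp. apply Rabs_mult_le; [rewrite Rabs_pos_eq; lra|exact X3]. }
assert (X6 : Rabs (s' * (- F + I2 - rho * K * (I3 - w))) <= / th1 * ((c1 + c2 + rho * K * (th2 ^ 2 + 3)) * d)).
{ apply Rabs_mult_le; [rewrite Rabs_pos_eq; lra|exact X5]. }
unfold Rminus at 1. eapply Rle_trans; [apply Rabs_triang|]. rewrite Rabs_Ropp.
apply Rle_trans with (m * d); [|unfold d; right; field; lra].
unfold m. nra.
Qed.

Lemma continuous_char_kernel (z : R) : z0 < z -> continuous char_kernel z.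
Proof.
intros Hz. apply (continuous_mult (fun z => K * rho / (z + 1)) (fun z => exp (- (rho * z * bdry z)))).
- apply (ex_derive_continuous (fun z => K * rho / (z + 1))). auto_derive. lra.
- apply (continuous_comp (fun z => - (rho * z * bdry z)) exp).
  + apply (continuous_opp (V := R_NormedModule) (fun z => rho * z * bdry z)).
    apply (continuous_mult (fun z => rho * z) bdry); [|now apply continuous_bdry].
    apply (ex_derive_continuous (fun z => rho * z)). auto_derive; trivial.
  + apply (ex_derive_continuous exp). auto_derive; trivial.
Qed.

(** The mean value theorem for [truncated] plus the primitive of [char_kernel] turns the uniform
    estimate of the derivative into one of the increment. *)
Lemma truncated_increment (z1 z2 : R) : z0 < z1 <= z2 ->
  forall delta, 0 < delta -> exists e r0, 0 < e /\ forall eps r,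
    0 < eps <= e -> r0 <= r ->
    Rabs (truncated eps r z2 - truncated eps r z1 + RInt char_kernel z1 z2) <= delta.
Proof.
intros Hz delta Hdelta.
assert (Hd : 0 < delta / (z2 - z1 + 1)) by (apply Rdiv_lt_0_compat; lra).
destruct (truncated_dz_limit z1 z2 Hz _ Hd) as [e [r0 [He H]]].
exists e, r0. split; [easy|]. intros eps r Heps Hr.
set (F := (fun z => truncated eps r z + RInt char_kernel z1 z) : R -> R).
assert (HI : forall z, z1 <= z -> is_derive (fun z => RInt char_kernel z1 z) z (char_kernel z)).
{ intros z Hz'. apply (is_derive_RInt (V := R_NormedModule) char_kernel (fun z => RInt char_kernel z1 z) z1 z).
  - generalize (open_gt z0 z ltac:(lra)). apply filter_imp. intros y Hy.
    apply (RInt_correct (V := R_CompleteNormedModule)), (ex_RInt_continuous (V := R_CompleteNormedModule)).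
    intros x Hx. apply continuous_char_kernel. revert Hx. unfold Rmin. destruct Rle_dec; lra.
  - apply continuous_char_kernel. lra. }
assert (HF : forall z, z1 <= z <= z2 -> is_derive F z (truncated_dz eps r z + char_kernel z)).
{ intros z Hz'. apply (is_derive_plus (V := R_NormedModule) (truncated eps r) (fun z => RInt char_kernel z1 z)).
  - apply is_derive_truncated; [lra|lra|]. apply (H eps r z Heps Hr Hz').
  - apply HI. lra. }
destruct (MVT_gen F z1 z2 (fun z => truncated_dz eps r z + char_kernel z)) as [c [Hc E]].
- rewrite Rmin_left, Rmax_right by lra. intros x Hx. apply HF. lra.
- rewrite Rmin_left, Rmax_right by lra. intros x Hx. apply continuity_pt_filterlim.
  apply (ex_derive_continuous F). eexists. now apply HF.
- rewrite Rmin_left, Rmax_right in Hc by lra.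
  replace (truncated eps r z2 - truncated eps r z1 + RInt char_kernel z1 z2) with (F z2 - F z1).
  2: { unfold F. rewrite (RInt_point (V := R_CompleteNormedModule) z1). change (@zero R_CompleteNormedModule) with 0. lra. }
  rewrite E. destruct (H eps r c Heps Hr Hc) as [_ Hb].
  apply Rle_trans with (delta / (z2 - z1 + 1) * (z2 - z1)).
  + apply Rabs_mult_le; [exact Hb|rewrite Rabs_pos_eq; lra].
  + apply Rle_trans with (delta / (z2 - z1 + 1) * (z2 - z1 + 1)); [|right; field; lra].
    apply Rmult_le_compat_l; lra.
Qed.

(** For [V >= 0] this is [Ptilde] at time [sig z]; freezing it for [V < 0] makes it continuous on
    the whole line. *)
Definition shifted_excess (z V : R) : R := excess K P (bdry z + Rmax V 0) (sig z).

(** The function [G] of the overview on the characteristic, after the substitution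
    [S = bdry z + V]. *)
Definition char_laplace (z : R) : R :=
  (rho * z) ^ 2 * exp (- (rho * z * bdry z)) * rlaplace (shifted_excess z) (rho * z).

Lemma continuous_shifted_excess (z V : R) : z0 < z -> continuous (shifted_excess z) V.
Proof.
intros Hz. apply (continuity_2d_pt_section (fun z V => excess K P (bdry z + Rmax V 0) (sig z))).
now apply continuity_2d_pt_excess_shift.
Qed.

Lemma shifted_excess_bound (z V : R) : z0 < z -> 0 <= V -> Rabs (shifted_excess z V) <= (B + bdry z) + V.
Proof.
intros Hz HV. unfold shifted_excess. rewrite Rmax_left by easy.
pose proof (bdry_pos z Hz). rewrite Rplus_assoc. apply Hbound; lra.
Qed.

(** After the shift by [bdry z] three errors separate: the cutoff, of order [1 / r], the missing
    piece [[0, eps]], and the Laplace tail beyond [r - bdry z]. *)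
Lemma truncated_limit (z : R) : z0 < z ->
  forall delta, 0 < delta -> exists e r0, 0 < e /\ forall eps r,
    0 < eps <= e -> r0 <= r -> Rabs (truncated eps r z - char_laplace z) <= delta.
Proof.
intros Hz delta Hdelta. set (A := bdry z). set (th := rho * z). set (u := shifted_excess z).
pose proof (bdry_pos z Hz) as HA. fold A in HA.
assert (Hth : 0 < th) by (unfold th; nra).
set (B' := B + A).
assert (Hu : forall V, continuous u V) by (intros; now apply continuous_shifted_excess).
assert (Hub : forall V, 0 <= V -> Rabs (u V) <= B' + V) by (intros; now apply shifted_excess_bound).
set (E := fun V => exp (- (th * V)) * u V).
assert (HEc : forall V, continuous E V).
{ intros V. apply (continuous_mult (fun V => exp (- (th * V))) u); [|apply Hu].
  apply (ex_derive_continuous (fun V => exp (- (th * V)))). auto_derive; trivial. }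
assert (HEb : forall V, 0 <= V -> Rabs (E V) <= (B' + V) * exp (- (th * V))).
{ intros V HV. rewrite Rmult_comm. apply Rabs_mult_le; [|now apply Hub].
  rewrite Rabs_pos_eq; [lra|left; apply exp_pos]. }
destruct (rlaplace_tail u B' th th Hu ltac:(unfold B'; lra) Hub ltac:(lra)) as [_ Htail].
set (C1 := (B' + 2 / th) * (2 / th)) in *.
set (C2 := 2 * ((A + 4 / th) * (B' + 4 / th)) * (2 / th)).
set (q := th ^ 2 * exp (- (th * A))).
assert (H4 : 0 < 4 / th) by (apply Rdiv_lt_0_compat; lra).
assert (H2 : 0 < 2 / th) by (apply Rdiv_lt_0_compat; lra).
assert (HB' : 0 <= B') by (unfold B'; lra).
assert (HC1 : 0 <= C1) by (unfold C1; apply Rmult_le_pos; lra).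
assert (HC2 : 0 <= C2) by (unfold C2; repeat apply Rmult_le_pos; lra).
assert (Hq : 0 < q) by (apply Rmult_lt_0_compat; [nra|apply exp_pos]).
set (m := q * (C2 + (B' + 1) + 1) + 1).
assert (Hm : 1 <= m) by (unfold m; assert (0 <= q * (C2 + (B' + 1) + 1)) by (apply Rmult_le_pos; lra); lra).
set (d := delta / m). assert (Hd : 0 < d) by (apply Rdiv_lt_0_compat; lra).
destruct (exp_eventually_small C1 (th / 2) d 0 HC1 ltac:(lra) Hd) as [b0 [Hb0 Hsmall]].
exists (Rmin 1 d), (A + b0 + 2 + / d). split; [apply Rmin_pos; lra|].
intros eps r Heps Hr. pose proof (Rmin_l 1 d). pose proof (Rmin_r 1 d).
assert (Hid : 0 < / d) by now apply Rinv_0_lt_compat.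
assert (Hir : 0 < / r <= d).
{ split; [apply Rinv_0_lt_compat; lra|]. rewrite <- (Rinv_inv d). apply Rinv_le_contravar; lra. }
set (b := r - A).
assert (Hb : b0 <= b /\ 1 < b) by (unfold b; lra).
assert (HwE : forall V, continuous (fun V => (1 - (V + A) / r) ^ 2 * E V) V).
{ intros V. apply (continuous_mult (fun V => (1 - (V + A) / r) ^ 2) E); [|apply HEc].
  apply (ex_derive_continuous (fun V => (1 - (V + A) / r) ^ 2)). auto_derive; trivial. }
assert (EN : truncated eps r z = q * RInt (fun V => (1 - (V + A) / r) ^ 2 * E V) eps b).
{ unfold truncated, truncated. fold A.
  assert (Hcl := RInt_comp_lin (V := R_CompleteNormedModule) (weighted r z) 1 A eps b).
  replace (1 * eps + A) with (A + eps) in Hcl by ring. replace (1 * b + A) with r in Hcl by (unfold b; ring).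
  rewrite <- Hcl.
  2: { apply (ex_RInt_continuous (V := R_CompleteNormedModule)). intros x Hx. rewrite Rmin_left in Hx by (unfold b in Hb; lra).
       apply (continuity_2d_pt_section (weighted r)). apply continuity_2d_pt_weighted; [easy|]. fold A. lra. }
  change (q * RInt (fun V => (1 - (V + A) / r) ^ 2 * E V) eps b)
    with (scal q (RInt (V := R_CompleteNormedModule) (fun V => (1 - (V + A) / r) ^ 2 * E V) eps b)).
  rewrite <- (RInt_scal (V := R_CompleteNormedModule)).
  2: { apply ex_RInt_cont. exact HwE. }
  apply RInt_ext. intros V HV. rewrite Rmin_left in HV by lra.
  change (1 * weighted r z (1 * V + A) = q * ((1 - (V + A) / r) ^ 2 * E V)).
  rewrite !Rmult_1_l. unfold weighted, weighted, test_fun, q, E, u, shifted_excess. fold th A.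
  rewrite Rmax_left by lra. replace (- (th * (V + A))) with (- (th * A) + - (th * V)) by ring.
  rewrite exp_plus, (Rplus_comm V A). ring. }
assert (Ew : RInt (fun V => (1 - (V + A) / r) ^ 2 * E V) eps b - rlaplace u th
  = - RInt (fun V => (1 - (1 - (V + A) / r) ^ 2) * E V) eps b - RInt E 0 eps - (rlaplace u th - RInt E 0 b)).
{ assert (S1 : RInt E 0 eps + RInt E eps b = RInt E 0 b).
  { apply (RInt_Chasles (V := R_CompleteNormedModule)); now apply ex_RInt_cont. }
  assert (S2 : RInt (fun V => (1 - (1 - (V + A) / r) ^ 2) * E V) eps b
     = RInt E eps b - RInt (fun V => (1 - (V + A) / r) ^ 2 * E V) eps b).
  { change (RInt (fun V => (1 - (1 - (V + A) / r) ^ 2) * E V) eps b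
     = minus (RInt E eps b) (RInt (V := R_CompleteNormedModule) (fun V => (1 - (V + A) / r) ^ 2 * E V) eps b)).
    rewrite <- (RInt_minus (V := R_CompleteNormedModule)).
    - apply RInt_ext. intros V _.
      change ((1 - (1 - (V + A) / r) ^ 2) * E V = E V - (1 - (V + A) / r) ^ 2 * E V). ring.
    - now apply ex_RInt_cont.
    - apply ex_RInt_cont. exact HwE. }
  rewrite S2. lra. }
assert (Y1 : Rabs (RInt (fun V => (1 - (1 - (V + A) / r) ^ 2) * E V) eps b) <= C2 * d).
{ apply Rle_trans with (C2 / r); [|unfold Rdiv; apply Rmult_le_compat_l; lra].
  replace (C2 / r) with (2 / r * ((A + 4 / th) * (B' + 4 / th)) / (th / 2)) by (unfold C2; field; lra).
  apply abs_RInt_exp_bound; try lra.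
  - apply Rmult_le_pos; [unfold Rdiv; lra|]. apply Rmult_le_pos; lra.
  - intros V _. apply (continuous_mult (fun V => 1 - (1 - (V + A) / r) ^ 2) E); [|apply HEc].
    apply (ex_derive_continuous (fun V => 1 - (1 - (V + A) / r) ^ 2)). auto_derive; trivial.
  - intros V HV. pose proof (cutoff_deficit r (V + A) ltac:(lra) ltac:(unfold b in HV; lra)) as Hdef.
    eapply Rle_trans.
    { apply Rabs_mult_le; [rewrite Rabs_pos_eq by lra; apply Hdef|apply HEb; lra]. }
    replace (2 * (V + A) / r * ((B' + V) * exp (- (th * V))))
      with (2 / r * ((A + V) * (B' + V) * exp (- (th * V)))) by (field; lra).
    rewrite (Rmult_assoc (2 / r)). apply Rmult_le_compat_l; [unfold Rdiv; lra|].
    apply quadratic_exp_bound; lra. }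
assert (Y2 : Rabs (RInt E 0 eps) <= (B' + 1) * d).
{ apply Rle_trans with ((eps - 0) * (B' + 1)).
  - apply abs_RInt_le_const; [lra|now apply ex_RInt_cont|]. intros V HV.
    eapply Rle_trans; [apply HEb; lra|]. rewrite <- (Rmult_1_r (B' + 1)).
    apply Rmult_le_compat; try lra. left; apply exp_pos. apply exp_opp_le_1; nra.
  - rewrite Rmult_comm, Rminus_0_r. apply Rmult_le_compat_l; lra. }
assert (Y3 : Rabs (rlaplace u th - RInt E 0 b) <= d).
{ eapply Rle_trans; [apply Htail; lra|]. left. apply Hsmall; lra. }
unfold char_laplace. fold A th u. rewrite EN.
change (th ^ 2 * exp (- (th * A))) with q. rewrite <- Rmult_minus_distr_l, Ew.
apply Rle_trans with (m * d); [|unfold d; right; field; lra].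
apply Rle_trans with (q * (C2 * d + (B' + 1) * d + d)); [|unfold m; nra].
apply Rabs_mult_le; [rewrite Rabs_pos_eq; lra|].
revert Y1 Y2 Y3. match goal with |- Rabs ?x <= _ -> Rabs ?y <= _ -> Rabs ?w <= _ -> _ => generalize x y w end.
intros x y w. unfold Rabs. repeat destruct Rcase_abs; lra.
Qed.

(** The three approximations are compared at one common pair of inset and cutoff radius; this is why
    the preceding limits hold for all small [eps] and large [r] jointly. *)
Lemma char_laplace_increment (z1 z2 : R) : z0 < z1 <= z2 ->
  char_laplace z1 - char_laplace z2 = RInt char_kernel z1 z2.
Proof.
intros Hz. apply Rminus_diag_uniq. apply cond_eq. intros delta Hdelta. rewrite Rminus_0_r.
destruct (truncated_increment z1 z2 Hz (delta / 4) ltac:(lra)) as [e1 [r1 [He1 H1]]].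
destruct (truncated_limit z1 ltac:(lra) (delta / 4) ltac:(lra)) as [e2 [r2 [He2 H2]]].
destruct (truncated_limit z2 ltac:(lra) (delta / 4) ltac:(lra)) as [e3 [r3 [He3 H3]]].
set (e := Rmin e1 (Rmin e2 e3)). set (r := Rmax r1 (Rmax r2 r3)).
assert (He : 0 < e) by (repeat apply Rmin_pos; lra).
assert (e <= e1 /\ e <= e2 /\ e <= e3).
{ unfold e. pose proof (Rmin_l e1 (Rmin e2 e3)). pose proof (Rmin_r e1 (Rmin e2 e3)).
  pose proof (Rmin_l e2 e3). pose proof (Rmin_r e2 e3). lra. }
assert (r1 <= r /\ r2 <= r /\ r3 <= r).
{ unfold r. pose proof (Rmax_l r1 (Rmax r2 r3)). pose proof (Rmax_r r1 (Rmax r2 r3)).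
  pose proof (Rmax_l r2 r3). pose proof (Rmax_r r2 r3). lra. }
specialize (H1 e r ltac:(lra) ltac:(lra)). specialize (H2 e r ltac:(lra) ltac:(lra)). specialize (H3 e r ltac:(lra) ltac:(lra)).
revert H1 H2 H3. generalize (truncated e r z1) (truncated e r z2) (char_laplace z1) (char_laplace z2) (RInt char_kernel z1 z2 : R).
intros t1 t2 g1 g2 k. unfold Rabs. repeat destruct Rcase_abs; lra.
Qed.

End Characteristic.

(** * The two representations *)

Lemma put_linear_growth (K rho : R) (P : R -> R -> R) (alpha : R -> R) (T : R) :
  0 < K -> american_put_fbp K rho P alpha ->
  exists B, 0 <= B /\ forall S s, 0 < S -> 0 <= s <= T -> Rabs (excess K P S s) <= B + S.
Proof.
intros HK HP. destruct (fbp_bounded _ _ _ _ HP T) as [M HM].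
exists (Rabs M + K). split; [pose proof (Rabs_pos M); lra|]. intros S s HS Hs.
specialize (HM S s HS Hs). pose proof (Rle_abs M). unfold excess.
apply Rabs_le. apply Rabs_le_between in HM. lra.
Qed.

Lemma continuous_bdry_Rmax (alpha : R -> R) (t : R) :
  continuous_on (fun t => 0 <= t) alpha -> continuous (fun t => alpha (Rmax t 0)) t.
Proof.
intros Ha. apply (continuity_2d_pt_section (fun _ t => alpha (Rmax t 0)) 0).
apply (continuous_on_ge0_locally alpha (fun _ t => Rmax t 0)); [easy| |].
- apply locally_2d_forall. intros. apply Rmax_r.
- apply continuity_2d_pt_Rmax_l, continuity_2d_pt_id2.
Qed.

(** The positive lower bound comes from boundedness of the continuous function [/ alpha] on a
    compact interval. It provides the exponential decay of [char_laplace] at infinity. *)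
Lemma bdry_segment_bounds (K rho : R) (P : R -> R -> R) (alpha : R -> R) (T : R) :
  american_put_fbp K rho P alpha ->
  exists a A, 0 < a /\ forall s, 0 <= s <= T -> a <= alpha s <= A.
Proof.
intros HP. pose proof (fbp_alpha_cont _ _ _ _ HP) as Hc.
destruct (bounded_on_segment (fun t => alpha (Rmax t 0)) 0 T) as [A [HA0 HA]].
{ intros; now apply continuous_bdry_Rmax. }
destruct (bounded_on_segment (fun t => / alpha (Rmax t 0)) 0 T) as [M [HM0 HM]].
{ intros z Hz. apply (continuous_comp (fun t => alpha (Rmax t 0)) Rinv); [now apply continuous_bdry_Rmax|].
  apply (ex_derive_continuous Rinv). auto_derive.
  apply Rgt_not_eq, (fbp_alpha_pos _ _ _ _ HP), Rmax_r. }
exists (/ (M + 1)), A. split; [apply Rinv_0_lt_compat; lra|]. intros s Hs.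
specialize (HA s Hs). specialize (HM s Hs). cbv beta in *. rewrite Rmax_left in HA, HM by lra.
pose proof (fbp_alpha_pos _ _ _ _ HP s ltac:(lra)) as Hp.
split; [|apply Rle_trans with (Rabs (alpha s)); [apply Rle_abs|easy]].
rewrite Rabs_pos_eq in HM by (left; now apply Rinv_0_lt_compat).
rewrite <- (Rinv_inv (alpha s)). apply Rinv_le_contravar; [now apply Rinv_0_lt_compat|lra].
Qed.

Lemma continuity_2d_pt_excess_ge0 (K rho : R) (P : R -> R -> R) (alpha : R -> R) (tau : R -> R) (z V : R) :
  american_put_fbp K rho P alpha -> (forall z, 0 <= tau z) -> continuous tau z ->
  continuity_2d_pt (fun z V => shifted_excess K P alpha tau z V) z V.
Proof.
intros HP Htau Hc. unfold shifted_excess, excess, bdry.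
assert (Ct : continuity_2d_pt (fun z (_ : R) => tau z) z V) by now apply continuity_2d_pt_of_1d_fst.
assert (Ca : continuity_2d_pt (fun z (_ : R) => alpha (tau z)) z V).
{ apply (continuous_on_ge0_locally alpha (fun z _ => tau z)); [apply (fbp_alpha_cont _ _ _ _ HP)| |easy].
  apply locally_2d_forall. intros; apply Htau. }
assert (CS : continuity_2d_pt (fun z V => alpha (tau z) + Rmax V 0) z V).
{ apply continuity_2d_pt_plus; [easy|]. apply continuity_2d_pt_Rmax_l, continuity_2d_pt_id2. }
apply continuity_2d_pt_minus.
- apply (cont2_on_comp _ P _ _ z V (fbp_cont _ _ _ _ HP)); try easy.
  apply locally_2d_forall. intros u v. split; [apply Htau|]. pose proof (Rmax_r v 0). lra.
- apply continuity_2d_pt_minus; [apply continuity_2d_pt_const|easy].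
Qed.

(** The increment formula holds strictly after the start of the characteristic. Continuity of [P]
    and [alpha] down to time 0 is enough to reach the start; there [tau] is any continuous path of
    bounded nonnegative times. *)
Lemma continuous_char_laplace (K rho : R) (P : R -> R -> R) (alpha : R -> R) (tau : R -> R) (T z : R) :
  0 < K -> 0 < rho -> american_put_fbp K rho P alpha ->
  (forall z, 0 <= tau z <= T) -> (forall z, continuous tau z) -> 0 < z ->
  continuous (char_laplace K rho P alpha tau) z.
Proof.
intros HK Hrho HP Htau Hc Hz.
destruct (put_linear_growth K rho P alpha T HK HP) as [B [HB HBd]].
destruct (bdry_segment_bounds K rho P alpha T HP) as [a [A [Ha HA]]].
assert (Hbd : forall z, 0 < bdry alpha tau z <= A).
{ intros y. unfold bdry. specialize (HA (tau y) (Htau y)). lra. }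
assert (HA0 : 0 <= A) by (specialize (Hbd z); lra).
assert (Cu : forall y V, continuity_2d_pt (shifted_excess K P alpha tau) y V).
{ intros y V. apply (continuity_2d_pt_excess_ge0 K rho); auto. apply Htau. }
assert (Cu1 : forall y V, continuous (shifted_excess K P alpha tau y) V).
{ intros y V. apply (continuity_2d_pt_section (shifted_excess K P alpha tau)), Cu. }
assert (Bu : forall y V, 0 <= V -> Rabs (shifted_excess K P alpha tau y V) <= (B + A) + V).
{ intros y V HV. unfold shifted_excess. rewrite Rmax_left by easy. specialize (Hbd y).
  eapply Rle_trans; [apply HBd; [lra|apply Htau]|]. lra. }
assert (Cb : continuous (bdry alpha tau) z).
{ unfold bdry. apply (continuous_ext (fun z => alpha (Rmax (tau z) 0))).
  - intros y. rewrite Rmax_left; [easy|apply Htau].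
  - apply (continuous_comp tau (fun t => alpha (Rmax t 0))); [apply Hc|].
    apply continuous_bdry_Rmax, (fbp_alpha_cont _ _ _ _ HP). }
unfold char_laplace.
apply (continuous_mult (fun z => (rho * z) ^ 2 * exp (- (rho * z * bdry alpha tau z)))).
- apply (continuous_mult (fun z => (rho * z) ^ 2)).
  + apply (ex_derive_continuous (fun z => (rho * z) ^ 2)). auto_derive; trivial.
  + apply (continuous_comp (fun z => - (rho * z * bdry alpha tau z)) exp).
    * apply (continuous_opp (V := R_NormedModule) (fun z => rho * z * bdry alpha tau z)).
      apply (continuous_mult (fun z => rho * z)); [|exact Cb].
      apply (ex_derive_continuous (fun z => rho * z)). auto_derive; trivial.
    * apply (ex_derive_continuous exp). auto_derive; trivial.
- apply filterlim_locally. intros eps. pose proof (cond_pos eps) as Heps.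
  (* A common lower bound for the transform variable at all [y > z / 2], so that one truncation
     point [b] serves a whole neighbourhood of [z]. *)
  set (th1 := rho * (z / 2)). assert (Hth1 : 0 < th1) by (apply Rmult_lt_0_compat; lra).
  set (C := (B + A + 2 / th1) * (2 / th1)).
  assert (HC : 0 <= C).
  { assert (0 < 2 / th1) by (apply Rdiv_lt_0_compat; lra). apply Rmult_le_pos; lra. }
  destruct (exp_eventually_small C (th1 / 2) (eps / 4) 0 HC ltac:(lra) ltac:(lra)) as [b [Hb Hsm]].
  specialize (Hsm b ltac:(lra)).
  set (g := fun y V => exp (- (rho * y * V)) * shifted_excess K P alpha tau y V).
  assert (Cg : forall y V, continuity_2d_pt g y V).
  { intros y V. apply continuity_2d_pt_mult; [apply continuity_2d_pt_exp_char|apply Cu]. }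
  assert (Hcont : continuous (fun y => RInt (g y) 0 b) z).
  { apply (continuous_RInt_param g 0 b z Hb); [intros; apply Cg|].
    apply filter_forall. intros y. apply ex_RInt_cont. intros x. apply (continuity_2d_pt_section g), Cg. }
  assert (He4 : 0 < eps / 4) by lra.
  pose proof (proj1 (filterlim_locally _ _) Hcont (mkposreal _ He4)) as Hc4.
  assert (Hz2 : locally z (fun y => z / 2 < y)) by (apply (open_gt (z / 2) z); lra).
  generalize (filter_and _ _ Hc4 Hz2). apply filter_imp. intros y [Hy1 Hy2].
  assert (Htl : forall y, z / 2 < y ->
     Rabs (rlaplace (shifted_excess K P alpha tau y) (rho * y) - RInt (g y) 0 b) <= eps / 4).
  { intros x Hx.
    assert (Hth : 0 < th1 <= rho * x) by (unfold th1 in *; nra).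
    destruct (rlaplace_tail (shifted_excess K P alpha tau x) (B + A) th1 (rho * x) (Cu1 x) ltac:(lra) (Bu x) Hth) as [_ Ht].
    eapply Rle_trans; [apply (Ht b Hb)|]. fold C. lra. }
  pose proof (Htl y Hy2) as T1. pose proof (Htl z ltac:(lra)) as T2.
  change (Rabs (RInt (g y) 0 b - RInt (g z) 0 b) < eps / 4) in Hy1.
  change (Rabs (rlaplace (shifted_excess K P alpha tau y) (rho * y) - rlaplace (shifted_excess K P alpha tau z) (rho * z)) < eps).
  revert T1 T2 Hy1. generalize (rlaplace (shifted_excess K P alpha tau y) (rho * y))
    (rlaplace (shifted_excess K P alpha tau z) (rho * z)) (RInt (g y) 0 b : R) (RInt (g z) 0 b : R).
  intros x1 x2 x3 x4. unfold Rabs. repeat destruct Rcase_abs; lra.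
Qed.

(** * Integration along the explicit characteristic *)

Lemma char_laplace_ext (K rho : R) (P : R -> R -> R) (alpha s1 s2 : R -> R) (z : R) :
  s1 z = s2 z -> char_laplace K rho P alpha s1 z = char_laplace K rho P alpha s2 z.
Proof. intros E. unfold char_laplace, shifted_excess, bdry. now rewrite E. Qed.

Lemma char_kernel_ext (K rho : R) (alpha s1 s2 : R -> R) (z : R) :
  s1 z = s2 z -> char_kernel K rho alpha s1 z = char_kernel K rho alpha s2 z.
Proof. intros E. unfold char_kernel, bdry. now rewrite E. Qed.

(** The solution of [ds/dz = 1 / (rho z (z + 1))] that equals [t] at [z = th / rho];
    [ln (z / (z + 1))] is a primitive of [1 / (z (z + 1))]. *)
Definition char_time (rho th t z : R) : R := t + / rho * ln ((th + rho) / th * (z / (z + 1))).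

Lemma char_time_start (rho th t : R) : 0 < rho -> 0 < th -> char_time rho th t (th / rho) = t.
Proof.
intros Hr Ht. unfold char_time.
replace ((th + rho) / th * (th / rho / (th / rho + 1))) with 1 by (field; lra).
rewrite ln_1. ring.
Qed.

Lemma char_time_derive (rho th t z : R) : 0 < rho -> 0 < th -> 0 < z ->
  is_derive (char_time rho th t) z (/ (rho * z * (z + 1))).
Proof.
intros Hr Ht Hz. unfold char_time. auto_derive.
- split; [lra|]. split; [|easy]. apply Rmult_lt_0_compat; apply Rdiv_lt_0_compat; lra.
- field. lra.
Qed.

Lemma char_time_gt (rho th t z : R) : 0 < rho -> 0 < th -> th / rho < z -> t < char_time rho th t z.
Proof.
intros Hr Ht Hz. unfold char_time.
assert (Hz0 : 0 < th / rho) by (apply Rdiv_lt_0_compat; lra).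
assert (H1 : 1 < (th + rho) / th * (z / (z + 1))).
{ apply Rmult_lt_reg_r with (th * (z + 1)); [apply Rmult_lt_0_compat; lra|].
  replace ((th + rho) / th * (z / (z + 1)) * (th * (z + 1))) with ((th + rho) * z) by (field; lra).
  assert (th < rho * z).
  { replace th with (rho * (th / rho)) at 1 by (field; lra). apply Rmult_lt_compat_l; lra. }
  lra. }
pose proof (ln_increasing 1 _ ltac:(lra) H1) as Hl. rewrite ln_1 in Hl.
pose proof (Rinv_0_lt_compat rho Hr). nra.
Qed.

(** As [z / (z + 1) <= 1], an unbounded range of [z] takes a bounded time, so that finite-horizon
    bounds on price and boundary cover the whole characteristic. *)
Lemma char_time_le (rho th t z : R) : 0 < rho -> 0 < th -> 0 < z ->
  char_time rho th t z <= t + / rho * ln ((th + rho) / th).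
Proof.
intros Hr Ht Hz. unfold char_time. apply Rplus_le_compat_l.
apply Rmult_le_compat_l; [left; now apply Rinv_0_lt_compat|].
assert (Hq : 0 < (th + rho) / th) by (apply Rdiv_lt_0_compat; lra).
apply ln_le; [apply Rmult_lt_0_compat; [easy|apply Rdiv_lt_0_compat; lra]|].
rewrite <- (Rmult_1_r ((th + rho) / th)) at 2. apply Rmult_le_compat_l; [lra|].
apply (Rdiv_le_1 z (z + 1)); lra.
Qed.

(** The increment formula is integrated from the start, reached by continuity, to infinity, where
    [char_laplace] vanishes. With [t = 0] included, this serves both representations. *)
Lemma kernel_integral (K rho : R) (P : R -> R -> R) (alpha : R -> R) (th t : R) :
  0 < K -> 0 < rho -> american_put_fbp K rho P alpha -> 0 < th -> 0 <= t ->
  is_kernel_integral rho alpha th t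
    (th ^ 2 * exp (- (th * alpha t))
     * rlaplace (fun V => excess K P (alpha t + Rmax V 0) t) th / (K * rho)).
Proof.
intros HK Hrho HP Hth Ht.
set (z0 := th / rho). assert (Hz0 : 0 < z0) by (apply Rdiv_lt_0_compat; lra).
set (sig := char_time rho th t). set (T := t + / rho * ln ((th + rho) / th)).
assert (Hsig : forall z, z0 < z -> 0 < sig z /\ is_derive sig z (/ (rho * z * (z + 1)))).
{ intros z Hz. split; [|apply char_time_derive; lra].
  pose proof (char_time_gt rho th t z Hrho Hth Hz). unfold sig. lra. }
assert (Hsig0 : sig z0 = t) by now apply char_time_start.
(* Freezing time below [z0] yields a path defined for every [z], continuous and with values in
   [[0, T]], as the continuity lemma demands. *)
set (tau := fun z => sig (Rmax z z0)).
assert (Htau_sig : forall z, z0 <= z -> tau z = sig z) by (intros z Hz; unfold tau; now rewrite Rmax_left).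
assert (Htau : forall z, 0 <= tau z <= T).
{ intros z. unfold tau. pose proof (Rmax_r z z0) as Hm. split; [|apply char_time_le; lra].
  destruct Hm as [Hm| <-]; [|lra]. left. now apply Hsig. }
assert (Ctau : forall z, continuous tau z).
{ intros z. apply (continuous_comp (fun z => Rmax z z0) sig).
  - apply (continuity_2d_pt_section (fun _ z => Rmax z z0) 0).
    apply continuity_2d_pt_Rmax_l, continuity_2d_pt_id2.
  - apply (ex_derive_continuous sig). eexists. apply char_time_derive; try lra.
    pose proof (Rmax_r z z0). lra. }
destruct (put_linear_growth K rho P alpha T HK HP) as [B [HB HBd]].
destruct (bdry_segment_bounds K rho P alpha T HP) as [a [A [Ha HA]]].
assert (Hbound : forall z S, z0 < z -> 0 < S -> Rabs (excess K P S (sig z)) <= B + S).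
{ intros z S Hz HS. apply HBd; [easy|]. rewrite <- Htau_sig by lra. apply Htau. }
set (G := char_laplace K rho P alpha tau). set (k := char_kernel K rho alpha tau).
assert (CG : forall z, 0 < z -> continuous G z).
{ intros z Hz. now apply (continuous_char_laplace K rho P alpha tau T). }
assert (Ck : forall z, 0 < z -> continuous k z).
{ intros z Hz. unfold k, char_kernel, bdry.
  apply (continuous_mult (fun z => K * rho / (z + 1))).
  - apply (ex_derive_continuous (fun z => K * rho / (z + 1))). auto_derive. lra.
  - apply (continuous_comp (fun z => - (rho * z * alpha (tau z))) exp); [|apply (ex_derive_continuous exp); auto_derive; trivial].
    apply (continuous_opp (V := R_NormedModule) (fun z => rho * z * alpha (tau z))).
    apply (continuous_mult (fun z => rho * z)).
    + apply (ex_derive_continuous (fun z => rho * z)). auto_derive; trivial.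
    + apply (continuous_ext (fun z => alpha (Rmax (tau z) 0))).
      * intros y. rewrite Rmax_left; [easy|apply Htau].
      * apply (continuous_comp tau (fun t => alpha (Rmax t 0))); [apply Ctau|].
        apply continuous_bdry_Rmax, (fbp_alpha_cont _ _ _ _ HP). }
assert (Exk : forall x y, z0 <= x -> z0 <= y -> ex_RInt k x y).
{ intros x y Hx Hy. apply (ex_RInt_continuous (V := R_CompleteNormedModule)). intros z Hz. apply Ck.
  revert Hz. unfold Rmin. destruct Rle_dec; lra. }
assert (Inc : forall z1 z2, z0 < z1 <= z2 -> G z1 - G z2 = RInt k z1 z2).
{ intros z1 z2 Hz. unfold G.
  rewrite !(char_laplace_ext K rho P alpha tau sig) by (apply Htau_sig; lra).
  rewrite (char_laplace_increment K rho P alpha HK Hrho HP sig z0 Hz0 Hsig B HB Hbound z1 z2 Hz).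
  apply RInt_ext. intros z Hz'. rewrite Rmin_left in Hz' by lra.
  symmetry. apply char_kernel_ext, Htau_sig. lra. }
(* [G z - RInt k z z2] equals [G z2] for every [z] in [(z0, z2]] and is continuous at [z0]. *)
assert (Inc0 : forall z2, z0 <= z2 -> G z0 - G z2 = RInt k z0 z2).
{ intros z2 [Hz2| <-]; [|rewrite (RInt_point (V := R_CompleteNormedModule)); apply Rminus_diag].
  assert (Hlim : continuous (fun z => G z - RInt k z z2) z0).
  { apply (continuous_minus (V := R_NormedModule) G (fun z => RInt k z z2)); [now apply CG|].
    apply (ex_derive_continuous (fun z => RInt k z z2)). exists (opp (k z0)).
    apply (is_derive_RInt' (V := R_NormedModule) k (fun z => RInt k z z2) z0 z2); [|now apply Ck].
    generalize (open_gt 0 z0 Hz0). apply filter_imp. intros y Hy.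
    apply (RInt_correct (V := R_CompleteNormedModule)), (ex_RInt_continuous (V := R_CompleteNormedModule)).
    intros z Hz. apply Ck. revert Hz. unfold Rmin. destruct Rle_dec; lra. }
  apply Rminus_diag_uniq. apply cond_eq. intros delta Hdelta. rewrite Rminus_0_r.
  destruct (proj1 (filterlim_locally _ _) Hlim (mkposreal _ Hdelta)) as [d Hd].
  set (z1 := z0 + Rmin (d / 2) (z2 - z0)).
  assert (Hz1 : 0 < Rmin (d / 2) (z2 - z0)).
  { pose proof (cond_pos d). apply Rmin_pos; lra. }
  pose proof (Rmin_l (d / 2) (z2 - z0)). pose proof (Rmin_r (d / 2) (z2 - z0)).
  assert (Hball : ball z0 d z1).
  { change (Rabs (z1 - z0) < d). unfold z1. rewrite Rabs_pos_eq; pose proof (cond_pos d); lra. }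
  specialize (Hd z1 Hball).
  change (Rabs ((G z1 - RInt k z1 z2) - (G z0 - RInt k z0 z2)) < delta) in Hd.
  specialize (Inc z1 z2 ltac:(unfold z1; lra)).
  revert Hd. rewrite <- Inc. rewrite <- Rabs_Ropp.
  replace (- (G z1 - (G z1 - G z2) - (G z0 - RInt k z0 z2))) with (G z0 - G z2 - RInt k z0 z2); [easy|].
  eq_in_R. ring. }
assert (HG0 : G z0 = th ^ 2 * exp (- (th * alpha t)) * rlaplace (fun V => excess K P (alpha t + Rmax V 0) t) th).
{ unfold G, char_laplace, shifted_excess, bdry. rewrite Htau_sig, Hsig0 by lra.
  replace (rho * z0) with th by (unfold z0; field; lra). reflexivity. }
(* The transform is bounded by [C], while its factor [th^2 e^{- th alpha}] is at most
   [th^2 e^{- a th}] with [th = rho * z]; the quadratic bound with zero offsets disposes of the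
   square. *)
assert (HGlim : filterlim G (Rbar_locally p_infty) (locally 0)).
{ apply filterlim_locally. intros eps. pose proof (cond_pos eps) as Heps.
  assert (HA0 : 0 <= A) by (specialize (HA (tau z0) (Htau z0)); lra).
  set (C := (B + A + 2 / th) * (2 / th)).
  assert (HC : 0 <= C).
  { assert (0 < 2 / th) by (apply Rdiv_lt_0_compat; lra). apply Rmult_le_pos; lra. }
  assert (Hq : 0 <= (0 + 4 / a) * (0 + 4 / a)).
  { apply Rmult_le_pos; apply Rplus_le_le_0_compat; try lra; apply Rdiv_le_0_compat; lra. }
  (* The threshold starts at [th], so that [rho * z >= th] and the tail estimate with lower bound
     [th] applies. *)
  destruct (exp_eventually_small ((0 + 4 / a) * (0 + 4 / a) * C) (a / 2) eps th) as [x0 [Hx0 Hsm]].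
  { now apply Rmult_le_pos. } { lra. } { easy. }
  exists (x0 / rho). intros z Hz.
  assert (Hzx : x0 < rho * z).
  { replace x0 with (rho * (x0 / rho)) by (field; lra). apply Rmult_lt_compat_l; lra. }
  assert (Hz' : 0 < z).
  { apply Rmult_lt_reg_l with rho; lra. }
  change (Rabs (G z - 0) < eps). rewrite Rminus_0_r.
  assert (Hb := HA (tau z) (Htau z)).
  destruct (rlaplace_tail (shifted_excess K P alpha tau z) (B + A) th (rho * z)) as [_ Htl].
  - intros V. apply (continuity_2d_pt_section (shifted_excess K P alpha tau)).
    apply (continuity_2d_pt_excess_ge0 K rho); auto. apply Htau.
  - lra.
  - intros V HV. unfold shifted_excess, bdry. rewrite Rmax_left by easy.
    eapply Rle_trans; [apply HBd; [lra|apply Htau]|]. lra.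
  - lra.
  - specialize (Htl 0 ltac:(lra)). rewrite (RInt_point (V := R_CompleteNormedModule)) in Htl.
    change (@zero R_CompleteNormedModule) with 0 in Htl. rewrite Rminus_0_r in Htl.
    rewrite Rmult_0_r, Ropp_0, exp_0, Rmult_1_r in Htl. fold C in Htl.
    specialize (Hsm (rho * z) ltac:(lra)). eapply Rle_lt_trans; [|exact Hsm].
    replace ((0 + 4 / a) * (0 + 4 / a) * C * exp (- (a / 2 * (rho * z))))
      with ((0 + 4 / a) * (0 + 4 / a) * exp (- (a / 2 * (rho * z))) * C) by ring.
    unfold G, char_laplace. apply Rabs_mult_le; [|exact Htl].
    pose proof (pow2_ge_0 (rho * z)).
    rewrite Rabs_pos_eq by (apply Rmult_le_pos; [easy|left; apply exp_pos]).
    apply Rle_trans with ((0 + rho * z) * (0 + rho * z) * exp (- (a * (rho * z)))).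
    + replace ((0 + rho * z) * (0 + rho * z)) with ((rho * z) ^ 2) by ring.
      apply Rmult_le_compat_l; [easy|]. apply exp_le_compat. unfold bdry. nra.
    + apply quadratic_exp_bound; lra. }
rewrite <- HG0. unfold is_kernel_integral. fold z0.
assert (HKr : K * rho <> 0) by (apply Rgt_not_eq; nra).
apply (is_RInt_gen_at_point_infty _ (fun b => (G z0 - G b) / (K * rho))).
- intros b Hb. apply (is_RInt_ext (fun z => / (K * rho) * k z)).
  + intros z Hz. rewrite Rmin_left in Hz by easy.
    unfold k. rewrite (char_kernel_ext K rho alpha tau sig) by (apply Htau_sig; lra).
    unfold char_kernel, kernel, bdry, sig, char_time. eq_in_R. field.
    repeat split; try lra.
  + replace ((G z0 - G b) / (K * rho)) with (scal (/ (K * rho)) (RInt (V := R_CompleteNormedModule) k z0 b)).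
    * apply (is_RInt_scal (V := R_NormedModule)). apply (RInt_correct (V := R_CompleteNormedModule)). apply Exk; lra.
    * rewrite <- Inc0 by easy. apply Rmult_comm.
- replace (G z0 / (K * rho)) with ((G z0 - 0) / (K * rho)) by (unfold Rdiv; now rewrite Rminus_0_r).
  change (is_lim (fun b => (G z0 - G b) / (K * rho)) p_infty (Finite ((G z0 - 0) / (K * rho)))).
  apply (is_lim_scal_r _ (/ (K * rho)) p_infty (Finite (G z0 - 0))).
  apply (is_lim_minus' _ _ p_infty (G z0) 0); [apply is_lim_const|exact HGlim].
Qed.

Theorem theorem1 (K rho : R) (P : R -> R -> R) (alpha : R -> R)
  (HK : 0 < K) (Hrho : 0 < rho) (HP : american_put_fbp K rho P alpha) :
  (exists Q : C -> R -> C,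
     forall t : R, 0 < t ->
       (forall theta : C, 0 < Re theta ->
          is_laplace (fun V => Ptilde K P alpha V t) theta (Q theta t)) /\
       (forall theta : C, 0 < Re theta -> ex_derive (fun w : C => Q w t) theta) /\
       (forall theta : R, 0 < theta ->
          exists I : R, is_kernel_integral rho alpha theta t I /\
            Q (RtoC theta) t
            = RtoC (K * rho / theta ^ 2 * exp (alpha t * theta) * I)) /\
       (forall (S c : R), alpha t < S -> 0 < c ->
          exists J : C,
            is_vertical_integral
              (fun theta : C => (Cexp (theta * RtoC (S - alpha t)) * Q theta t)%C)
              c J /\
            RtoC (P S t)
            = (RtoC (K - S) + / (2 * RtoC PI * Ci) * J)%C)) /\
  (forall theta : R, 0 < theta ->
     is_kernel_integral rho alpha theta 0 (exp (- (K * theta)) / (K * rho))).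
Proof.
set (u := fun t V => excess K P (alpha t + Rmax V 0) t).
assert (Cu : forall t V, 0 <= t -> continuous (u t) V).
{ intros t V Ht. apply (continuity_2d_pt_section (shifted_excess K P alpha (fun _ => t)) 0 V).
  apply (continuity_2d_pt_excess_ge0 K rho); auto. apply continuous_const. }
assert (Bu : forall t, 0 <= t -> exists B, 0 <= B /\ forall V, 0 <= V -> Rabs (u t V) <= B + V).
{ intros t Ht. destruct (put_linear_growth K rho P alpha t HK HP) as [B [HB HBd]].
  pose proof (fbp_alpha_pos _ _ _ _ HP t Ht) as Ha.
  exists (B + alpha t). split; [lra|]. intros V HV. unfold u. rewrite Rmax_left by easy.
  rewrite Rplus_assoc. apply HBd; lra. }
split.
(* The transform on the whole half-plane is taken as [Q]. The kernel formula is then needed on the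
   real axis only, and complex differentiability makes [Q] its analytic continuation. *)
- exists (fun theta t => laplace (u t) theta). intros t Ht.
  destruct (Bu t ltac:(lra)) as [B [HB HBt]].
  assert (Hs : subexp (u t)) by (now apply (subexp_linear _ B)).
  assert (Cut : forall V, continuous (u t) V) by (intros; apply Cu; lra).
  pose proof (fbp_alpha_pos _ _ _ _ HP t ltac:(lra)) as Ha.
  split; [|split; [|split]].
  + intros theta Hth. unfold is_laplace.
    apply (is_RInt_gen_ext (V := C_R_NormedModule) (laplace_integrand (u t) theta)).
    * apply (Filter_prod _ _ _ (fun x => x = 0) (fun b => 0 < b)); [easy|now exists 0|].
      intros x b -> Hb V HV. simpl in HV. rewrite Rmin_left in HV by lra.
      unfold laplace_integrand, u, excess, Ptilde. rewrite Rmax_left by lra.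
      now rewrite (Rplus_comm (alpha t) V).
    * now apply (is_laplace_laplace (u t) theta Cut Hs).
  + intros theta Hth. eexists. now apply is_derive_laplace.
  + intros theta Hth. eexists. split; [now apply (kernel_integral K rho P alpha theta t HK Hrho HP Hth); lra|].
    rewrite (laplace_rlaplace (u t) B theta) by assumption. f_equal. fold (u t).
    assert (E : exp (alpha t * theta) * exp (- (theta * alpha t)) = 1).
    { rewrite <- exp_plus, <- exp_0. f_equal. ring. }
    transitivity (exp (alpha t * theta) * exp (- (theta * alpha t)) * rlaplace (u t) theta).
    * rewrite E. ring.
    * field. repeat split; lra.
  + intros S c HS Hc.
    (* The kink of [Rmax] is at 0, away from [S - alpha t > 0], and [P] is differentiable in the
       continuation region. *)
    assert (Hdu : ex_derive (u t) (S - alpha t)).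
    { apply (ex_derive_ext_loc (fun V => excess K P (alpha t + V) t)).
      - generalize (open_gt 0 (S - alpha t) ltac:(lra)). apply filter_imp. intros V HV.
        unfold u. now rewrite Rmax_left by lra.
      - apply (ex_derive_comp (fun S => excess K P S t) (fun V => alpha t + V)); [|auto_derive; trivial].
        replace (alpha t + (S - alpha t)) with S by ring.
        eexists. now apply (is_derive_excess_S K rho P alpha HP). }
    (* The purely imaginary number [2 * PI * i * u t (S - alpha t)]. *)
    exists (0, 2 * PI * u t (S - alpha t)). split.
    * apply bromwich_inversion; try assumption; lra.
    * assert (Eu : u t (S - alpha t) = P S t - (K - S)).
      { unfold u, excess. rewrite Rmax_left by lra. now replace (alpha t + (S - alpha t)) with S by ring. }
      replace ((0, 2 * PI * u t (S - alpha t)) : C) with (2 * RtoC PI * Ci * RtoC (u t (S - alpha t)%R))%C.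
      2: { unfold Cmult, Ci, RtoC; simpl. f_equal; ring. }
      rewrite Cmult_assoc, Cinv_l, Cmult_1_l.
      2: { pose proof PI_RGT_0. intros E. apply (f_equal snd) in E. unfold Cmult, Ci, RtoC in E; simpl in E. lra. }
      rewrite <- RtoC_plus. f_equal. rewrite Eu. ring.
- intros theta Hth.
  pose proof (kernel_integral K rho P alpha theta 0 HK Hrho HP Hth ltac:(lra)) as H.
  fold (u 0) in H. rewrite (rlaplace_id (u 0) theta) in H; [|intros V HV|exact Hth].
  + rewrite (fbp_alpha_0 _ _ _ _ HP) in H.
    replace (exp (- (K * theta))) with (theta ^ 2 * exp (- (theta * K)) * / theta ^ 2); [exact H|].
    rewrite (Rmult_comm theta K). field. lra.
  + unfold u, excess. rewrite (fbp_alpha_0 _ _ _ _ HP), (Rmax_left V 0) by easy.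
    rewrite (fbp_initial _ _ _ _ HP) by lra. rewrite Rmax_right by lra. ring.
Qed.
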